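(* Let $G$ be a graph, let $k$ be a positive integer, let $m$ be a positive integer, and let $f:V(G)\rightarrow \mathbb{Z}_k$ be a mapping compatible with $G$. If $G$ is $(2m+6k-5)$-tree-connected, then $G$ has an $m$-tree-connected factor $H$ such that $d_H(v)\equiv f(v)\pmod k$ for every vertex $v$, and for each vertex $v$, $$\left\lfloor \frac{d_G(v)}{2} \right\rfloor -(k-1) \le d_H(v) \le \left\lceil \frac{d_G(v)}{2}\right\rceil+(k-1)+m.$$
   Context: Graphs may have loops and multiple edges. A factor of $G$ is a spanning subgraph. A graph is $m$-tree-connected if it contains $m$ edge-disjoint spanning trees. For a set $A\subseteq V(G)$, $e_G(A)$ is the number of edges of $G$ with both ends in $A$. A mapping $f:V(G)\to\mathbb{Z}_k$ is compatible with $G$ with respect to a partition $X,Y$ of $V(G)$ if either $\sum_{v\in X} f(v)-2x\equiv \sum_{v\in Y}f(v) \pmod k$ for some integer $x$ with $0\le x\le e_G(X)$, or $\sum_{v\in X} f(v)\equiv \sum_{v\in Y}f(v)-2y \pmod k$ for some integer $y$ with $0\le y\le e_G(Y)$; $f$ is compatible with $G$ if it is compatible with $G$ with respect to every partition $X,Y$ of $V(G)$. *)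

(* Defs.v *)
From HB Require Import structures.
From mathcomp Require Import all_boot all_order all_algebra.

Set Implicit Arguments.
Unset Strict Implicit.
Unset Printing Implicit Defensive.

Import GRing.Theory.

(* Finite undirected graphs with loops and multiple edges. The order of the two
   ends of an edge carries no meaning: every notion below is invariant under
   swapping them. *)
Record multigraph : Type := Multigraph {
  vertex : finType;
  edge : finType;
  ends : edge -> vertex * vertex
}.

(* A factor of G is given by its edge set F : {set edge G}; the graph G itself
   is the factor [set: edge G]. *)
Section Factors.

Variable G : multigraph.
Implicit Types (F T : {set edge G}) (A X Y : {set vertex G}).

(* A loop contributes 2 to the degree of its vertex. *)
Definition degree F (v : vertex G) : nat :=
  \sum_(e in F) (((ends e).1 == v) + ((ends e).2 == v)).

Definition edges_inside F A : nat :=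
  #|[set e in F | ((ends e).1 \in A) && ((ends e).2 \in A)]|.

Definition adjacent F : rel (vertex G) := fun u v =>
  [exists e in F, (ends e == (u, v)) || (ends e == (v, u))].

Definition connected F : Prop := forall u v, connect (adjacent F) u v.

(* A dart (e, b) is the edge e together with a direction of traversal. *)
Definition dart : Type := (edge G * bool)%type.

Definition dart_tail (d : dart) : vertex G :=
  if d.2 then (ends d.1).2 else (ends d.1).1.

Definition dart_head (d : dart) : vertex G :=
  if d.2 then (ends d.1).1 else (ends d.1).2.

(* Loops are the cycles of length 1 and pairs of parallel edges those of
   length 2; requiring distinct edges excludes going back and forth along a
   single edge. *)
Definition is_cycle F (c : seq dart) : Prop :=
  [/\ c != [::],
      all (fun d => d.1 \in F) c,
      cycle (fun d d' => dart_head d == dart_tail d') c,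
      uniq [seq dart_tail d | d <- c] &
      uniq [seq d.1 | d <- c]].

Definition acyclic F : Prop := forall c : seq dart, ~ is_cycle F c.

Definition spanning_tree T : Prop := connected T /\ acyclic T.

Definition tree_connected (m : nat) F : Prop :=
  exists T : 'I_m -> {set edge G},
    (forall i, T i \subset F /\ spanning_tree (T i)) /\
    (forall i j, i != j -> [disjoint T i & T j]).

(* Z_k is represented by the residues 'I_k = {0, ..., k-1}, also when k = 1. *)
Definition compatible_wrt (k : nat) (f : vertex G -> 'I_k) F X Y : Prop :=
  (exists2 x : nat, x <= edges_inside F X &
     (\sum_(v in X) (f v)%:Z - 2 * x%:Z = \sum_(v in Y) (f v)%:Z
        %[mod k%:Z])%Z%R) \/
  (exists2 y : nat, y <= edges_inside F Y &
     (\sum_(v in X) (f v)%:Z = \sum_(v in Y) (f v)%:Z - 2 * y%:Z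
        %[mod k%:Z])%Z%R).

(* One of the two parts may be empty. This matters only when G has a single
   vertex, which would otherwise impose no condition on f. *)
Definition compatible (k : nat) (f : vertex G -> 'I_k) F : Prop :=
  forall X Y, X :|: Y = [set: vertex G] -> [disjoint X & Y] ->
    compatible_wrt f F X Y.

End Factors.

(* Main.v *)
Require Import Defs.
From HB Require Import structures.
From mathcomp Require Import all_boot all_order all_algebra.
From mathcomp Require Import all_fingroup zify.

(** Keep [k - 1] edges with both ends on one side of a suitable bipartition [X, Y]
    aside, and split the other edges into a part [P] and a bipartite part [F].

    The bipartition is a maximum cut of [6k - 4] of the given trees, so that by tree
    packing the cut contains a spanning tree and a disjoint [(3k-3)]-edge-connected
    factor. A parity join inside that tree makes all degrees of [P] even; then [P] is
    [2m]-edge-connected and has an Eulerian, hence [m]-arc-connected, orientation.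
    Edmonds' theorem gives [m] arborescences in it. Following a closed Eulerian trail and
    choosing every edge that lies on an arborescence, and otherwise the opposite of the
    successor's choice, yields [Q] with [d_P / 2 <= d_Q <= d_P / 2 + m].

    Choosing a factor of the bipartite part [F] is the same as orienting it (chosen
    edges go from [X] to [Y]), and the required residues are obtained from the theorem of
    Lovasz, Thomassen, Wu and Zhang on orientations modulo [k], proved here with bounds
    on the out-degrees. The edges that were set aside become arcs to one additional
    vertex; compatibility is what makes the residues sum up correctly. *)

Set Implicit Arguments.
Unset Strict Implicit.
Unset Printing Implicit Defensive.

Import Order.TTheory GRing.Theory Num.Theory.

(** * Residues modulo [2k] *)

(** The net out-degree is twice the out-degree minus the degree, so prescribing out-degrees modulo
    [k] means prescribing net out-degrees modulo [2k]. Reversing all arcs then merely negates the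
    targets.

    The orientation theorem goes by induction, and contracting a tight set leaves a subproblem whose
    boundary edges are already directed. Hence the outside vertex with pre-directed arcs is part of
    the inductive statement; the edges set aside only reuse it.

    Constants: a cut must have size [2k - 2] plus a norm that is at most [k], and parity saves one,
    whence [3k - 3]. One more tree for the parity join gives [3k - 2], doubled to [6k - 4] because a
    maximum cut keeps only half of each boundary. The other [2m - 1] trees make [P]
    [(2m - 1)]-edge-connected, and its even degrees supply the missing unit. Setting [k - 1] edges
    aside suffices since from 0 to [k - 1] of them can be used, one number for each residue. *)

Section Residues.

Variable k : nat.
Definition eqm (a b : int) : Prop := exists j : int, (a = b + j * Posz (2 * k))%R.

Lemma eqm_refl a : eqm a a. Proof. by exists 0%R; lia. Qed.

Lemma eqm_sym a b : eqm a b -> eqm b a.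
Proof. by case=> j ->; exists (- j)%R; lia. Qed.

Lemma eqm_trans b a c : eqm a b -> eqm b c -> eqm a c.
Proof. by case=> j -> [l ->]; exists (l + j)%R; lia. Qed.

Lemma eqmD a b a' b' : eqm a b -> eqm a' b' -> eqm (a + a')%R (b + b')%R.
Proof. by case=> j -> [l ->]; exists (l + j)%R; lia. Qed.

Lemma eqmN a b : eqm a b -> eqm (- a)%R (- b)%R.
Proof. by case=> j ->; exists (- j)%R; lia. Qed.

Lemma eqm_sum (I : finType) (P : pred I) (F H : I -> int) :
  (forall i, P i -> eqm (F i) (H i)) -> eqm (\sum_(i | P i) F i)%R (\sum_(i | P i) H i)%R.
Proof.
move=> FH; apply: (big_ind2 eqm) => // [|a b a' b']; first exact: eqm_refl.
exact: eqmD.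
Qed.

Hypothesis k_gt0 : 0 < k.

(** The distance from [z] to the nearest multiple of [2k]. *)
Definition nrm (z : int) : nat :=
  let r := absz (z %% Posz (2 * k))%Z in minn r (2 * k - r).

Lemma nrmP z : exists r : nat, [/\ eqm z (Posz r), r < 2 * k & nrm z = minn r (2 * k - r)].
Proof.
exists (absz (z %% Posz (2 * k))%Z); split=> //; last first.
  by have := @ltz_pmod z (Posz (2 * k)); have := @modz_ge0 z (Posz (2 * k)); lia.
exists (z %/ Posz (2 * k))%Z.
by have := divz_eq z (Posz (2 * k)); have := @modz_ge0 z (Posz (2 * k)); lia.
Qed.

Lemma nrm_le z : nrm z <= k.
Proof. by case: (nrmP z) => r [_ _ ->]; lia. Qed.

Lemma nrm_min z (y : int) : eqm z y -> nrm z <= absz y.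
Proof.
case: (nrmP z) => r [[j ->] rk ->] [l El].
have [lj|[lj|lj]] : (l = j \/ l + 1 <= j \/ j + 1 <= l)%R by lia.
- by subst; lia.
- have : ((j - l) * Posz (2 * k) >= Posz (2 * k))%R by nia.
  by nia.
- have : ((l - j) * Posz (2 * k) >= Posz (2 * k))%R by nia.
  by nia.
Qed.

Lemma nrm_rep z : eqm z (Posz (nrm z)) \/ eqm z (- Posz (nrm z))%R.
Proof.
case: (nrmP z) => r [[j ->] rk ->].
have [?|?] := leqP r (2 * k - r).
  by left; exists j; lia.
by right; exists (j + 1)%R; lia.
Qed.

Lemma nrm_eqm a b : eqm a b -> nrm a = nrm b.
Proof.
suff H x y : eqm x y -> nrm x <= nrm y.
  by move=> ab; apply/eqP; rewrite eqn_leq !H //; exact: eqm_sym.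
move=> xy; have [E|E] := nrm_rep y.
  by have := nrm_min (eqm_trans xy E); lia.
by have := nrm_min (eqm_trans xy E); lia.
Qed.

Lemma nrmN a : nrm (- a)%R = nrm a.
Proof.
suff H x : nrm (- x)%R <= nrm x.
  by apply/eqP; rewrite eqn_leq H /= -{1}[a]opprK H.
have [E|E] := nrm_rep x; have := nrm_min (eqmN E); lia.
Qed.

Lemma nrmD a b : nrm (a + b)%R <= nrm a + nrm b.
Proof.
by have [Ea|Ea] := nrm_rep a; have [Eb|Eb] := nrm_rep b;
  have := nrm_min (eqmD Ea Eb); lia.
Qed.

Lemma nrm_abs a : nrm a <= absz a.
Proof. by apply: nrm_min; exact: eqm_refl. Qed.

Lemma nrm_shift a b : nrm a <= nrm (a + b)%R + absz b.
Proof.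
have := nrmD (a + b)%R (- b)%R; have := nrm_abs (- b)%R.
rewrite addrK; lia.
Qed.

Lemma odd_nrm z : odd (nrm z) = odd (absz z).
Proof.
by case: (nrm_rep z) => -[j Ej]; rewrite {2}Ej; lia.
Qed.

Lemma nrm0_eqm z : nrm z = 0 -> eqm z 0%R.
Proof. by move=> z0; case: (nrm_rep z); rewrite z0 ?oppr0. Qed.

(* The value of [nrm] away from the multiples of [k] singles out one of
   the two residues; [pos] fixes the sign, a residue [k] being both. *)
Definition pos (z : int) : Prop := eqm z (Posz (nrm z)).

Lemma posVneg z : pos z \/ pos (- z)%R.
Proof.
rewrite /pos nrmN; case: (nrm_rep z) => E; [by left | right].
by have := eqmN E; rewrite opprK.
Qed.

Lemma pos_dec z : 0 < nrm z -> pos z -> nrm (z - 1)%R = (nrm z).-1.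
Proof.
move=> z0 /(eqmD) /(_ (eqm_refl (-1)%R)) E; apply/eqP; rewrite eqn_leq.
have := nrm_min E; have := nrm_shift z (-1)%R; lia.
Qed.

Lemma neg_inc z : 0 < nrm z -> pos (- z)%R -> nrm (z + 1)%R = (nrm z).-1.
Proof.
by move=> z0 zn; rewrite -nrmN opprD pos_dec ?nrmN.
Qed.

Lemma pos_k z : nrm z = k -> pos z /\ pos (- z)%R.
Proof.
rewrite /pos nrmN => zk; rewrite zk.
case: (nrm_rep z); rewrite zk => -[j E]; split; first by exists j.
- by exists (- j - 1)%R; lia.
- by exists (j - 1)%R; lia.
- by exists (- j)%R; lia.
Qed.

(** If [absz net >= 2k], one period towards zero gives [nrm net <= absz net - 2k <= nrm z - 2],
    although both norms agree. So at a vertex of small degree [d] the congruence alone implies the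
    bound. *)
Lemma net_bound (net : int) (z : int) (d : nat) :
  eqm net z -> absz net <= d -> d <= 2 * k - 2 + nrm z -> absz net <= 2 * k - 1.
Proof.
move=> E netd dz; rewrite leqNgt; apply/negP=> big.
rewrite -(nrm_eqm E) in dz.
have zk := nrm_le net.
have : nrm net <= absz net - 2 * k.
  have [n0|n0] : (0 <= net \/ net <= 0)%R by lia.
  - have /nrm_min : eqm net (net - Posz (2 * k))%R by exists 1%R; lia.
    by lia.
  - have /nrm_min : eqm net (net + Posz (2 * k))%R by exists (-1)%R; lia.
    by lia.
lia.
Qed.

End Residues.

(** * Orientations modulo [k] *)

Section Weights.

Variable T : finType.
Implicit Types (e : T -> T -> nat) (W A B : {set T}) (u v w x y : T).

Definition cut e W A := \sum_(x in A) \sum_(y in W :\: A) e x y.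

Definition edge1 u v x y : nat := ((x == u) && (y == v)) + ((x == v) && (y == u)).

Definition arc1 u v x y : nat := (x == u) && (y == v).

Lemma eq_cut e e' W A : e =2 e' -> cut e W A = cut e' W A.
Proof. by move=> ee; apply: eq_bigr => x _; apply: eq_bigr => y _. Qed.

Lemma cutD e e' W A : cut (fun x y => e x y + e' x y) W A = cut e W A + cut e' W A.
Proof. by rewrite /cut -big_split; apply: eq_bigr => x _; rewrite -big_split. Qed.

Lemma sum_delta v A : \sum_(x in A) (x == v : nat) = (v \in A).
Proof.
rewrite -big_mkcondr /= sum1dep_card; case: (boolP (v \in A)) => vA.
  rewrite (_ : [set _ | _] = [set v]) ?cards1 //.
  by apply/setP=> x; rewrite !inE; case: eqP => [->|]; rewrite ?vA ?andbF.
apply: eq_card0 => x; rewrite !inE; case: eqP => [->|]; last by rewrite andbF.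
by rewrite (negbTE vA).
Qed.

Lemma sum_deltaD (h : T -> nat) v A :
  \sum_(x in A) (h x + (x == v)) = \sum_(x in A) h x + (v \in A).
Proof. by rewrite big_split /= sum_delta. Qed.

Lemma sum_arc1 u v x W : v \in W -> \sum_(y in W) arc1 u v x y = (x == u).
Proof.
move=> vW; rewrite /arc1; case: (x == u) => /=; last by rewrite big1.
by rewrite sum_delta vW.
Qed.

Lemma sum_arc1r u v x W : u \in W -> \sum_(y in W) arc1 u v y x = (x == v).
Proof.
move=> vW; rewrite /arc1; case: (x == v); last by rewrite big1 // => y; rewrite andbF.
by under eq_bigr do rewrite andbT; rewrite sum_delta vW.
Qed.

Lemma sum2_arc1 u v A B : \sum_(x in A) \sum_(y in B) arc1 u v x y = (u \in A) && (v \in B).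
Proof.
rewrite /arc1; case: (boolP (v \in B)) => vB.
  by under eq_bigr do rewrite sum_arc1 //; rewrite sum_delta andbT.
rewrite andbF big1 // => x _; rewrite big1 // => y yB.
by case: eqP => //= _; case: eqP => // yv; move: vB; rewrite -yv yB.
Qed.

Lemma edge1E u v x y : edge1 u v x y = arc1 u v x y + arc1 v u x y.
Proof. by []. Qed.

Lemma arc1C u v x y : arc1 u v y x = arc1 v u x y.
Proof. by rewrite /arc1 andbC. Qed.

Lemma edge1C u v x y : edge1 u v x y = edge1 u v y x.
Proof. by rewrite /edge1 addnC andbC [(y == v) && _]andbC. Qed.

Lemma edge1CC u v x y : edge1 u v x y = edge1 v u x y.
Proof. by rewrite /edge1 addnC. Qed.

Lemma edge1_irr u v x : u != v -> edge1 u v x x = 0.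
Proof.
by move=> uv; rewrite /edge1; case: (x =P u) => [->|_]; rewrite ?(negbTE uv) ?andbF.
Qed.

Lemma cut_edge1 u v W A : u \in W -> v \in W ->
  cut (edge1 u v) W A = (u \in A) (+) (v \in A).
Proof.
move=> uW vW; rewrite (@eq_cut _ (fun x y => arc1 u v x y + arc1 v u x y)) //.
rewrite cutD /cut !sum2_arc1 !inE uW vW !andbT.
by case: (u \in A); case: (v \in A).
Qed.

Lemma sum2_edge1 u v W : u \in W -> v \in W ->
  \sum_(x in W) \sum_(y in W) edge1 u v x y = 2.
Proof.
move=> uW vW; under eq_bigr do under eq_bigr do rewrite edge1E.
by under eq_bigr do rewrite big_split /=; rewrite big_split /= !sum2_arc1 uW vW.
Qed.

Lemma sum2D e e' W : \sum_(x in W) \sum_(y in W) (e x y + e' x y) =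
  \sum_(x in W) \sum_(y in W) e x y + \sum_(x in W) \sum_(y in W) e' x y.
Proof. by rewrite -big_split; apply: eq_bigr => x _; rewrite -big_split. Qed.

(** An arbitrary reference orientation, following the enumeration of [T]. It shows that degree sums
    are even, and it is already a solution when [k = 1]. *)
Definition orient e x y := if enum_rank x < enum_rank y then e x y else 0.

Lemma orientE e : (forall x y, e x y = e y x) -> (forall x, e x x = 0) ->
  forall x y, orient e x y + orient e y x = e x y.
Proof.
move=> eC e0 x y; rewrite /orient; case: ltngtP => [_|_|/val_inj/enum_rank_inj ->].
- by rewrite addn0.
- by rewrite eC.
- by rewrite e0.
Qed.

Lemma sum2_even e A : (forall x y, e x y = e y x) -> (forall x, e x x = 0) ->
  ~~ odd (\sum_(x in A) \sum_(y in A) e x y).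
Proof.
move=> eC e0; under eq_bigr do under eq_bigr do rewrite -(orientE eC e0).
rewrite (sum2D (orient e) (fun x y => orient e y x)) [X in _ + X]exchange_big /=.
by rewrite addnn odd_double.
Qed.

Lemma sum_setD e W A x : A \subset W ->
  \sum_(y in W) e x y = \sum_(y in A) e x y + \sum_(y in W :\: A) e x y.
Proof.
move=> AW; rewrite (bigID (mem A)) /=; congr (_ + _); apply: eq_bigl => y.
  by rewrite andbC; case: (boolP (y \in A)) => //= /(subsetP AW) ->.
by rewrite !inE andbC.
Qed.

Lemma cut1 e W x : e x x = 0 -> x \in W -> cut e W [set x] = \sum_(y in W) e x y.
Proof.
move=> e0 xW; rewrite /cut big_set1 (@sum_setD e W [set x]) ?sub1set //.
by rewrite big_set1 e0.
Qed.

Lemma cut_union e W A B : (forall x y, e x y = e y x) -> A \subset W -> B \subset W ->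
  [disjoint A & B] ->
  cut e W (A :|: B) + 2 * \sum_(x in A) \sum_(y in B) e x y = cut e W A + cut e W B.
Proof.
move=> eC AW BW dAB; rewrite /cut.
have dAB' : A :&: B = set0 by apply/eqP; rewrite setI_eq0.
have sA : B \subset W :\: A.
  by apply/subsetP=> x xB; rewrite inE (subsetP BW) // andbT (disjointFl dAB).
have sB : A \subset W :\: B.
  by apply/subsetP=> x xB; rewrite inE (subsetP AW) // andbT (disjointFr dAB).
have EA x : \sum_(y in W :\: A) e x y =
    \sum_(y in B) e x y + \sum_(y in W :\: (A :|: B)) e x y.
  by rewrite (sum_setD _ _ sA) setDDl.
have EB x : \sum_(y in W :\: B) e x y =
    \sum_(y in A) e x y + \sum_(y in W :\: (A :|: B)) e x y.
  by rewrite (sum_setD _ _ sB) setDDl setUC.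
under [X in _ = X + _]eq_bigr do rewrite EA.
under [X in _ = _ + X]eq_bigr do rewrite EB.
rewrite (eq_bigl [predU A & B]); last by move=> x; rewrite !inE.
rewrite bigU //= !big_split /= [\sum_(x in B) \sum_(y in A) _]exchange_big /=.
under [\sum_(j in A) \sum_(i in B) e i j]eq_bigr do under eq_bigr do rewrite eC.
by lia.
Qed.

Lemma cut_compl e W A : (forall x y, e x y = e y x) -> A \subset W ->
  cut e W (W :\: A) = cut e W A.
Proof.
move=> eC AW; rewrite /cut exchange_big /= setDDr setDv set0U (setIidPr AW).
by apply: eq_bigr => x _; apply: eq_bigr => y _; rewrite eC.
Qed.

Lemma cutW e W : cut e W W = 0.
Proof. by rewrite /cut setDv big1 // => x _; rewrite big_set0. Qed.

(** Serves to distribute the number of edges leaving a contracted set among the vertices of that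
    set. *)
Lemma split_sum (A : {set T}) (h : T -> nat) n : n <= \sum_(x in A) h x ->
  exists2 h' : T -> nat, (forall x, h' x <= h x) & \sum_(x in A) h' x = n.
Proof.
elim: n => [|n IHn] le_n; first by exists (fun=> 0) => //; rewrite big1.
have [h' h'h En] := IHn (ltnW le_n).
have [/existsP [x /andP[xA ltx]]|] := boolP [exists x, (x \in A) && (h' x < h x)].
  exists (fun y => h' y + (y == x)); last by rewrite sum_deltaD En xA addn1.
  by move=> y; case: eqP => [->|_]; rewrite ?addn1 // addn0.
rewrite negb_exists => /forallP hx.
suff : \sum_(x in A) h x <= \sum_(x in A) h' x by lia.
apply: leq_sum => x xA; have := hx x; rewrite xA /= -leqNgt //.
Qed.

End Weights.

(** * Orientation problems with pre-directed arcs to an outside vertex *)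

Section Instances.

Variables (T : finType) (k : nat).
Hypothesis k_gt0 : 0 < k.
Implicit Types (W A B : {set T}) (u v w x y : T).

Local Notation nrm := (nrm k).
Local Notation eqm := (eqm k).
Local Notation pos := (pos k).

(** [iE] gives edge multiplicities. [iP x] and [iQ x] count the arcs that reach [x] from the outside
    vertex and that go from [x] to it; their directions are fixed. [iT] holds the targets for the
    net out-degrees, and [iZ] the vertex, if any, exempt from the cut condition. *)
Record inst := Inst {
  iW : {set T};
  iE : T -> T -> nat;
  iP : T -> nat;
  iQ : T -> nat;
  iT : T -> int;
  iZ : {set T}
}.

Implicit Types I J : inst.

Definition ar I A := \sum_(x in A) (iP I x + iQ I x).
Definition dg I A := cut (iE I) (iW I) A + ar I A.
Definition ts I A : int := (\sum_(x in A) iT I x)%R.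
Definition bal I A := (2 * k - 2 + nrm (ts I A)) <= dg I A.

(** At the outside vertex the degree condition is reversed: [v_arc] is an upper bound where [v_cut]
    is a lower bound. The exemption for one vertex of target 0 allows its degree to fall while its
    edges are lifted away. *)
Record valid I : Prop := Valid {
  v_sym : forall x y, iE I x y = iE I y x;
  v_irr : forall x, iE I x x = 0;
  v_exc : iZ I = set0 \/ exists2 v, iZ I = [set v] & nrm (iT I v) = 0;
  v_par : forall x, x \in iW I -> odd (absz (iT I x)) = odd (dg I [set x]);
  v_sum : eqm (ts I (iW I) + Posz (\sum_(x in iW I) iP I x))%R
              (Posz (\sum_(x in iW I) iQ I x));
  v_arc : ar I (iW I) <= 2 * k - 2 + nrm (ts I (iW I));
  v_cut : forall A, A \subset iW I -> A != set0 -> A != iW I -> A != iZ I -> bal I A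
}.

Definition oriented I (f : T -> T -> nat) :=
  {in iW I &, forall x y, f x y + f y x = iE I x y}.

Definition net I (f : T -> T -> nat) x : int :=
  (Posz (\sum_(y in iW I) f x y + iQ I x) - Posz (\sum_(y in iW I) f y x + iP I x))%R.

Definition solvable I := exists2 f, oriented I f &
  forall x, x \in iW I -> eqm (net I f x) (iT I x) /\ absz (net I f x) <= 2 * k - 1.

Lemma ts1 I x : ts I [set x] = iT I x. Proof. by rewrite /ts big_set1. Qed.

Lemma ar1 I x : ar I [set x] = iP I x + iQ I x. Proof. by rewrite /ar big_set1. Qed.

Lemma ar_sumE I A : ar I A = \sum_(x in A) iP I x + \sum_(x in A) iQ I x.
Proof. by rewrite /ar big_split. Qed.

Lemma tsD I A B : A \subset B -> ts I B = (ts I A + ts I (B :\: A))%R.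
Proof.
move=> AB; rewrite /ts (bigID (mem A)) /=; congr (_ + _)%R; apply: eq_bigl => y.
  by rewrite andbC; case: (boolP (y \in A)) => //= /(subsetP AB) ->.
by rewrite !inE andbC.
Qed.

Lemma arD I A B : A \subset B -> ar I B = ar I A + ar I (B :\: A).
Proof.
move=> AB; rewrite /ar (bigID (mem A)) /=; congr (_ + _); apply: eq_bigl => y.
  by rewrite andbC; case: (boolP (y \in A)) => //= /(subsetP AB) ->.
by rewrite !inE andbC.
Qed.

Lemma ts_le_ar I : valid I -> nrm (ts I (iW I)) <= ar I (iW I).
Proof.
move=> vI; rewrite ar_sumE; case: (v_sum vI) => j Ej.
have /(nrm_min k_gt0) : eqm (ts I (iW I))
  (Posz (\sum_(x in iW I) iQ I x) - Posz (\sum_(x in iW I) iP I x))%R.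
  by exists j; lia.
by lia.
Qed.

Section Valid.

Variable I : inst.
Hypothesis vI : valid I.
Local Notation W := (iW I).

Lemma dg1 x : x \in W -> dg I [set x] = \sum_(y in W) iE I x y + iP I x + iQ I x.
Proof. by move=> xW; rewrite /dg ar1 cut1 ?addnA ?(v_irr vI). Qed.

Lemma dgW : dg I W = ar I W.
Proof. by rewrite /dg cutW. Qed.

Lemma odd_dg A : A \subset W -> odd (absz (ts I A)) = odd (dg I A).
Proof.
move=> AW; have -> : odd (dg I A) = odd (\sum_(x in A) dg I [set x]).
  have -> : \sum_(x in A) dg I [set x] =
      dg I A + \sum_(x in A) \sum_(y in A) iE I x y.
    rewrite /dg /ar /cut -!big_split /=; apply: eq_bigr => x xA.
    have := @dg1 x (subsetP AW _ xA); rewrite /dg /cut !big_set1 ar1 => ->.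
    by rewrite (sum_setD _ _ AW); lia.
  by rewrite oddD (negbTE (sum2_even _ (v_sym vI) (v_irr vI))) addbF.
rewrite /ts; apply: (big_ind2 (fun (a : int) b => odd (absz a) = odd b)) => //.
  by move=> a b a' b'; lia.
by move=> x xA; apply: (v_par vI); apply: (subsetP AW).
Qed.

(** Parity forbids a value just one above the bound, so a set that is not tight has slack 2, which
    is what a single move may consume. *)
Lemma dg_gap A : A \subset W -> 2 * k - 2 + nrm (ts I A) < dg I A ->
  2 * k + nrm (ts I A) <= dg I A.
Proof. by move=> /odd_dg; have := odd_nrm k_gt0 (ts I A); lia. Qed.

Lemma dg_compl A : A \subset W -> dg I A + dg I (W :\: A) =
  2 * cut (iE I) W A + ar I W.
Proof.
move=> AW; rewrite /dg (cut_compl (v_sym vI) AW) (arD _ AW); lia.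
Qed.

Lemma nrm_compl A : A \subset W ->
  nrm (ts I W) <= nrm (ts I A) + nrm (ts I (W :\: A)).
Proof. by move=> AW; rewrite (tsD _ AW) nrmD. Qed.

(** Add the cut conditions of [A] and of its complement; [v_arc] bounds the arcs counted in them.
    For [k > 1] this makes the instance connected. *)
Lemma cut_conn A : A \subset W -> A != set0 -> A != W -> iZ I = set0 ->
  2 * k - 2 + (nrm (ts I A) + nrm (ts I (W :\: A)) - nrm (ts I W)) <=
  2 * cut (iE I) W A.
Proof.
move=> AW A0 AnW Z0.
have A'0 : W :\: A != set0.
  by apply: contra AnW; rewrite setD_eq0 eqEsubset AW => ->.
have A'W : W :\: A != W.
  apply: contra A0 => /eqP A'W; apply/eqP/setP=> x; rewrite inE.
  apply/negP=> xA; have := subsetP AW _ xA; rewrite -A'W inE xA //.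
have := v_cut vI AW A0 AnW; have := v_cut vI (subsetDl _ _) A'0 A'W.
rewrite /bal Z0 A'0 A0 => /(_ isT) c1 /(_ isT) c2.
have := dg_compl AW; have := v_arc vI; have := nrm_compl AW; lia.
Qed.

Lemma dgU1 u v : u \in W -> v \in W -> u != v ->
  dg I [set u; v] + 2 * iE I u v = dg I [set u] + dg I [set v].
Proof.
move=> uW vW uv; have := @cut_union _ (iE I) W [set u] [set v] (v_sym vI).
rewrite !sub1set !big_set1 disjoints1 inE uv => /(_ uW vW isT).
rewrite /dg !ar1 /ar big_setU1 /= ?inE ?uv // big_set1; lia.
Qed.

Lemma ts2 u v : u != v -> ts I [set u; v] = (iT I u + iT I v)%R.
Proof. by move=> uv; rewrite /ts big_setU1 /= ?inE ?uv // big_set1. Qed.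

Lemma net_le f x : oriented I f -> x \in W -> absz (net I f x) <= dg I [set x].
Proof.
move=> fE xW; rewrite dg1 //.
have -> : \sum_(y in W) iE I x y = \sum_(y in W) f x y + \sum_(y in W) f y x.
  by rewrite -big_split; apply: eq_bigr => y yW; rewrite -fE.
by rewrite /net; lia.
Qed.

End Valid.

Definition sz I := \sum_(x in iW I) \sum_(y in iW I) iE I x y.
(** A lexicographic order in one number: in a valid instance the arcs number at most [3k - 2], so
    they cannot outweigh a change in the first factor. *)
Definition mu I := (sz I + #|iW I|) * (3 * k + 1) + ar I (iW I).

Lemma mu_lt1 I J : valid J -> sz J + #|iW J| < sz I + #|iW I| -> mu J < mu I.
Proof.
move=> vJ ltJ; have := v_arc vJ; have := nrm_le k_gt0 (ts J (iW J)); rewrite /mu; nia.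
Qed.

Lemma mu_lt2 I J : sz J + #|iW J| <= sz I + #|iW I| ->
  ar J (iW J) < ar I (iW I) -> mu J < mu I.
Proof. by move=> le1 lt2; rewrite /mu; nia. Qed.

(** Reversal of all directions, so that negative targets need no separate treatment. *)
Definition opp I := Inst (iW I) (iE I) (iQ I) (iP I) (fun x => - iT I x)%R (iZ I).

Lemma ts_opp I A : ts (opp I) A = (- ts I A)%R.
Proof. by rewrite /ts -sumrN. Qed.

Lemma ar_opp I A : ar (opp I) A = ar I A.
Proof. by apply: eq_bigr => x _; rewrite addnC. Qed.

Lemma dg_opp I A : dg (opp I) A = dg I A.
Proof. by rewrite /dg ar_opp. Qed.

Lemma valid_opp I : valid I -> valid (opp I).
Proof.
move=> vI; split=> //=; try by case: vI.
- case: (v_exc vI) => [|[v]]; [by left | by right; exists v => //; rewrite nrmN].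
- by move=> x xW; rewrite dg_opp -(v_par vI) // abszN.
- rewrite ts_opp; case: (v_sum vI) => j E; exists (- j)%R; lia.
- by rewrite ar_opp ts_opp nrmN //; exact: v_arc vI.
- move=> A *; rewrite /bal dg_opp ts_opp nrmN //; exact: v_cut.
Qed.

Lemma solvable_opp I : solvable (opp I) -> solvable I.
Proof.
case=> f fE fN; exists (fun x y => f y x) => [x y xW yW|x xW].
  by rewrite -[RHS](fE x y) // addnC.
have [fN1 fN2] := fN x xW.
have -> : net I (fun x y => f y x) x = (- net (opp I) f x)%R.
  by rewrite /net /=; lia.
by split; [have := eqmN fN1; rewrite /= opprK | rewrite abszN].
Qed.

Lemma mu_opp I : mu (opp I) = mu I.
Proof. by rewrite /mu /sz /= ar_opp. Qed.

End Instances.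

(** * Contracting a tight set *)

Section Contraction.

Variables (T : finType) (k : nat).
Hypothesis k_gt0 : 0 < k.
Implicit Types (W A B : {set T}) (u v w x y : T).

Local Notation nrm := (nrm k).
Local Notation eqm := (eqm k).
Local Notation valid := (@valid T k).
Local Notation solvable := (@solvable T k).

Lemma big_fibers (R : Type) (idx : R) (op : Monoid.com_law idx) (c : T -> T)
    (W B : {set T}) (F : T -> R) :
  \big[op/idx]_(x in B) \big[op/idx]_(z in W | c z == x) F z =
  \big[op/idx]_(z in [set z in W | c z \in B]) F z.
Proof.
rewrite [RHS](partition_big c (mem B)) /=; last by move=> z; rewrite inE => /andP[].
apply: eq_bigr => x xB; apply: eq_bigl => z; rewrite !inE.
by case: (z \in W) => //=; case: eqP => [->|]; rewrite ?xB ?andbF.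
Qed.

Variable I : inst T.
Hypothesis vI : valid I.
Variable A : {set T}.
Hypotheses (AW : A \subset iW I) (AnW : A != iW I) (A_gt1 : 1 < #|A|).
Variable a : T.
Hypothesis aA : a \in A.

Local Notation W := (iW I).
Local Notation e := (iE I).

(** [A] is contracted onto one of its own elements, which keeps the quotient inside the type [T]. *)
Let c z := if z \in A then a else z.

(** The contracted vertex is not exempt even if [A] contains the exempt vertex: it stands for a set
    of at least two vertices, to which the cut condition applies. *)
Definition quo := Inst (c @: W)
  (fun x y => if x == y then 0 else
     \sum_(z in W | c z == x) \sum_(z' in W | c z' == y) e z z')
  (fun x => \sum_(z in W | c z == x) iP I z)
  (fun x => \sum_(z in W | c z == x) iQ I z)
  (fun x => \sum_(z in W | c z == x) iT I z)%R
  (iZ I :\: A).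

Local Notation pre B := [set z in W | c z \in B].

Lemma ts_quo B : ts quo B = ts I (pre B).
Proof. exact: (@big_fibers _ 0%R +%R). Qed.

Lemma ar_quo B : ar quo B = ar I (pre B).
Proof.
by rewrite /ar -big_fibers; apply: eq_bigr => x _; rewrite big_split.
Qed.

Lemma dg_quo B : B \subset c @: W -> dg quo B = dg I (pre B).
Proof.
move=> BW; rewrite /dg ar_quo; congr (_ + _).
rewrite /cut /= -big_fibers; apply: eq_bigr => x xB.
transitivity (\sum_(y in (c @: W) :\: B) \sum_(z in W | c z == x)
                \sum_(z' in W | c z' == y) e z z').
  apply: eq_bigr => y; rewrite inE => /andP[yB _].
  by case: eqP => // xy; move: yB; rewrite -xy xB.
rewrite exchange_big /=; apply: eq_bigr => z _; rewrite big_fibers.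
apply: eq_bigl => z'; rewrite !inE; case: (boolP (z' \in W)) => //= z'W.
by rewrite imset_f ?andbT.
Qed.

Lemma pre_quo : pre (c @: W) = W.
Proof. by apply/setP=> z; rewrite inE; case: (boolP (z \in W)) => //= zW; rewrite imset_f. Qed.

Lemma c_out z : z \notin A -> c z = z. Proof. by rewrite /c => /negbTE ->. Qed.

Lemma c_in z : z \in A -> c z = a. Proof. by rewrite /c => ->. Qed.

Lemma c_eqa z : (c z == a) = (z \in A).
Proof.
rewrite /c; case: (boolP (z \in A)) => zA; rewrite ?eqxx //.
by apply/eqP=> za; move: zA; rewrite za aA.
Qed.

Lemma c_eqx z x : x \notin A -> (c z == x) = (z == x).
Proof.
move=> xA; rewrite /c; case: (boolP (z \in A)) => // zA.
by apply/eqP/eqP=> E; move: xA; rewrite -E ?aA ?zA.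
Qed.

Lemma quoW : c @: W = a |: (W :\: A).
Proof.
apply/setP=> x; rewrite !inE; apply/imsetP/idP.
  case=> z zW ->; rewrite c_eqa; case: (boolP (z \in A)) => //= zA.
  by rewrite c_out // zA.
case/orP=> [/eqP->|/andP[xA xW]]; last by exists x; rewrite ?c_out.
by exists a; rewrite ?c_in // (subsetP AW).
Qed.

Lemma card_quo : #|c @: W| < #|W|.
Proof.
rewrite quoW cardsU1 !inE aA /= add1n cardsD (setIidPr AW).
have := subset_leq_card AW; lia.
Qed.

Lemma sz_quo : sz quo <= sz I.
Proof.
rewrite /sz /=.
apply: (@leq_trans (\sum_(x in c @: W) \sum_(y in c @: W) \sum_(z in W | c z == x)
   \sum_(z' in W | c z' == y) e z z')).
  by apply: leq_sum => x _; apply: leq_sum => y _; case: eqP.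
under eq_bigr => x _ do rewrite exchange_big /=.
rewrite big_fibers pre_quo; apply: leq_sum => z _.
by rewrite big_fibers pre_quo.
Qed.

Lemma valid_quo : valid quo.
Proof.
split=> /=.
- move=> x y; rewrite eq_sym; case: eqP => // _; rewrite exchange_big /=.
  by apply: eq_bigr => z _; apply: eq_bigr => z' _; rewrite (v_sym vI).
- by move=> x; rewrite eqxx.
- case: (v_exc vI) => [->|[v -> v0]]; first by left; rewrite set0D.
  case: (boolP (v \in A)) => vA.
    by left; apply/eqP; rewrite setD_eq0 sub1set.
  have [vW|vW] := boolP (v \in W); last first.
    right; exists v; first by apply/setDidPl; rewrite disjoints1.
    rewrite big1 ?(@nrm_abs k k_gt0 0) //; last first.
      by move=> z /andP[zW]; rewrite c_eqx // => /eqP zv; move: vW; rewrite -zv zW.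
    by apply/eqP; rewrite -leqn0; exact: (nrm_abs k_gt0 0%R).
  right; exists v; first by apply/setDidPl; rewrite disjoints1.
  rewrite (big_pred1 v) // => z /=; rewrite c_eqx //.
  by case: eqP => [->|]; rewrite ?vW ?andbF.
- move=> x xW; rewrite dg_quo ?sub1set //.
  have -> : (\sum_(z in W | c z == x) iT I z)%R = ts I (pre [set x]).
    by apply: eq_bigl => z; rewrite !inE.
  by apply: (odd_dg k_gt0 vI); apply/subsetP=> z; rewrite inE => /andP[].
- rewrite ts_quo; have := @big_fibers _ 0%N addn c W (c @: W).
  by move=> BF; rewrite !BF pre_quo; exact: v_sum vI.
- by rewrite ar_quo ts_quo pre_quo; exact: v_arc vI.
move=> B BW B0 BnW BZ; rewrite /bal dg_quo // ts_quo.
have sub : pre B \subset W by apply/subsetP=> z; rewrite inE => /andP[].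
have preP x : x \in B -> exists z, [/\ z \in W, c z = x & z \in pre B].
  move=> xB; have /imsetP[z zW xz] := subsetP BW _ xB.
  by exists z; rewrite inE zW -xz xB.
apply: (v_cut vI) => //.
- have /set0Pn[x /preP [z [_ _ zB]]] := B0.
  by apply/set0Pn; exists z.
- apply: contra BnW => /eqP preW; rewrite eqEsubset BW /=.
  apply/subsetP=> x /imsetP[z zW ->].
  by move: zW; rewrite -preW inE => /andP[].
(* The preimage of [B] cannot be the exempt singleton: if its vertex lay in [A], all of [A] would be
   in the preimage, against [A_gt1]; if not, [B] would be that singleton and still exempt. *)
case: (v_exc vI) => [->|[v Zv _]].
  have /set0Pn[x /preP [z [_ _ zB]]] := B0.
  by apply/set0Pn; exists z.
apply: contra BZ; rewrite Zv => /eqP preZ.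
have vpre : v \in pre B by rewrite preZ set11.
have Bv x : x \in B -> x = c v.
  by case/preP=> z [_ <-]; rewrite preZ inE => /eqP ->.
have [vA|vA] := boolP (v \in A).
  have sA : A \subset pre B.
    apply/subsetP=> z zA; rewrite inE (subsetP AW) //= (c_in zA).
    by move: vpre; rewrite inE (c_in vA) => /andP[].
  by have := subset_leq_card sA; rewrite preZ cards1; lia.
move: vpre; rewrite inE (c_out vA) => /andP[vW vB].
apply/eqP/setP=> x; rewrite !inE; apply/idP/idP.
  by move=> /[dup] /Bv; rewrite (c_out vA) => -> _; rewrite eqxx vA.
by case/andP=> _ /eqP ->.
Qed.

(* [I'] describes the same orientation problem on [W] as [I], but with other
   arcs to the outside vertex; it is only required to be valid inside [A]. *)
Lemma contract I' :
  iW I' = W -> iE I' = e ->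
  (forall x, x \in A -> eqm (iT I' x - Posz (iQ I' x) + Posz (iP I' x))%R
                           (iT I x - Posz (iQ I x) + Posz (iP I x))%R) ->
  (iZ I' = set0 \/ exists2 v, iZ I' = [set v] & nrm (iT I' v) = 0) ->
  (forall x, x \in A -> odd (absz (iT I' x)) = odd (dg I' [set x])) ->
  dg I' A <= 2 * k - 2 + nrm (ts I' A) ->
  (forall B, B \subset A -> B != set0 -> B != A -> B != iZ I' -> bal k I' B) ->
  (forall J, valid J -> #|iW J| < #|W| -> sz J <= sz I -> solvable J) ->
  exists2 f, oriented I f & forall x, x \in W -> eqm (net I f x) (iT I x) /\
    absz (net (if x \in A then I' else I) f x) <= 2 * k - 1.
Proof.
move=> W' E' T' Z' par' tight' bal' IH; have [f1 f1E f1N] := IH _ valid_quo card_quo sz_quo.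
have aW1 : a \in c @: W by rewrite quoW !inE eqxx.
have inW1 y : y \in W :\: A -> y \in c @: W by rewrite quoW !inE => ->; rewrite orbT.
have e1E y : y \in W :\: A -> f1 a y + f1 y a = \sum_(z in A) e z y.
  move=> yW; rewrite (f1E a y aW1 (inW1 _ yW)) /=.
  move: yW; rewrite inE => /andP[yA yW].
  have -> /= : (a == y) = false by apply/eqP=> ay; move: yA; rewrite -ay aA.
  have -> : \sum_(z in W | c z == a) \sum_(z' in W | c z' == y) e z z' =
            \sum_(z in A) \sum_(z' in W | c z' == y) e z z'.
    apply: eq_bigl => z; rewrite c_eqa andbC.
    by case: (boolP (z \in A)) => //= /(subsetP AW).
  apply: eq_bigr => z _; rewrite (big_pred1 y) // => z' /=; rewrite c_eqx //.
  by case: eqP => [->|]; rewrite ?yW ?andbF.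
(* The solution of the quotient only tells how many edges between [A] and [y] leave [A]; any
   distribution [h y] of this number over the vertices of [A] will do. *)
have : forall y, exists2 h : T -> nat,
    forall z, h z <= e z y & (y \in W :\: A -> \sum_(z in A) h z = f1 a y).
  move=> y; have [yW|yW] := boolP (y \in W :\: A); last by exists (fun=> 0).
  have [|h hE hS] := @split_sum _ A (fun z => e z y) (f1 a y).
    by rewrite -e1E // leq_addr.
  by exists h.
case/fin_all_exists2=> h hE hS.
(* Within [A], the rest of the graph is merged into the outside vertex, and the boundary edges
   become arcs directed according to [h]. *)
pose J := Inst A e (fun z => iP I' z + \sum_(y in W :\: A) (e z y - h y z))
                   (fun z => iQ I' z + \sum_(y in W :\: A) h y z) (iT I') (iZ I').
have hD z : \sum_(y in W :\: A) (e z y - h y z) + \sum_(y in W :\: A) h y z =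
            \sum_(y in W :\: A) e z y.
  by rewrite -big_split; apply: eq_bigr => y _ /=; rewrite subnK.
have arJ B : ar J B = ar I' B + \sum_(z in B) \sum_(y in W :\: A) e z y.
  by rewrite /ar -big_split; apply: eq_bigr => z _ /=; rewrite -hD; lia.
have dgJ B : B \subset A -> dg J B = dg I' B.
  move=> BA; rewrite /dg arJ /cut /= W' E' addnCA addnC; congr (_ + _).
  rewrite -big_split; apply: eq_bigr => z _ /=.
  have sub : A :\: B \subset W :\: B by rewrite setSD.
  rewrite (sum_setD _ _ sub); congr (_ + _); apply: eq_bigl => y.
  rewrite !inE; have [yA|yA] := boolP (y \in A); first by case: (y \in B).
  by have [/(subsetP BA)|] := boolP (y \in B); rewrite ?(negbTE yA).
(* The congruence satisfied by the quotient at [a] is what provides [v_sum] for [J]. *)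
have net_a : eqm (ts I A) (Posz (\sum_(z in A) iQ I z + \sum_(y in W :\: A) f1 a y)
                - Posz (\sum_(z in A) iP I z + \sum_(y in W :\: A) f1 y a))%R.
  have [+ _] := f1N a aW1; rewrite /net /= quoW !big_setU1 ?inE ?aA //=.
  have EA z : (z \in W) && (c z == a) = (z \in A).
    rewrite c_eqa andbC.
    by case: (boolP (z \in A)) => //= /(subsetP AW).
  rewrite (eq_bigl _ _ EA) [X in (_ - Posz (_ + X))%R](eq_bigl _ _ EA).
  rewrite [X in eqm _ X](eq_bigl _ _ EA) -/(ts I A) => -[j E].
  by exists (- j)%R; lia.
have sum_h : \sum_(z in A) \sum_(y in W :\: A) h y z = \sum_(y in W :\: A) f1 a y.
  by rewrite exchange_big /=; apply: eq_bigr => y /hS.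
have sum_eh : \sum_(z in A) \sum_(y in W :\: A) (e z y - h y z) =
              \sum_(y in W :\: A) f1 y a.
  rewrite exchange_big /=; apply: eq_bigr => y yW.
  have := e1E y yW; rewrite -(hS _ yW).
  have -> : \sum_(z in A) e z y = \sum_(z in A) (e z y - h y z) + \sum_(z in A) h y z.
    by rewrite -big_split; apply: eq_bigr => z _ /=; rewrite subnK.
  by lia.
have sum' : eqm (ts I' A - Posz (\sum_(z in A) iQ I' z) + Posz (\sum_(z in A) iP I' z))%R
               (ts I A - Posz (\sum_(z in A) iQ I z) + Posz (\sum_(z in A) iP I z))%R.
  have PE : {morph Posz : a b / (a + b)%N >-> (a + b)%R} by [].
  rewrite !(big_morph Posz PE (erefl _)) /ts -!sumrB -!big_split /=.
  exact: eqm_sum.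
have tsJ B : ts J B = ts I' B by [].
have vJ : valid J.
  split=> //=; try by case: vI.
  - by move=> x xA; rewrite dgJ ?sub1set // par'.
  - rewrite !tsJ /= !big_split /= sum_h sum_eh.
    by case: net_a => j E; case: sum' => l E2; exists (j + l)%R; lia.
  - by rewrite -(@dgW _ J) dgJ.
  - by move=> B BA B0 BnA BZ; rewrite /bal dgJ // tsJ; exact: bal'.
have [||f2 f2E f2N] := IH _ vJ.
- rewrite /=; apply: proper_card; rewrite properEneq AW AnW //.
- rewrite /sz /= (@big_setID _ _ _ _ W A) /= (setIidPr AW).
  apply: leq_trans (leq_addr _ _); apply: leq_sum => x _.
  by rewrite (sum_setD _ _ AW) leq_addr.
pose f x y := if x \in A then if y \in A then f2 x y else h y x
              else if y \in A then e x y - h x y else f1 x y.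
exists f => [x y xW yW|x xW].
  rewrite /f; have [xA|xA] := boolP (x \in A); have [yA|yA] := boolP (y \in A).
  - exact: f2E.
  - by rewrite (v_sym vI x y) addnC subnK // (v_sym vI).
  - by rewrite subnK // (v_sym vI).
  have xy1 : x \in W :\: A by rewrite inE xA.
  have xy2 : y \in W :\: A by rewrite inE yA.
  rewrite (f1E x y (inW1 _ xy1) (inW1 _ xy2)) /=; case: eqP => [->|_]; first by rewrite (v_irr vI).
  rewrite (big_pred1 x) => [|z /=]; last first.
    by rewrite c_eqx //; case: eqP => [->|]; rewrite ?xW ?andbF.
  rewrite (big_pred1 y) // => z /=.
  by rewrite c_eqx //; case: eqP => [->|]; rewrite ?yW ?andbF.
have [xA|xA] := boolP (x \in A).
  have nJ : net I' f x = net J f2 x.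
    rewrite /net /= W' (sum_setD _ _ AW) (@sum_setD _ (fun x y => f y x) _ _ _ AW).
    have -> : \sum_(y in A) f x y = \sum_(y in A) f2 x y.
      by apply: eq_bigr => y yA; rewrite /f xA yA.
    have -> : \sum_(y in A) f y x = \sum_(y in A) f2 y x.
      by apply: eq_bigr => y yA; rewrite /f xA yA.
    have -> : \sum_(y in W :\: A) f x y = \sum_(y in W :\: A) h y x.
      by apply: eq_bigr => y; rewrite inE /f xA => /andP[/negbTE -> _].
    have -> : \sum_(y in W :\: A) f y x = \sum_(y in W :\: A) (e x y - h y x).
      by apply: eq_bigr => y; rewrite inE /f xA (v_sym vI x) => /andP[/negbTE -> _].
    by lia.
  have [] := f2N x xA; rewrite -nJ => -[j E1] E2; split=> //.
  case: (T' x xA) => l; rewrite /= in E1; move: E1; rewrite /net W' => E1 E3.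
  by exists (j + l)%R; lia.
have xWA : x \in W :\: A by rewrite inE xA.
have [] := f1N x (inW1 _ xWA).
have -> : iT quo x = iT I x.
  rewrite /= (big_pred1 x) // => z /=.
  by rewrite c_eqx //; case: eqP => [->|]; rewrite ?xW ?andbF.
suff -> : net quo f1 x = net I f x by [].
rewrite /net /= quoW !big_setU1 ?inE ?aA //=.
rewrite (sum_setD _ _ AW) (@sum_setD _ (fun x y => f y x) _ _ _ AW).
have -> : \sum_(z in W | c z == x) iP I z = iP I x.
  rewrite (big_pred1 x) // => z /=.
  by rewrite c_eqx //; case: eqP => [->|]; rewrite ?xW ?andbF.
have -> : \sum_(z in W | c z == x) iQ I z = iQ I x.
  rewrite (big_pred1 x) // => z /=.
  by rewrite c_eqx //; case: eqP => [->|]; rewrite ?xW ?andbF.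
have -> : \sum_(y in W :\: A) f x y = \sum_(y in W :\: A) f1 x y.
  by apply: eq_bigr => y; rewrite inE /f (negbTE xA) => /andP[/negbTE -> _].
have -> : \sum_(y in W :\: A) f y x = \sum_(y in W :\: A) f1 y x.
  by apply: eq_bigr => y; rewrite inE /f (negbTE xA) => /andP[/negbTE -> _].
have -> : \sum_(y in A) f y x = f1 a x.
  by rewrite -(hS _ xWA); apply: eq_bigr => y yA; rewrite /f yA (negbTE xA).
have -> : \sum_(y in A) f x y = f1 x a.
  have := e1E x xWA; rewrite -(hS _ xWA).
  have -> : \sum_(z in A) e z x = \sum_(y in A) f x y + \sum_(z in A) h x z.
    rewrite -big_split; apply: eq_bigr => z zA /=.
    by rewrite /f zA (negbTE xA) (v_sym vI x) subnK.
  by lia.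
by lia.
Qed.

End Contraction.

(** * Lifting moves at a vertex *)

Section Moves.

Variables (T : finType) (k : nat).
Hypothesis k_gt0 : 0 < k.

Local Ltac clia := clear - k_gt0; lia.

Implicit Types (W A B : {set T}) (u v w x y : T) (e : T -> T -> nat) (h : T -> nat).

Local Notation nrm := (nrm k).
Local Notation eqm := (eqm k).
Local Notation pos := (pos k).
Local Notation valid := (@valid T k).
Local Notation solvable := (@solvable T k).

Definition dec h v := fun x => h x - (x == v).
Definition inc h v := fun x => h x + (x == v).
Definition shift (t : T -> int) v (z : int) := fun x => (t x + if x == v then z else 0)%R.
Definition edec e u v := fun x y => e x y - edge1 u v x y.
Definition einc e u v := fun x y => e x y + edge1 u v x y.

Lemma sum_dec h v A : 0 < h v -> \sum_(x in A) dec h v x + (v \in A) = \sum_(x in A) h x.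
Proof.
move=> h0; rewrite -sum_deltaD; apply: eq_bigr => x _; rewrite /dec subnK //.
by case: eqP => [->|].
Qed.

Lemma sum_inc h v A : \sum_(x in A) inc h v x = \sum_(x in A) h x + (v \in A).
Proof. exact: sum_deltaD. Qed.

Lemma sum_shift t v z A : (\sum_(x in A) shift t v z x =
  \sum_(x in A) t x + if v \in A then z else 0)%R.
Proof.
rewrite big_split /=; congr (_ + _)%R; rewrite -big_mkcondr /=.
case: ifP => vA.
  rewrite (big_pred1 v) // => x /=; case: eqP => [->|]; rewrite ?vA ?andbF //.
by rewrite big_pred0 // => x; case: eqP => [->|]; rewrite ?vA ?andbF.
Qed.

Lemma edecE e u v : (forall x y, e x y = e y x) -> u != v -> 0 < e u v ->
  forall x y, edec e u v x y + edge1 u v x y = e x y.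
Proof.
move=> eC uv e0 x y; rewrite subnK // /edge1.
case: (x =P u) => [->|_]; rewrite ?(negbTE uv) /= ?addn0.
  by case: eqP => [->|].
by case: (x =P v) => [->|_] //; case: (y =P u) => [->|_] //=; rewrite eC.
Qed.

Lemma edec_sym e u v : (forall x y, e x y = e y x) ->
  forall x y, edec e u v x y = edec e u v y x.
Proof. by move=> eC x y; rewrite /edec eC edge1C. Qed.

Lemma edec_irr e u v : (forall x, e x x = 0) -> forall x, edec e u v x x = 0.
Proof. by move=> e0 x; rewrite /edec e0. Qed.

Lemma cut_edec e u v W A : (forall x y, e x y = e y x) -> u != v -> 0 < e u v ->
  u \in W -> v \in W ->
  cut (edec e u v) W A + ((u \in A) (+) (v \in A)) = cut e W A.
Proof.
move=> eC uv e0 uW vW; rewrite -(cut_edge1 _ uW vW) -cutD.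
exact: (eq_cut _ _ (edecE eC uv e0)).
Qed.

Lemma sum2_edec e u v W : (forall x y, e x y = e y x) -> u != v -> 0 < e u v ->
  u \in W -> v \in W ->
  \sum_(x in W) \sum_(y in W) edec e u v x y + 2 = \sum_(x in W) \sum_(y in W) e x y.
Proof.
move=> eC uv e0 uW vW; rewrite -(sum2_edge1 uW vW) -sum2D.
by apply: eq_bigr => x _; apply: eq_bigr => y _; rewrite edecE.
Qed.

Lemma cut_einc e u v W A : u \in W -> v \in W ->
  cut (einc e u v) W A = cut e W A + ((u \in A) (+) (v \in A)).
Proof. by move=> uW vW; rewrite cutD cut_edge1. Qed.

Lemma sum2_einc e u v W : u \in W -> v \in W ->
  \sum_(x in W) \sum_(y in W) einc e u v x y = \sum_(x in W) \sum_(y in W) e x y + 2.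
Proof. by move=> uW vW; rewrite sum2D sum2_edge1. Qed.

Variable I : inst T.
Hypothesis vI : valid I.
Local Notation W := (iW I).
Local Notation e := (iE I).
Local Notation p := (iP I).
Local Notation q := (iQ I).
Local Notation t := (iT I).

Definition loose := forall A, A \subset W -> A != W -> 1 < #|A| ->
  2 * k + nrm (ts I A) <= dg I A.

Hypothesis looseI : loose.

Definition zero_exc (J : inst T) :=
  iZ J = set0 \/ exists2 v, iZ J = [set v] & nrm (iT J v) = 0.

Lemma par_step (a a' : int) (d d' : nat) (j : int) :
  (Posz d' + a' = Posz d + a + j * 2)%R -> odd (absz a) = odd d -> odd (absz a') = odd d'.
Proof. clear; lia. Qed.

(** Looseness pays for a loss of 2 on every larger proper set, so the cut condition has to be
    rechecked at singletons only. *)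
Lemma valid_mod J : iW J = W ->
  (forall x y, iE J x y = iE J y x) -> (forall x, iE J x x = 0) -> zero_exc J ->
  (forall x, x \in W -> exists j : int,
     (Posz (dg J [set x]) + iT J x = Posz (dg I [set x]) + t x + j * 2)%R) ->
  eqm (ts J W + Posz (\sum_(x in W) iP J x))%R (Posz (\sum_(x in W) iQ J x)) ->
  ar J W <= 2 * k - 2 + nrm (ts J W) ->
  (forall A, A \subset W -> dg I A + nrm (ts J A) <= dg J A + nrm (ts I A) + 2) ->
  (forall x, x \in W -> [set x] != W -> [set x] != iZ J -> bal k J [set x]) ->
  valid J.
Proof.
move=> JW Jsym Jirr Jexc Jpar Jsum Jarc Jdrop J1; split; rewrite ?JW //.
  by move=> x xW; have [j E] := Jpar x xW; apply: par_step (v_par vI xW); exact: E.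
move=> A AW A0 AnW AZ; have [A1|] := boolP (1 < #|A|).
  by have := looseI AW AnW A1; have := Jdrop A AW; rewrite /bal; lia.
rewrite -leqNgt; move: A0; rewrite -card_gt0 => A0 A1.
have /cards1P[x Ax] : #|A| == 1 by rewrite eqn_leq A1 A0.
by subst A; apply: J1 => //; rewrite -sub1set.
Qed.

Definition reducible := exists J, [/\ valid J, mu k J < mu k I & solvable J -> solvable I].

Section Lift.

(** Two uses are intended: [Z = [set v]] if the target of [v] is 0, which exempts [v] while it loses
    degree, and [Z = set0] if [v] itself has slack 2. *)
Variables (v : T) (Z : {set T}).
Hypotheses (vW : v \in W) (Z0 : Z = set0 \/ exists2 v, Z = [set v] & nrm (t v) = 0).
Hypothesis Zsub : forall x, x != v -> [set x] != Z -> [set x] != iZ I.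
Hypothesis Zv : [set v] != Z -> 2 * k + nrm (t v) <= dg I [set v].

Lemma bal_other x : x \in W -> x != v -> [set x] != W -> [set x] != Z -> bal k I [set x].
Proof.
move=> xW xv xnW xZ; apply: (v_cut vI); rewrite ?sub1set //; last exact: Zsub.
by apply/set0Pn; exists x; rewrite set11.
Qed.

(** An incoming and an outgoing arc cancel in the net out-degree of [v]. *)
Lemma move_cancel : 0 < p v -> 0 < q v -> reducible.
Proof.
move=> p0 q0; pose J := Inst W e (dec p v) (dec q v) t Z.
have arJ A : ar J A + 2 * (v \in A) = ar I A.
  rewrite !ar_sumE /=; have := sum_dec A p0; have := sum_dec A q0; clia.
have dgJ A : dg J A + 2 * (v \in A) = dg I A.
  by rewrite /dg -(arJ A) /=; clia.
have vJ : valid J.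
  apply: valid_mod => //=; try by case: vI.
  + by move=> x xW; exists (- Posz (v \in [set x]))%R; have := dgJ [set x]; rewrite -[iT J x]/(t x); clia.
  + have [j E] := v_sum vI; exists j; have := sum_dec W p0; have := sum_dec W q0.
    by rewrite vW; move: E; rewrite -[ts J W]/(ts I W); clia.
  + by have := arJ W; have := v_arc vI; rewrite -[ts J W]/(ts I W) vW; clia.
  + by move=> A _; have := dgJ A; rewrite -[ts J A]/(ts I A); case: (v \in A); clia.
  move=> x xW xnW xZ; have := dgJ [set x]; rewrite /bal -[ts J _]/(ts I _) inE.
  have [vx|vx] := eqVneq v x.
    by subst x; have := Zv xZ; rewrite ts1 /=; clia.
  have := bal_other xW _ xnW xZ; rewrite [x == v]eq_sym vx => /(_ isT); rewrite /bal /=; clia.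
exists J; split=> //.
- by apply: (mu_lt2 k_gt0) => //=; have := arJ W; rewrite vW; clia.
- case=> f fE fN; exists f => // x xW; have := fN x xW.
  suff -> : net J f x = net I f x by [].
  by move: p0 q0; rewrite /net /= /dec; case: eqP => [->|_]; clia.
Qed.

(** The edges [v u] and [v w] are replaced by one edge [u w]. Whatever direction that edge receives,
    it is rerouted through [v], where it enters once and leaves once. *)
Lemma move_lift u w : u \in W -> w \in W -> u != v -> w != v -> u != w ->
  0 < e v u -> 0 < e v w -> reducible.
Proof.
move=> uW wW uv wv uw eu ew.
have vu : v != u by rewrite eq_sym.
have vw : v != w by rewrite eq_sym.
pose e1 := edec e v u; pose e2 := edec e1 v w; pose e3 := einc e2 u w.
have e1s := edec_sym v u (v_sym vI).
have e1w : 0 < e1 v w.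
  by rewrite /e1 /edec /edge1 eqxx /= [w == u]eq_sym (negbTE uw) (negbTE vu) /= subn0.
have e2s := edec_sym v w e1s.
pose J := Inst W e3 p q t Z.
have cutJ A : dg J A + ((v \in A) (+) (u \in A)) + ((v \in A) (+) (w \in A)) =
    dg I A + ((u \in A) (+) (w \in A)).
  have := cut_edec A (v_sym vI) vu eu vW uW; have := cut_edec A e1s vw e1w vW wW.
  rewrite /dg /= (cut_einc _ _ uW wW) -[ar J A]/(ar I A) -/e1 -/e2.
  by case: (v \in A); case: (u \in A); case: (w \in A) => /=; clia.
have e3E x y : e3 x y + edge1 v u x y + edge1 v w x y = e x y + edge1 u w x y.
  have := edecE (v_sym vI) vu eu x y; have := edecE e1s vw e1w x y.
  by rewrite -/e1 -/e2 /e3 /einc; clia.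
have vJ : valid J.
  apply: valid_mod => //=; try by case: vI.
  + by move=> x y; rewrite /e3 /einc /e2 /e1 e2s edge1C.
  + by move=> x; rewrite /e3 /einc edge1_irr // addn0; apply: edec_irr; apply: edec_irr (v_irr vI).
  + move=> x xW.
    exists (- Posz ((v == x) && (u != x) && (w != x)) - Posz ((v != x) && (u == x) && (w == x)))%R.
    have := cutJ [set x]; rewrite -[iT J x]/(t x) !inE.
    by case: (v == x); case: (u == x); case: (w == x); rewrite /=; clia.
  + move=> A _; have := cutJ A; rewrite -[ts J A]/(ts I A).
    by case: (v \in A); case: (u \in A); case: (w \in A); clia.
  move=> x xW xnW xZ; have := cutJ [set x]; rewrite /bal -[ts J _]/(ts I _) !inE.
  have [vx|vx] := eqVneq v x.
    by subst x; have := Zv xZ; rewrite ts1 /= (negbTE uv) (negbTE wv); clia.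
  have := bal_other xW _ xnW xZ; rewrite [x == v]eq_sym vx => /(_ isT); rewrite /bal /=.
  have : ~~ ((u == x) && (w == x)) by apply: contra uw => /andP[/eqP-> /eqP->].
  by case: (u == x); case: (w == x) => //= _; clia.
exists J; split=> //.
- apply: (mu_lt1 k_gt0 vJ) => /=.
  have := sum2_edec (v_sym vI) vu eu vW uW; have := sum2_edec e1s vw e1w vW wW.
    by rewrite /sz /= sum2_einc // -/e1 -/e2; clia.
- case=> f fE fN.
  (* [u1] is the tail and [w1] the head of the new edge, so that both directions are treated at
     once. *)
  have step u1 w1 : u1 \in W -> w1 \in W -> 0 < f u1 w1 ->
      (forall x y, edge1 v u1 x y + edge1 v w1 x y = edge1 v u x y + edge1 v w x y) ->
      (forall x y, edge1 u1 w1 x y = edge1 u w x y) -> solvable I.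
    move=> u1W w1W f0 E1 E2.
    pose f' x y := f x y - arc1 u1 w1 x y + arc1 u1 v x y + arc1 v w1 x y.
    have f'E x y : f' x y + arc1 u1 w1 x y = f x y + arc1 u1 v x y + arc1 v w1 x y.
      rewrite /f' /arc1; move: f0; case: (x =P u1) => [->|_] //=; last by clia.
      by case: (y =P w1) => [->|_] /=; clia.
    exists f' => [x y xW yW|x xW].
      have := e3E x y; have := fE x y xW yW; have := f'E x y; have := f'E y x.
      have := E1 x y; have := E2 x y; rewrite !edge1E ![arc1 _ _ y x]arc1C /=; clia.
    have := fN x xW; suff -> : net J f x = net I f' x by [].
    have S1 : \sum_(y in W) f' x y + (x == u1) = \sum_(y in W) f x y + (x == u1) + (x == v).
      rewrite -{1}(sum_arc1 u1 x w1W) -{1}(sum_arc1 u1 x vW) -(sum_arc1 v x w1W).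
      by rewrite -!big_split; apply: eq_bigr => y _ /=; rewrite f'E.
    have S2 : \sum_(y in W) f' y x + (x == w1) = \sum_(y in W) f y x + (x == v) + (x == w1).
      rewrite -{1}(sum_arc1r w1 x u1W) -{1}(sum_arc1r v x u1W) -(sum_arc1r w1 x vW).
      by rewrite -!big_split; apply: eq_bigr => y _ /=; rewrite f'E.
    by move: S1 S2; rewrite /net /=; clia.
  have := fE u w uW wW; have := e3E u w.
  rewrite /= /edge1 !eqxx (negbTE uw) (negbTE uv) (negbTE wv) /=.
  rewrite ?[w == u]eq_sym ?(negbTE uw) /= => E3 E4.
  have [fu|fu] : 0 < f u w \/ 0 < f w u by move: E3 E4; clia.
  + by apply: (step u w).
  + by apply: (step w u) => // x y; [rewrite addnC | rewrite edge1CC].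
Qed.

(** The arc entering [v] is prolonged along the edge [v u] to an arc entering [u]; undoing this
    directs the edge from [v] to [u]. *)
Lemma move_arc u : u \in W -> u != v -> 0 < p v -> 0 < e v u -> reducible.
Proof.
move=> uW uv p0 eu; have vu : v != u by rewrite eq_sym.
pose J := Inst W (edec e v u) (inc (dec p v) u) q t Z.
have arJ A : ar J A + (v \in A) = ar I A + (u \in A).
  by rewrite !ar_sumE /= sum_inc; have := sum_dec A p0; clia.
have dgJ A : dg J A + (v \in A) + ((v \in A) (+) (u \in A)) = dg I A + (u \in A).
  have := cut_edec A (v_sym vI) vu eu vW uW; have := arJ A.
  rewrite /dg -[iE J]/(edec e v u) -[iW J]/W.
  by case: (v \in A); case: (u \in A) => /=; clia.
have vJ : valid J.
  apply: valid_mod => //=; try by case: vI.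
  + exact: edec_sym (v_sym vI).
  + exact: edec_irr (v_irr vI).
  + move=> x xW; exists (- Posz ((v == x) && (u != x)))%R.
    have := dgJ [set x]; rewrite -[iT J x]/(t x) !inE.
    by case: (v == x); case: (u == x); clia.
  + have [j E] := v_sum vI; exists j; rewrite sum_inc; have := sum_dec W p0.
    by rewrite vW uW; move: E; rewrite -[ts J W]/(ts I W); clia.
  + by have := arJ W; have := v_arc vI; rewrite -[ts J W]/(ts I W) vW uW; clia.
  + move=> A _; have := dgJ A; rewrite -[ts J A]/(ts I A).
    by case: (v \in A); case: (u \in A); clia.
  move=> x xW xnW xZ; have := dgJ [set x]; rewrite /bal -[ts J _]/(ts I _) !inE.
  have [vx|vx] := eqVneq v x.
    by subst x; have := Zv xZ; rewrite ts1 /= (negbTE uv); clia.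
  have := bal_other xW _ xnW xZ; rewrite [x == v]eq_sym vx => /(_ isT); rewrite /bal /=.
  by case: (u == x); clia.
exists J; split=> //.
- apply: (mu_lt1 k_gt0 vJ) => /=.
  by have := sum2_edec (v_sym vI) vu eu vW uW; rewrite /sz /=; clia.
- case=> f fE fN; exists (fun x y => f x y + arc1 v u x y) => [x y xW yW|x xW].
    have := fE x y xW yW; rewrite /= -(edecE (v_sym vI) vu eu x y) => <-.
    by rewrite edge1E [arc1 _ _ y x]arc1C; clia.
  have := fN x xW; suff -> : net J f x = net I (fun x y => f x y + arc1 v u x y) x by [].
  move: p0; rewrite /net /= !big_split /= sum_arc1 // sum_arc1r // /inc /dec.
  by case: (x =P v) => [->|_]; rewrite ?(negbTE vu); clia.
Qed.

End Lift.

End Moves.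

(** * Deleting vertices, edges and arcs *)

Section Deletions.

Variables (T : finType) (k : nat).
Hypothesis k_gt0 : 0 < k.
Implicit Types (W A B : {set T}) (u v w x y : T) (e : T -> T -> nat) (h : T -> nat).

Local Ltac clia := clear - k_gt0; lia.

Local Notation nrm := (nrm k).
Local Notation eqm := (eqm k).
Local Notation pos := (pos k).
Local Notation valid := (@valid T k).
Local Notation solvable := (@solvable T k).

Variable I : inst T.
Hypothesis vI : valid I.
Local Notation W := (iW I).
Local Notation e := (iE I).
Local Notation p := (iP I).
Local Notation q := (iQ I).
Local Notation t := (iT I).

(** The congruences without the bound. A move that shifts targets does not preserve the bound, but
    [wsolvableW] recovers it when all degrees are small. *)
Definition wsolvable := exists2 f, oriented I f &
  forall x, x \in W -> eqm (net I f x) (t x).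

Lemma wsolvableW : (forall x, x \in W -> dg I [set x] <= 2 * k - 2 + nrm (t x)) ->
  wsolvable -> solvable I.
Proof.
move=> s0 [f fE fN]; exists f => // x xW; split; first exact: fN.
by apply: (net_bound k_gt0 (fN x xW) (net_le k_gt0 vI fE xW)); exact: s0.
Qed.

(** Target 0 makes the degree of [v] even, so its edges, all going to [u], can be directed half each
    way. For the cut condition, a set containing [u] is compared with the same set enlarged by
    [v]. *)
Lemma drop_vertex v u : v \in W -> u \in W -> u != v -> nrm (t v) = 0 ->
  p v = 0 -> q v = 0 -> (forall y, y \in W -> y != u -> e v y = 0) ->
  (iZ I = set0 \/ iZ I = [set v]) -> reducible k I.
Proof.
move=> vW uW uv tv pv qv ev Zv.
pose J := Inst (W :\ v) e p q t set0.
have sW : W :\ v \subset W by rewrite subD1set.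
have tv0 := nrm0_eqm k_gt0 tv.
have dgv : dg I [set v] = e v u.
  rewrite (dg1 vI vW) pv qv !addn0 (bigD1 u) //= big1 ?addn0 //.
  by move=> y /andP[]; exact: ev.
have even_e y : y \in W -> ~~ odd (e v y).
  move=> yW; have [->|yu] := eqVneq y u; last by rewrite ev.
  by rewrite -dgv -(v_par vI vW) -(odd_nrm k_gt0) tv.
have ET (R : Type) (idx : R) (op : Monoid.com_law idx) (F : T -> R) :
    \big[op/idx]_(x in W) F x = op (F v) (\big[op/idx]_(x in W :\ v) F x).
  by rewrite (bigD1 v) //=; congr (op _ _); apply: eq_bigl => x; rewrite !inE andbC.
have cutv A x : A \subset W :\ v -> \sum_(y in W :\: A) e x y =
    e x v + \sum_(y in (W :\ v) :\: A) e x y.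
  move=> AW; have vA : v \notin A by apply: contraTN isT => /(subsetP AW); rewrite !inE eqxx.
  rewrite (bigD1 v) ?inE ?vA //=; congr (_ + _); apply: eq_bigl => y.
  by rewrite !inE; case: (y == v); case: (y \in A); rewrite ?andbF ?andbT.
have dgJ A : A \subset W :\ v -> u \notin A -> dg J A = dg I A.
  move=> AW uA; rewrite /dg -[ar J A]/(ar I A); congr (_ + _).
  apply: eq_bigr => x xA /=; rewrite cutv // (v_sym vI) ev //.
    by apply: (subsetP sW); apply: (subsetP AW).
  by apply: contraNneq uA => <-.
have dgJu A : A \subset W :\ v -> u \in A -> dg J A = dg I (v |: A).
  move=> AW uA; have vA : v \notin A by apply: contraTN isT => /(subsetP AW); rewrite !inE eqxx.
  have WA : (W :\ v) :\: A = W :\: (v |: A) by rewrite setDDl.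
  rewrite /dg /ar /cut !big_setU1 //= pv qv -WA [X in _ = X + _ + _]big1 ?add0n //.
  move=> y; rewrite !inE => /andP[yA /andP[_ yW]]; apply: ev => //.
  by apply: contraNneq yA => ->.
have tsv A : v \notin A -> nrm (ts I (v |: A)) = nrm (ts I A).
  move=> vA; apply: (nrm_eqm k_gt0); rewrite /ts big_setU1 //=.
  by rewrite -[X in eqm _ X]add0r; apply: eqmD => //; exact: eqm_refl.
have W_vW : W = v |: (W :\ v) by rewrite setD1K.
have vJ : valid J.
  split=> /=; try by case: vI.
  - by left.
  - move=> x xW; have xW' := subsetP sW _ xW.
    have [xu|xu] := eqVneq x u.
      rewrite xu in xW xW' *; rewrite (v_par vI uW) dgJu ?sub1set ?set11 //.
      have := dgU1 k_gt0 vI vW uW; rewrite eq_sym uv => /(_ isT).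
      by rewrite dgv; have := even_e u uW; clia.
    rewrite dgJ ?sub1set //; first exact: (v_par vI).
    by rewrite inE eq_sym.
  - have [j E] := v_sum vI; have [l E2] := tv0; exists (j - l)%R.
    by move: E; rewrite {1}/ts !ET /= pv qv !add0n -/(ts I _) -[ts J _]/(ts I (W :\ v)) E2; clia.
  - have := v_arc vI; rewrite [X in nrm (ts I X)]W_vW tsv ?inE ?eqxx //.
    by rewrite {1}/ar ET /= pv qv add0n.
  move=> A AW A0 AnW _.
  have vA : v \notin A by apply: contraTN isT => /(subsetP AW); rewrite !inE eqxx.
  rewrite /bal -[ts J A]/(ts I A).
  have [uA|uA] := boolP (u \in A); last first.
    rewrite dgJ //; apply: (v_cut vI) => //; first exact: subset_trans sW.
      by apply: contraNneq vA => ->.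
    case: Zv => ->; first by [].
    by apply: contraNneq vA => ->; rewrite set11.
  rewrite dgJu // -tsv //; apply: (v_cut vI).
  - by rewrite subUset sub1set vW; exact: subset_trans sW.
  - by apply/set0Pn; exists v; rewrite setU11.
  - apply: contra AnW => /eqP E; rewrite -E; apply/eqP/setP=> x; rewrite !inE.
    by case: eqP => [->|] //=; rewrite (negbTE vA).
  case: Zv => ->; first by apply/set0Pn; exists v; rewrite setU11.
  apply: contraNneq uv => E; have : u \in v |: A by rewrite !inE uA orbT.
  by rewrite E inE.
exists J; split=> //.
  apply: (mu_lt1 k_gt0 vJ) => /=; rewrite /sz /= [#|W|](cardsD1 v) vW /=.
  suff : \sum_(x in W :\ v) \sum_(y in W :\ v) e x y <= \sum_(x in W) \sum_(y in W) e x y.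
    by clia.
  rewrite [X in _ <= X]ET /= addnC; apply: leq_trans (leq_addr _ _).
  by apply: leq_sum => x _; rewrite [X in _ <= X]ET /= leq_addl.
case=> f fE fN.
pose f' x y := if (x == v) || (y == v) then (e x y)./2 else f x y.
have f'E : oriented I f'.
  move=> x y xW yW; rewrite /f' orbC.
  have [->|yv] := eqVneq y v; rewrite ?orbT /=.
    by rewrite (v_sym vI x) addnn even_halfK // even_e.
  have [->|xv] := eqVneq x v; first by rewrite (v_sym vI y) addnn even_halfK // even_e.
  by apply: fE; rewrite !inE ?xv ?yv.
exists f' => // x xW; have [->|xv] := eqVneq x v.
  have -> : net I f' v = 0%R.
    rewrite /net pv qv !addn0; apply/eqP; rewrite subr_eq0; apply/eqP; congr Posz.
    by apply: eq_bigr => y _; rewrite /f' eqxx orbT /= (v_sym vI).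
  by split; [exact: eqm_sym | clia].
have := fN x; rewrite !inE xv xW => /(_ isT).
suff -> : net J f x = net I f' x by [].
rewrite /net /= !ET /=.
have -> : \sum_(y in W :\ v) f' x y = \sum_(y in W :\ v) f x y.
  by apply: eq_bigr => y; rewrite !inE /f' (negbTE xv) => /andP[/negbTE ->].
have -> : \sum_(y in W :\ v) f' y x = \sum_(y in W :\ v) f y x.
  by apply: eq_bigr => y; rewrite !inE /f' (negbTE xv) orbF => /andP[/negbTE ->].
by rewrite /f' eqxx orbT /= (v_sym vI x); clia.
Qed.

Hypothesis looseI : loose k I.
Hypothesis Z0 : iZ I = set0.

Lemma bal1 x : x \in W -> [set x] != W -> bal k I [set x].
Proof.
move=> xW xnW; apply: (v_cut vI); rewrite ?sub1set ?Z0 //.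
  by apply/set0Pn; exists x; rewrite set11.
by apply/set0Pn; exists x; rewrite set11.
Qed.

(** Two parallel edges are directed oppositely and cancel; slack 2 at both ends pays for their
    removal. *)
Lemma move_pair u v : u \in W -> v \in W -> u != v -> 1 < e u v ->
  2 * k + nrm (t u) <= dg I [set u] -> 2 * k + nrm (t v) <= dg I [set v] ->
  reducible k I.
Proof.
move=> uW vW uv eu su sv.
have e1 : 0 < e u v by exact: ltnW.
have e1s := edec_sym u v (v_sym vI).
have e2 : 0 < edec e u v u v.
  by rewrite /edec /edge1 !eqxx (negbTE uv) /= addn0 subn_gt0.
pose J := Inst W (edec (edec e u v) u v) p q t set0.
have dgJ A : dg J A + 2 * ((u \in A) (+) (v \in A)) = dg I A.
  have := cut_edec A (v_sym vI) uv e1 uW vW; have := cut_edec A e1s uv e2 uW vW.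
  rewrite /dg -[ar J A]/(ar I A) -[iE J]/(edec (edec e u v) u v) -[iW J]/W.
  by case: (u \in A); case: (v \in A) => /=; clia.
have vJ : valid J.
  apply: (valid_mod k_gt0 vI looseI) => //=; try by case: vI.
  - exact: edec_sym.
  - by apply: edec_irr; apply: edec_irr (v_irr vI).
  - by left.
  - move=> x xW; exists (- Posz ((u \in [set x]) (+) (v \in [set x])))%R.
    have := dgJ [set x]; rewrite -[iT J x]/(t x).
    by case: (u \in [set x]); case: (v \in [set x]) => /=; clia.
  - move=> A _; have := dgJ A; rewrite -[ts J A]/(ts I A).
    by case: (u \in A); case: (v \in A) => /=; clia.
  move=> x xW xnW _; have := dgJ [set x]; rewrite /bal -[ts J _]/(ts I _) ts1 !inE.
  have [ux|ux] := eqVneq u x; first by subst x; have := su; case: (v == u) => /=; clia.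
  have [vx|vx] := eqVneq v x; first by subst x; have := sv; clia.
  by have := bal1 xW xnW; rewrite /bal ts1 /=; clia.
exists J; split=> //.
  apply: (mu_lt1 k_gt0 vJ) => /=; have := sum2_edec (v_sym vI) uv e1 uW vW.
  by have := sum2_edec e1s uv e2 uW vW; rewrite /sz /=; clia.
case=> f fE fN; exists (fun x y => f x y + arc1 u v x y + arc1 v u x y) => [x y xW yW|x xW].
  have := fE x y xW yW; have := edecE (v_sym vI) uv e1 x y; have := edecE e1s uv e2 x y.
  by rewrite edge1E ![arc1 _ _ y x]arc1C /=; clia.
have := fN x xW; suff -> : net J f x =
    net I (fun x y => f x y + arc1 u v x y + arc1 v u x y) x by [].
by rewrite /net /= !big_split /= !sum_arc1 // !sum_arc1r //; clia.
Qed.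

(** An outgoing arc realises one unit of a positive target. Without it, degree and norm at [x] both
    drop by one, which keeps the singleton balanced. *)
Lemma move_out x : x \in W -> 0 < q x -> 0 < nrm (t x) -> pos (t x) ->
  (forall y, y \in W -> dg I [set y] <= 2 * k - 2 + nrm (t y)) -> reducible k I.
Proof.
move=> xW q0 t0 tpos s0.
pose J := Inst W e p (dec q x) (shift t x (-1)%R) set0.
have arJ A : ar J A + (x \in A) = ar I A.
  by rewrite !ar_sumE /=; have := sum_dec A q0; clia.
have dgJ A : dg J A + (x \in A) = dg I A.
  by rewrite /dg -(arJ A) -[iE J]/e -[iW J]/W; clia.
have tsJ A : ts J A = (ts I A + if x \in A then -1 else 0)%R by exact: sum_shift.
have vJ : valid J.
  apply: (valid_mod k_gt0 vI looseI) => //; try by case: vI.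
  - by left.
  - move=> y yW; exists (- Posz (x == y))%R; have := dgJ [set y].
    by rewrite -[iT J y]/(shift t x (-1)%R y) /shift inE eq_sym; case: eqP => _ /=; clia.
  - rewrite tsJ xW -[iP J]/p -[iQ J]/(dec q x); have [j E] := v_sum vI; exists j.
    by have := sum_dec W q0; rewrite xW; move: E; clia.
  - have := arJ W; have := v_arc vI; have := nrm_shift k_gt0 (ts I W) (-1)%R.
    by rewrite tsJ xW; clia.
  - move=> A _; have := dgJ A; rewrite tsJ; have := nrm_shift k_gt0 (ts I A - 1)%R 1%R.
    by rewrite subrK; case: (x \in A); rewrite ?addr0; clia.
  move=> y yW ynW _; have := bal1 yW ynW; have := dgJ [set y].
  rewrite /bal tsJ !ts1 inE; have [xy|xy] := eqVneq x y; last by rewrite addr0; clia.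
  by subst y; have := pos_dec k_gt0 t0 tpos; move: t0; clia.
exists J; split=> //.
  by apply: (mu_lt2 k_gt0) => //; have := arJ W; rewrite xW -[iW J]/W; clia.
case=> f fE fN; apply: wsolvableW => //; exists f => // y yW.
have [j E] := (fN y yW).1; exists j; move: E q0.
rewrite /net /= /dec /shift; case: eqP => [->|_]; rewrite ?addr0; clia.
Qed.

(** The edge is directed from a positive to a negative vertex and deleted. Both norms drop along
    with the degrees; any other set separating the ends loses one edge and gains at most one in
    norm, within the slack of 2. *)
Lemma move_edge x y : x \in W -> y \in W -> x != y -> 0 < e x y ->
  0 < nrm (t x) -> pos (t x) -> 0 < nrm (t y) -> pos (- t y)%R ->
  exists J, [/\ valid J, sz J < sz I, iW J = W & solvable J -> wsolvable].
Proof.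
move=> xW yW xy e0 tx0 tx ty0 ty.
pose J := Inst W (edec e x y) p q (shift (shift t x (-1)) y 1)%R set0.
have dgJ A : dg J A + ((x \in A) (+) (y \in A)) = dg I A.
  have := cut_edec A (v_sym vI) xy e0 xW yW.
  by rewrite /dg -[iE J]/(edec e x y) -[ar J A]/(ar I A) -[iW J]/W;
    case: (x \in A); case: (y \in A) => /=; clia.
have tsJ A : ts J A = (ts I A + (if x \in A then -1 else 0) + if y \in A then 1 else 0)%R.
  by rewrite /ts !sum_shift.
have szJ : sz J + 2 = sz I by exact: (sum2_edec (v_sym vI) xy e0 xW yW).
exists J; split=> //.
- apply: (valid_mod k_gt0 vI looseI) => //; try by case: vI.
  + exact: edec_sym (v_sym vI).
  + exact: edec_irr (v_irr vI).
  + by left.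
  + move=> z zW; exists (- Posz ((x == z) && (y != z)))%R; have := dgJ [set z].
    rewrite -[iT J z]/(shift (shift t x (-1)) y 1 z)%R /shift !inE ![z == _]eq_sym.
    have [xz|xz] := eqVneq x z; have [yz|yz] := eqVneq y z => /=; try clia.
  + rewrite tsJ xW yW -[iP J]/p -[iQ J]/q; have [j E] := v_sum vI; exists j.
    by move: E; clia.
  + by rewrite tsJ xW yW -addrA addNr addr0; exact: v_arc vI.
  + move=> A _; have := dgJ A; rewrite tsJ.
    have := nrm_shift k_gt0 (ts I A - 1)%R 1%R; have := nrm_shift k_gt0 (ts I A + 1)%R (-1)%R.
    rewrite subrK addrK; case: (x \in A); case: (y \in A) => /=.
    * by rewrite subrK; clia.
    * by rewrite addr0; clia.
    * by rewrite addr0; clia.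
    * by rewrite !addr0; clia.
  move=> z zW znW _; have := bal1 zW znW; have := dgJ [set z].
  rewrite /bal tsJ !ts1 !inE; have [xz|xz] := eqVneq x z.
    subst z; rewrite eq_sym (negbTE xy) addr0 /=.
    by have := pos_dec k_gt0 tx0 tx; move: tx0; clia.
  have [yz|yz] := eqVneq y z; last by rewrite !addr0; clia.
  by subst z; rewrite addr0 /=; have := neg_inc k_gt0 ty0 ty; move: ty0; clia.
- by move: szJ; clia.
case=> f fE fN; exists (fun a b => f a b + arc1 x y a b) => [a b aW bW|z zW].
  have := fE a b aW bW; have := edecE (v_sym vI) xy e0 a b.
  by rewrite edge1E ![arc1 _ _ b a]arc1C /=; clia.
have [j E] := (fN z zW).1; exists j; move: E.
rewrite /net /= !big_split /= !sum_arc1 // !sum_arc1r // /shift.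
have [zx|zx] := eqVneq z x; have [zy|zy] := eqVneq z y; try clia.
Qed.

End Deletions.

(** * Deciding the sign of a residue *)

Section Signs.

Variable k : nat.
Hypothesis k_gt0 : 0 < k.
Local Notation nrm := (nrm k).
Local Notation eqm := (eqm k).
Local Notation pos := (pos k).

Lemma nrm_val z r : eqm z (Posz r) -> r <= k -> nrm z = r.
Proof.
move=> zr rk; apply/eqP; rewrite eqn_leq (nrm_min k_gt0 zr) /= leqNgt; apply/negP=> lt.
have nk := nrm_le k_gt0 z.
have tri (j : int) : (j = 0 \/ 1 <= j \/ j <= -1)%R by clear; lia.
by case: (nrm_rep k_gt0 z) => zn; have [j E] := eqm_trans (eqm_sym zn) zr;
  case: (tri j) => [j0|[j0|j0]]; nia.
Qed.

Lemma nrm_lift z (y : int) : eqm z y -> exists i : int, nrm z = absz (y + i * Posz (2 * k))%R.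
Proof.
by move=> zy; case: (nrm_rep k_gt0 z) => zn;
  have [j E] := eqm_trans (eqm_sym zn) zy; exists j; lia.
Qed.

Definition posb z := (z == Posz (nrm z) %[mod Posz (2 * k)])%Z.

Lemma posP z : reflect (pos z) (posb z).
Proof.
rewrite /posb eqz_mod_dvd; apply: (iffP dvdzP) => -[j E]; exists j; lia.
Qed.

Lemma posbN z : ~~ posb z -> posb (- z)%R.
Proof. by move/posP=> z0; apply/posP; case: (posVneg k_gt0 z). Qed.

End Signs.

(** * Instances in which all targets are positive *)

Section Flip.

Variables (T : finType) (k : nat).
Hypothesis k_gt0 : 0 < k.
Implicit Types (W A B : {set T}) (u v w x y : T).

Local Ltac clia := clear - k_gt0; lia.

Local Notation nrm := (nrm k).
Local Notation eqm := (eqm k).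
Local Notation pos := (pos k).
Local Notation valid := (@valid T k).
Local Notation solvable := (@solvable T k).

Variable I : inst T.
Hypothesis vI : valid I.
Local Notation W := (iW I).
Local Notation e := (iE I).
Local Notation p := (iP I).
Local Notation q := (iQ I).
Local Notation t := (iT I).

Hypothesis Z0 : iZ I = set0.
Hypothesis W_gt1 : 1 < #|W|.
Hypothesis k_gt1 : 1 < k.
Hypothesis s0 : forall x, x \in W -> dg I [set x] <= 2 * k - 2 + nrm (t x).
Hypothesis allpos : forall x, x \in W -> [/\ pos (t x), 0 < nrm (t x), nrm (t x) < k & q x = 0].
Hypothesis IH : forall J, valid J -> mu k J < mu k I -> solvable J.

(** All arcs come in, so the targets sum to [- ar I W]. With [2k] or more arcs this residue would
    have norm at most [ar I W - 2k], against [v_arc]. *)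
Lemma ar_lt : ar I W < 2 * k /\ eqm (ts I W) (- Posz (ar I W))%R.
Proof.
have q0 : \sum_(x in W) q x = 0 by apply: big1 => x /allpos [].
have E : eqm (ts I W) (- Posz (ar I W))%R.
  have [j Ej] := v_sum vI; exists j; rewrite ar_sumE; move: Ej; rewrite q0; clia.
split=> //; rewrite ltnNge; apply/negP=> big.
have /(nrm_min k_gt0) : eqm (ts I W) (Posz (2 * k) - Posz (ar I W))%R.
  by case: E => j Ej; exists (j - 1)%R; move: Ej; clia.
by have := v_arc vI; move: big; clia.
Qed.

Lemma set1W x : [set x] != W.
Proof. by apply: contraTneq W_gt1 => <-; rewrite cards1. Qed.

Lemma few_arcs : exists2 x, x \in W & p x < k.
Proof.
have [a aW] : exists a, a \in W by apply/set0Pn; rewrite -card_gt0 ltnW.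
have [pa|pa] := ltnP (p a) k; first by exists a.
have [b /setD1P [ba bW]] : exists b, b \in W :\ a.
  apply/set0Pn; rewrite -card_gt0; have := cardsD1 a W; rewrite aW; move: W_gt1; clia.
exists b => //; have [+ _] := ar_lt; rewrite ar_sumE (bigD1 a) //= (bigD1 b) ?bW //=.
move: pa; clia.
Qed.

(** With equal signs everywhere [move_edge] does not apply. So one vertex [x] is made negative: its
    [p x < k] incoming arcs are replaced by [b] outgoing ones and its target is shifted by
    [p x + b]. The edges must contribute the same as before, but the target is now congruent to
    [p x - k]; degree and norm at [x] change by the same amount [b - p x]. *)
Lemma flip_solvable : solvable I.
Proof.
have [x xW px] := few_arcs; have [tpos t0 tk qx] := allpos xW.
pose b := k - nrm (t x).
pose J := Inst W e (fun y => if y == x then 0 else p y)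
  (fun y => if y == x then b else q y) (shift t x (Posz (p x + b))) set0.
have sumP A : \sum_(y in A) iP J y + (x \in A) * p x = \sum_(y in A) p y.
  have [xA|xA] := boolP (x \in A); last first.
    rewrite mul0n addn0; apply: eq_bigr => y yA /=; case: eqP => // yx.
    by move: xA; rewrite -yx yA.
  rewrite (bigD1 x) //= eqxx [RHS](bigD1 x) //= add0n mul1n addnC; congr (_ + _).
  by apply: eq_bigr => y /andP[_ /negbTE ->].
have sumQ A : \sum_(y in A) iQ J y = \sum_(y in A) q y + (x \in A) * b.
  have [xA|xA] := boolP (x \in A); last first.
    rewrite mul0n addn0; apply: eq_bigr => y yA /=; case: eqP => // yx.
    by move: xA; rewrite -yx yA.
  rewrite (bigD1 x) //= eqxx [in RHS](bigD1 x) //= qx add0n mul1n addnC; congr (_ + _).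
  by apply: eq_bigr => y /andP[_ /negbTE ->].
have arJ A : ar J A + (x \in A) * p x = ar I A + (x \in A) * b.
  by rewrite !ar_sumE; have := sumP A; have := sumQ A; clia.
have dgJ A : dg J A + (x \in A) * p x = dg I A + (x \in A) * b.
  by have := arJ A; rewrite /dg -[iE J]/e -[iW J]/W; clia.
have tsJ A : ts J A = (ts I A + if x \in A then Posz (p x + b) else 0)%R by exact: sum_shift.
have b_def : b + nrm (t x) = k by rewrite /b; move: tk; clia.
have tJx : iT J x = (t x + Posz (p x + b))%R by rewrite /= /shift eqxx.
have tJy y : y != x -> iT J y = t y by rewrite /= /shift => /negbTE ->; rewrite addr0.
have posN : eqm (- iT J x)%R (Posz (k - p x)).
  by case: tpos => j Ej; exists (- j - 1)%R; rewrite tJx; move: Ej b_def px; clia.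
have nrmJ : nrm (iT J x) = k - p x.
  by rewrite -(nrmN k_gt0) (nrm_val k_gt0 posN) // leq_subr.
have balJ y : y \in W -> bal k J [set y].
  move=> yW; have := bal1 vI Z0 yW (set1W y); have := dgJ [set y].
  rewrite /bal !ts1 inE; have [yx|yx] := eqVneq y x.
    by subst y; rewrite nrmJ ?eqxx /=; move: b_def px; clia.
  by rewrite tJy // ?[x == y]eq_sym ?(negbTE yx) /=; clia.
have parJ y : y \in W -> odd (absz (iT J y)) = odd (dg J [set y]).
  move=> yW; apply: (@par_step (t y) _ (dg I [set y]) _ (Posz ((y == x) * b)) _ (v_par vI yW)).
  have := dgJ [set y]; rewrite inE eq_sym; have [yx|yx] := eqVneq y x.
    by rewrite yx tJx; clia.
  by rewrite tJy //; clia.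
have sameT y : y \in W -> (iT J y - Posz (iQ J y) + Posz (iP J y))%R =
    (t y - Posz (q y) + Posz (p y))%R.
  move=> yW; have [yx|yx] := eqVneq y x; first by rewrite yx tJx /= eqxx qx; clia.
  by rewrite tJy //= (negbTE yx).
apply: wsolvableW => //.
(* Larger sets containing [x] may have become tight or worse. All proper subsets of a smallest such
   set are balanced, so [contract] applies with [J] inside the set and the original [I] outside. *)
pose bad A := [&& A \subset W, A != W, 1 < #|A| & dg J A <= 2 * k - 2 + nrm (ts J A)].
have small J' : valid J' -> #|iW J'| < #|W| -> sz J' <= sz I -> solvable J'.
  move=> vJ' ltW lesz; apply: IH => //; apply: (mu_lt1 k_gt0 vJ').
  by move: ltW lesz; clia.
have [/existsP [A0 badA0]|nobad] := boolP [exists A, bad A].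
  case: (arg_minnP (fun A : {set T} => #|A|) badA0) => A /and4P [AW AnW A1 tA] Amin.
  have [a aA] : exists a, a \in A by apply/set0Pn; rewrite -card_gt0 ltnW.
  have balA B : B \subset A -> B != set0 -> B != A -> B != iZ J -> bal k J B.
    move=> BA B0 BnA _; have [B1|B1] := boolP (1 < #|B|); last first.
      rewrite -leqNgt in B1; move: B0; rewrite -card_gt0 => B0.
      have /cards1P[y By] : #|B| == 1 by rewrite eqn_leq B1 B0.
      by subst B; apply: balJ; apply: (subsetP AW); rewrite -sub1set.
    rewrite /bal leqNgt; apply/negP=> ltB.
    have ltBA : #|B| < #|A| by apply: proper_card; rewrite properEneq BnA BA.
    have /Amin : bad B; last by rewrite leqNgt ltBA.
    rewrite /bad B1 (subset_trans BA AW) (ltnW ltB) /= andbT.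
    by apply: contraTneq ltBA => ->; rewrite -leqNgt subset_leq_card.
  have sameA y : y \in A -> eqm (iT J y - Posz (iQ J y) + Posz (iP J y))%R
      (t y - Posz (q y) + Posz (p y))%R.
    by move=> yA; rewrite sameT ?(subsetP AW) //; exact: eqm_refl.
  have [f fE fN] := @contract _ _ k_gt0 _ vI A AW AnW A1 a aA J erefl erefl sameA
    (or_introl erefl) (fun y yA => parJ y (subsetP AW _ yA)) tA balA small.
  by exists f => // y yW; case: (fN y yW).
have gapJ A : A \subset W -> A != W -> 1 < #|A| -> 2 * k - 2 + nrm (ts J A) < dg J A.
  move=> AW AnW A1; rewrite ltnNge; apply: contra nobad => tA.
  by apply/existsP; exists A; rewrite /bad AW AnW A1.
have vJ : valid J.
  split=> //; try by case: vI.
  - by left.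
  - have [j Ej] := v_sum vI; exists j; rewrite -[iW J]/W tsJ xW.
    have := sumP W; have := sumQ W; rewrite xW; move: Ej; clia.
  - have [Dlt [j Ej]] := ar_lt; rewrite -[iW J]/W.
    (* The norm is the absolute value of some representative; the inequality is verified for every
       representative, according to the sign of [i]. *)
    have /(nrm_lift k_gt0) [i ->] : eqm (ts J W)
        (Posz (p x + b) - Posz (ar I W))%R.
      by exists j; rewrite tsJ xW; move: Ej; clia.
    have := arJ W; rewrite xW mul1n mul1n => arW.
    have pD : p x <= ar I W by rewrite ar_sumE (bigD1 x) //=; clia.
    have [i0|[i0|i0]] : (i = 0 \/ 1 <= i \/ i <= -1)%R by clear; lia.
    + by subst i; move: arW pD Dlt b_def t0 px; clia.
    + have : (i * Posz (2 * k) >= Posz (2 * k))%R by move: i0; clear; nia.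
      by move: arW pD Dlt b_def t0 px; clia.
    + have : (i * Posz (2 * k) <= - Posz (2 * k))%R by move: i0; clear; nia.
      by move: arW pD Dlt b_def t0 px; clia.
  move=> A AW A0 AnW _; have [A1|A1] := boolP (1 < #|A|).
    by rewrite /bal ltnW // gapJ.
  rewrite -leqNgt in A1; move: A0; rewrite -card_gt0 => A0.
  have /cards1P[y Ay] : #|A| == 1 by rewrite eqn_leq A1 A0.
  by subst A; apply: balJ; rewrite -sub1set.
have looseJ : loose k J.
  by move=> A AW AnW A1; apply: (dg_gap k_gt0 vJ AW); exact: gapJ.
have [y yW exy] : exists2 y, y \in W & 0 < e x y.
  have x0 : [set x] != set0 by apply/set0Pn; exists x; rewrite set11.
  have sx : [set x] \subset W by rewrite sub1set.
  have := cut_conn k_gt0 vI sx x0 (set1W x) Z0.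
  rewrite (cut1 (v_irr vI x) xW) => c0.
  have : 0 < \sum_(y in W) e x y by move: c0 k_gt1; clia.
  rewrite lt0n sum_nat_eq0 negb_forall => /existsP [y]; rewrite negb_imply => /andP[].
  by rewrite -lt0n; exists y.
have yx : y != x by apply: contraTneq exy => ->; rewrite (v_irr vI).
have [typos ty0 _ _] := allpos yW.
(* The edge is directed from [y], which is still positive, to [x], which is now negative. *)
have [|||||J2 [vJ2 szJ2 WJ2 solJ2]] := @move_edge _ _ k_gt0 J vJ looseJ erefl y x yW xW yx.
- by rewrite (v_sym vJ).
- by rewrite tJy.
- by rewrite tJy.
- by rewrite nrmJ subn_gt0.
- by rewrite /pos nrmN // nrmJ.
have {}solJ2 : wsolvable k J.
  apply/solJ2/IH => //; apply: (mu_lt1 k_gt0 vJ2); rewrite WJ2.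
  by move: szJ2; rewrite -[sz J]/(sz I) -[iW J]/W; clia.
have [f fE fN] := solJ2; exists f => // z zW.
have [j Ej] := fN z zW; exists j; have := sameT z zW; move: Ej.
by rewrite /net -[iW J]/W; clia.
Qed.

End Flip.

(** * The orientation theorem *)

Section ModOrient.

Variables (T : finType) (k : nat).
Hypothesis k_gt0 : 0 < k.
Implicit Types (W A B : {set T}) (u v w x y : T) (I J : inst T).

Local Ltac clia := clear - k_gt0; lia.

Local Notation nrm := (nrm k).
Local Notation eqm := (eqm k).
Local Notation pos := (pos k).
Local Notation valid := (@valid T k).
Local Notation solvable := (@solvable T k).

Lemma reducible_opp I : reducible k (opp I) -> reducible k I.
Proof.
case=> J [vJ muJ solJ]; exists J; split=> //; first by rewrite mu_opp in muJ.
by move/solJ; exact: solvable_opp.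
Qed.

Lemma loose_opp I : loose k I -> loose k (opp I).
Proof. by move=> lI A AW AnW A1; rewrite dg_opp // ts_opp nrmN //; exact: lI. Qed.

Lemma other_vertex W v : 1 < #|W| -> v \in W -> exists2 u, u \in W & u != v.
Proof.
move=> W1 vW; have : 0 < #|W :\ v| by have := cardsD1 v W; rewrite vW; move: W1; clia.
by case/card_gt0P=> u /setD1P [uv uW]; exists u.
Qed.

(** Without edges at [v], the arcs not at [v] must alone satisfy the cut condition of the remaining
    vertices. Combined with [v_arc], this leaves at most [nrm (iT I v)] arcs for [v]. *)
Lemma isolated I v : valid I -> v \in iW I -> 1 < #|iW I| ->
  (iZ I = set0 \/ iZ I = [set v]) -> (forall y, y \in iW I -> iE I v y = 0) ->
  2 * k - 2 + nrm (ts I (iW I)) - nrm (iT I v) + (iP I v + iQ I v) <= ar I (iW I).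
Proof.
move=> vI vW W1 Zv ev.
have sv : [set v] \subset iW I by rewrite sub1set.
have dv : dg I [set v] = iP I v + iQ I v by rewrite (dg1 vI vW) big1 // addnA.
have cv : cut (iE I) (iW I) [set v] = 0.
  by move: dv; rewrite /dg ar1; clia.
have := dg_compl k_gt0 vI sv; rewrite cv muln0 add0n dv => arE.
have [u uW uv] := other_vertex W1 vW.
have bW : bal k I (iW I :\: [set v]).
  apply: (v_cut vI); first exact: subsetDl.
  - by apply/set0Pn; exists u; rewrite !inE uv.
  - by apply: contraTneq vW => <-; rewrite !inE eqxx.
  - case: Zv => ->; first by apply/set0Pn; exists u; rewrite !inE uv.
    by apply: contraTneq (set11 v) => <-; rewrite !inE eqxx.
have := nrm_compl k_gt0 sv; rewrite ts1; move: bW; rewrite /bal.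
by move: arE; clia.
Qed.

(* The lifts available at [v]; when none is left, [v] has no arcs to the outside
   vertex and at most one neighbour. *)
Lemma lift_or_pendant I v Z : valid I -> loose k I -> v \in iW I -> 1 < #|iW I| ->
  (Z = set0 \/ exists2 v, Z = [set v] & nrm (iT I v) = 0) ->
  (forall x, x != v -> [set x] != Z -> [set x] != iZ I) ->
  ([set v] != Z -> 2 * k + nrm (iT I v) <= dg I [set v]) ->
  (iZ I = set0 \/ iZ I = [set v]) ->
  reducible k I \/ [/\ iP I v = 0, iQ I v = 0 & exists2 u, u \in iW I &
    u != v /\ (forall y, y \in iW I -> y != u -> iE I v y = 0)].
Proof.
move=> vI lI vW W1 Z0 Zsub Zv IZ.
have [[p0 q0]|pq] : (0 < iP I v /\ 0 < iQ I v) \/ (iP I v = 0 \/ iQ I v = 0) by clia.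
  by left; apply: (move_cancel k_gt0 vI lI vW Z0).
have [/existsP [u /andP[uW eu]]|] := boolP [exists u, (u \in iW I) && (0 < iE I v u)].
  have uv : u != v by apply: contraTneq eu => ->; rewrite (v_irr vI).
  have [p0|p0] := posnP (iP I v); last first.
    by left; apply: (move_arc k_gt0 vI lI vW Z0 Zsub Zv uW uv).
  have [q0|q0] := posnP (iQ I v); last first.
    left; apply: reducible_opp.
    apply: (move_arc k_gt0 (valid_opp k_gt0 vI) (loose_opp lI) vW (Z := Z) _ Zsub _ uW uv) => //.
      by case: Z0 => [|[w Ew w0]]; [left | right; exists w => //=; rewrite nrmN].
    by rewrite dg_opp //= nrmN.
  have [/existsP [w /and3P[wW wu ew]]|] :=
      boolP [exists w, [&& w \in iW I, w != u & 0 < iE I v w]].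
    have wv : w != v by apply: contraTneq ew => ->; rewrite (v_irr vI).
    left; apply: (move_lift k_gt0 vI lI vW Z0 Zsub Zv uW wW uv wv _ eu ew).
    by rewrite eq_sym.
  rewrite negb_exists => /forallP no; right; split=> //; exists u => //; split=> // y yW yu.
  by apply/eqP; have := no y; rewrite yW yu /= -leqNgt leqn0.
rewrite negb_exists => /forallP no; right.
have ev y : y \in iW I -> iE I v y = 0.
  by move=> yW; apply/eqP; have := no y; rewrite yW /= -leqNgt leqn0.
have := isolated vI vW W1 IZ ev; have := v_arc vI => arI isoI.
have [u uW uv] := other_vertex W1 vW.
have dv : dg I [set v] = iP I v + iQ I v by rewrite (dg1 vI vW) big1 // addnA.
suff [pv qv] : iP I v = 0 /\ iQ I v = 0.
  by split=> //; exists u => //; split=> // y yW _; exact: ev.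
have [vZ|vZ] := eqVneq [set v] Z; last first.
  by have := Zv vZ; rewrite dv; move: arI isoI; clia.
case: Z0 => [Z0|[w Zw w0]].
  by move: (set11 v); rewrite vZ Z0 inE.
have vw : v = w by apply/set1P; rewrite -Zw -vZ set11.
by move: arI isoI; rewrite vw w0 subn0; clia.
Qed.

Lemma contract_tight I A : valid I -> A \subset iW I -> A != iW I -> 1 < #|A| ->
  dg I A <= 2 * k - 2 + nrm (ts I A) ->
  (forall J, valid J -> mu k J < mu k I -> solvable J) -> solvable I.
Proof.
move=> vI AW AnW A1 tA IH.
have [a aA] : exists a, a \in A by apply/set0Pn; rewrite -card_gt0 ltnW.
have [||||f fE fN] := @contract _ _ k_gt0 _ vI A AW AnW A1 a aA I erefl erefl
   (fun y _ => eqm_refl _ _) (v_exc vI).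
- by move=> x xA; apply: (v_par vI); apply: (subsetP AW).
- exact: tA.
- move=> B BA B0 BnA BZ; apply: (v_cut vI) => //; first exact: subset_trans AW.
  by apply: contra BnA => /eqP BW; rewrite eqEsubset BA BW AW.
- move=> J vJ ltW lesz; apply: IH => //; apply: (mu_lt1 k_gt0 vJ).
  by move: ltW lesz; clia.
by exists f => // x xW; have := fN x xW; rewrite if_same.
Qed.

Lemma mod_orient_zero I v : valid I -> loose k I -> v \in iW I -> 1 < #|iW I| ->
  nrm (iT I v) = 0 -> (iZ I = set0 \/ iZ I = [set v]) -> reducible k I.
Proof.
move=> vI lI vW W1 v0 IZ.
have [|||//|[pv qv [u uW [uv ev]]]] := @lift_or_pendant I v [set v] vI lI vW W1 _ _ _ IZ.
- by right; exists v.
- move=> x xv xZ; case: IZ => -> //.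
  by apply/set0Pn; exists x; rewrite set11.
- by rewrite eqxx.
exact: (drop_vertex k_gt0 vI vW uW uv).
Qed.

(** If no lift is available, all edges at [v] go to one vertex [u]. The degree of [u] is then that
    of [v] plus that of the pair, and subadditivity of the norm gives [u] slack 2 as well, so two
    parallel edges can be deleted. *)
Lemma mod_orient_big I v : valid I -> loose k I -> v \in iW I -> 1 < #|iW I| ->
  iZ I = set0 -> 2 * k - 2 + nrm (iT I v) < dg I [set v] -> reducible k I.
Proof.
move=> vI lI vW W1 IZ big.
have sv : [set v] \subset iW I by rewrite sub1set.
have {}big : 2 * k + nrm (iT I v) <= dg I [set v].
  by rewrite -ts1; apply: (dg_gap k_gt0 vI sv); rewrite ts1.
have [||||//|[pv qv [u uW [uv ev]]]] := @lift_or_pendant I v set0 vI lI vW W1.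
- by left.
- by move=> x _; rewrite IZ.
- by [].
- by left.
have vu : v != u by rewrite eq_sym.
have dv : dg I [set v] = iE I v u.
  rewrite (dg1 vI vW) pv qv !addn0 (bigD1 u) //= big1 ?addn0 // => y /andP[]; exact: ev.
have dvu : nrm (iT I v + iT I u)%R <= dg I [set v; u].
  rewrite -(ts2 _ vu); have [->|nW] := eqVneq [set v; u] (iW I).
    by rewrite dgW; exact: ts_le_ar.
  apply: leq_trans (lI [set v; u] _ nW _); first exact: leq_addl.
    by rewrite subUset !sub1set vW uW.
  by rewrite cards2 vu.
have := dgU1 k_gt0 vI vW uW vu; rewrite dv => duE.
apply: (move_pair k_gt0 vI lI IZ vW uW vu) => //; first by rewrite dv in big; move: big; clia.
have := nrmD k_gt0 (iT I v + iT I u)%R (- iT I v)%R.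
rewrite addrAC addrN add0r nrmN //; move: duE dvu big; rewrite dv; clia.
Qed.

(** Induction on [mu]. Once tight sets, zero targets and large degrees are gone, the bound is
    automatic and only the congruences matter. If both signs occur, connectivity yields an edge
    between them to delete; a common sign is broken by [flip_solvable]. *)
Theorem mod_orient I : valid I -> solvable I.
Proof.
have [n] := ubnP (mu k I); elim: n => // n IHn in I *; rewrite ltnS => mu_n vI.
have {n IHn mu_n} IH J : valid J -> mu k J < mu k I -> solvable J.
  by move=> vJ lt; apply: IHn => //; apply: leq_trans mu_n.
have red : reducible k I -> solvable I.
  by case=> J [vJ muJ]; apply; exact: IH.
have [/card_le1P W1|W1] := leqP #|iW I| 1.
  exists (fun _ _ => 0) => [x y xW yW|x xW].
    by have /eqP -> : x == y; [have := W1 _ yW x; rewrite xW inE => <- | rewrite (v_irr vI)].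
  have Wx : iW I = [set x].
    by apply/setP=> y; have := W1 _ xW y; rewrite !inE.
  have E : eqm (net I (fun _ _ => 0) x) (iT I x).
    have [j E] := v_sum vI; exists (- j)%R; move: E.
    by rewrite /net Wx ts1 !big_set1; clia.
  split=> //; apply: (net_bound k_gt0 E (d := ar I (iW I))).
    by rewrite /net Wx ar1 !big_set1; clia.
  by have := v_arc vI; rewrite Wx ts1.
have [/existsP [A /and4P [AW AnW A1 tA]]|notight] := boolP [exists A : {set T},
    [&& A \subset iW I, A != iW I, 1 < #|A| & dg I A <= 2 * k - 2 + nrm (ts I A)]].
  exact: (contract_tight vI AW AnW A1 tA IH).
have lI : loose k I.
  move=> A AW AnW A1; apply: (dg_gap k_gt0 vI AW); rewrite ltnNge.
  by apply: contra notight => tA; apply/existsP; exists A; rewrite AW AnW A1.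
(* An exempt vertex of the instance has target 0 and is reduced at once; outside [iW I] the
   exemption is void. *)
wlog IZ : I vI IH red W1 lI {notight} / iZ I = set0.
  move=> wl; have [Z0|[v Zv v0]] := v_exc vI; first exact: (wl I).
  have [vW|vW] := boolP (v \in iW I).
    by apply: red; apply: (mod_orient_zero vI lI vW W1 v0); right.
  apply: (wl (Inst (iW I) (iE I) (iP I) (iQ I) (iT I) set0)) => //.
  split; try by case: vI.
    by left.
  move=> A AW A0 AnW _; apply: (v_cut vI) => //.
  by apply: contraNneq vW => AZ; rewrite -sub1set -Zv -AZ.
have [/existsP [v /andP[vW /eqP v0]]|] := boolP [exists v, (v \in iW I) && (nrm (iT I v) == 0)].
  by apply: red; apply: (mod_orient_zero vI lI vW W1 v0); left.
rewrite negb_exists => /forallP nz.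
have {}nz x : x \in iW I -> 0 < nrm (iT I x).
  by move=> xW; have := nz x; rewrite xW /= -lt0n.
have [/existsP [v /andP[vW big]]|] :=
    boolP [exists v, (v \in iW I) && (2 * k - 2 + nrm (iT I v) < dg I [set v])].
  exact: red (mod_orient_big vI lI vW W1 IZ big).
rewrite negb_exists => /forallP s0.
have {}s0 x : x \in iW I -> dg I [set x] <= 2 * k - 2 + nrm (iT I x).
  by move=> xW; have := s0 x; rewrite xW /= -leqNgt.
(* Modulo 2 the net out-degree is determined by the degree, so for [k = 1] any orientation works. *)
have [k1|k1] := leqP k 1.
  apply: (wsolvableW k_gt0 vI s0); exists (orient (iE I)).
    by move=> x y _ _; apply: (orientE (v_sym vI) (v_irr vI)).
  move=> x xW; have := v_par vI xW; rewrite (dg1 vI xW).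
  have -> : \sum_(y in iW I) iE I x y =
      \sum_(y in iW I) orient (iE I) x y + \sum_(y in iW I) orient (iE I) y x.
    by rewrite -big_split; apply: eq_bigr => y _ /=; rewrite (orientE (v_sym vI) (v_irr vI)).
  have -> : k = 1 by move: k1; clia.
  move=> par; exists ((net I (orient (iE I)) x - iT I x) %/ 2)%Z.
  by move: par; rewrite /net; clear; lia.
have [/existsP [x /and3P[xW q0 px]]|noq] :=
    boolP [exists x, [&& x \in iW I, 0 < iQ I x & posb k (iT I x)]].
  by apply: red; apply: (move_out k_gt0 vI lI IZ xW q0 (nz x xW)) => //; apply/posP.
have s0o x : x \in iW I -> dg (opp I) [set x] <= 2 * k - 2 + nrm (- iT I x)%R.
  by move=> xW; rewrite dg_opp // nrmN // s0.
have nzo x : x \in iW I -> 0 < nrm (- iT I x)%R by move=> xW; rewrite nrmN // nz.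
have [/existsP [x /and3P[xW p0 px]]|nop] :=
    boolP [exists x, [&& x \in iW I, 0 < iP I x & posb k (- iT I x)%R]].
  apply/red/reducible_opp; apply: (move_out k_gt0 (valid_opp k_gt0 vI) (loose_opp lI) IZ xW p0) => //.
    exact: nzo.
  by apply/posP.
have edge x y : x \in iW I -> y \in iW I -> 0 < iE I x y ->
    posb k (iT I x) -> posb k (- iT I y)%R -> solvable I.
  move=> xW yW exy px py; have xy : x != y by apply: contraTneq exy => ->; rewrite (v_irr vI).
  have [J [vJ szJ WJ solJ]] := move_edge k_gt0 vI lI IZ xW yW xy exy (nz x xW)
     (posP k_gt0 _ px) (nz y yW) (posP k_gt0 _ py).
  apply: (wsolvableW k_gt0 vI s0); apply/solJ/IH => //; apply: (mu_lt1 k_gt0 vJ).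
  by rewrite WJ; move: szJ; clia.
have conn A : A \subset iW I -> A != set0 -> A != iW I ->
    exists x y, [/\ x \in A, y \in iW I :\: A & 0 < iE I x y].
  move=> AW A0 AnW; have := cut_conn k_gt0 vI AW A0 AnW IZ => c0.
  have : cut (iE I) (iW I) A != 0 by move: c0 k1; clia.
  rewrite sum_nat_eq0 negb_forall => /existsP [x]; rewrite negb_imply => /andP[xA].
  rewrite sum_nat_eq0 negb_forall => /existsP [y]; rewrite negb_imply => /andP[yA].
  by rewrite -lt0n => exy; exists x, y.
(* The residue [k] has both signs, so any edge at [x] can be directed to suit its other end. *)
have full x : x \in iW I -> nrm (iT I x) = k -> solvable I.
  move=> xW xk; have [xp xn] := pos_k k_gt0 xk.
  have x0 : [set x] != set0 by apply/set0Pn; exists x; rewrite set11.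
  have xnW : [set x] != iW I by apply: contraTneq W1 => <-; rewrite cards1.
  have [|x' [y [/set1P -> /setDP [yW _] exy]]] := conn [set x] _ x0 xnW.
    by rewrite sub1set.
  have [py|py] := boolP (posb k (iT I y)).
    by apply: (edge y x); rewrite // ?(v_sym vI y) //; apply/posP.
  by apply: (edge x y) => //; [apply/posP | exact: posbN].
have lek x : nrm (iT I x) <= k by exact: nrm_le.
have [/existsP [x /andP[xW /eqP xk]]|nok] := boolP [exists x, (x \in iW I) && (nrm (iT I x) == k)].
  exact: (full x).
have ltk x : x \in iW I -> nrm (iT I x) < k.
  move=> xW; rewrite ltn_neqAle lek andbT; apply: contra nok => xk.
  by apply/existsP; exists x; rewrite xW.
pose S := [set x in iW I | posb k (iT I x)].
have SW : S \subset iW I by apply/subsetP=> x; rewrite inE => /andP[].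
have [Se|Sn] := eqVneq S (iW I).
  apply: (flip_solvable k_gt0 vI IZ W1 k1 s0) => // x xW.
  have px : posb k (iT I x) by move: xW; rewrite -Se inE => /andP[].
  split; [exact/posP | exact: nz | exact: ltk|].
  apply/eqP; rewrite -leqn0 leqNgt; apply: contra noq => q0.
  by apply/existsP; exists x; rewrite xW q0.
have [Se|S0] := eqVneq S set0.
  have px x : x \in iW I -> posb k (- iT I x)%R.
    move=> xW; apply: posbN => //; apply/negP=> px.
    by have : x \in S; [rewrite inE xW | rewrite Se inE].
  apply: solvable_opp => //.
  apply: (flip_solvable k_gt0 (valid_opp k_gt0 vI) IZ W1 k1 s0o) => [x xW|J vJ].
    split; [exact/posP/px | exact: nzo | by rewrite /= nrmN // ltk|].
    apply/eqP; rewrite -leqn0 leqNgt; apply: contra nop => p0.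
    by apply/existsP; exists x; rewrite xW px // p0.
  by rewrite mu_opp; exact: IH.
have [x [y [xS /setDP [yW yS] exy]]] := conn S SW S0 Sn.
move: xS; rewrite inE => /andP[xW px].
apply: (edge x y) => //; apply: posbN => //.
by apply: contra yS => py; rewrite inE yW.
Qed.

End ModOrient.

(** * Orientations and arborescences *)

Section Orientations.

Variables (V E : finType).
Implicit Types (S T : {set E}) (A B U : {set V}).

(** * Orientations with bounded in-degrees *)

Section Hakimi.

Variables a b : E -> V.

Definition internal S U := \sum_(e in S) ((a e \in U) && (b e \in U)).

Lemma inside_supermod S A B :
  internal S A + internal S B <= internal S (A :&: B) + internal S (A :|: B).
Proof.
rewrite /internal -!big_split /=; apply: leq_sum => e _; rewrite !inE.
by case: (a e \in A); case: (a e \in B); case: (b e \in A); case: (b e \in B).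
Qed.

Lemma insideD1 S e U : e \in S ->
  internal S U = ((a e \in U) && (b e \in U)) + internal (S :\ e) U.
Proof.
move=> eS; rewrite /internal (bigD1 e) //=; congr (_ + _).
by apply: eq_bigl => x; rewrite !inE andbC.
Qed.

Definition hd_of (o : E -> bool) e := if o e then a e else b e.
Definition tl_of (o : E -> bool) e := if o e then b e else a e.

Lemma sum_modular (h : V -> nat) A B :
  \sum_(v in A) h v + \sum_(v in B) h v =
  \sum_(v in A :&: B) h v + \sum_(v in A :|: B) h v.
Proof.
rewrite [X in X + _]big_mkcond [X in _ + X = _]big_mkcond.
rewrite [X in _ = X + _]big_mkcond [X in _ = _ + X]big_mkcond -!big_split /=; apply: eq_bigr => v _.
by rewrite !inE; case: (v \in A); case: (v \in B); rewrite /= ?addn0.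
Qed.

(** Hakimi's theorem. Remove an edge [e] and direct it to an end lying in no set saturated by
    [S :\ e]. If both ends lay in saturated sets, the union of these would contain [e] too and, by
    supermodularity, exceed its capacity. *)
Lemma orientation_exists S (cap : V -> nat) :
  (forall U, internal S U <= \sum_(v in U) cap v) ->
  exists o : E -> bool, forall v, #|[set e in S | hd_of o e == v]| <= cap v.
Proof.
have [n] := ubnP #|S|; elim: n => // n IHn in S cap *; rewrite ltnS => leSn capP.
have [->|[e eS]] := set_0Vmem S.
  exists (fun=> true) => v; rewrite (_ : [set _ | _] = set0) ?cards0 //.
  by apply/setP=> x; rewrite !inE.
have card_S : #|S :\ e| < n by move: leSn; rewrite (cardsD1 e) eS; lia.
have step x : (x = a e \/ x = b e) ->
    (forall U, x \in U -> internal (S :\ e) U < \sum_(v in U) cap v) ->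
    exists o : E -> bool, forall v, #|[set e in S | hd_of o e == v]| <= cap v.
  move=> xe ok; have capx : 0 < cap x.
    by have := ok [set x] (set11 _); rewrite big_set1; apply: leq_trans.
  have [|o oP] := IHn (S :\ e) (fun v => cap v - (v == x)) card_S.
    move=> U; have [xU|xU] := boolP (x \in U); last first.
      have -> : \sum_(v in U) (cap v - (v == x)) = \sum_(v in U) cap v.
        apply: eq_bigr => v vU; case: eqP => [vx|_]; last by rewrite subn0.
        by move: xU; rewrite -vx vU.
      by apply: leq_trans (capP U); rewrite (insideD1 _ eS) leq_addl.
    have := ok U xU; rewrite (bigD1 x) // [in X in _ -> X](bigD1 x) //= eqxx.
    have -> : \sum_(v in U | v != x) (cap v - (v == x)) = \sum_(v in U | v != x) cap v.
      by apply: eq_bigr => v /andP[_ /negbTE ->]; rewrite subn0.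
    by move: capx; clear; lia.
  pose o' z := if z == e then x == a e else o z.
  have o'e : hd_of o' e = x.
    by rewrite /hd_of /o' eqxx; case: eqP => [->|] //; case: xe.
  exists o' => v.
  have -> : [set z in S | hd_of o' z == v] =
      (if v == x then [set e] else set0) :|: [set z in S :\ e | hd_of o z == v].
    apply/setP=> z; rewrite !inE; have [->|ze] := eqVneq z e.
      by rewrite eS o'e /= orbF eq_sym; case: eqP; rewrite inE // eqxx.
    rewrite /hd_of /o' (negbTE ze) /=.
    by case: (v == x); rewrite !inE ?(negbTE ze).
  apply: leq_trans (leq_card_setU _ _) _; have := oP v; have [->|_] := eqVneq v x.
    by rewrite cards1; move: capx; clear; lia.
  by rewrite cards0; clear; lia.
have [/forallP Ha|] := boolP [forall U : {set V}, (a e \in U) ==> (internal (S :\ e) U < \sum_(v in U) cap v)].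
  by apply: (step (a e)) => [|U]; [left | apply/implyP/Ha].
rewrite negb_forall => /existsP [A]; rewrite negb_imply -leqNgt => /andP[aA tA].
have [/forallP Hb|] := boolP [forall U : {set V}, (b e \in U) ==> (internal (S :\ e) U < \sum_(v in U) cap v)].
  by apply: (step (b e)) => [|U]; [right | apply/implyP/Hb].
rewrite negb_forall => /existsP [B]; rewrite negb_imply -leqNgt => /andP[bB tB].
have := capP A; have := capP B; have := capP (A :|: B); have := capP (A :&: B).
rewrite !(insideD1 _ eS) !inE aA bB orbT /=.
have := inside_supermod (S :\ e) A B; have := sum_modular cap A B.
by move: tA tB; clear; lia.
Qed.

End Hakimi.

(** * Disjoint arborescences *)

Section Edmonds.

Variables tl hd : E -> V.

Definition din S A := \sum_(e in S) ((tl e \notin A) && (hd e \in A)).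

Lemma din_submod S A B : din S (A :&: B) + din S (A :|: B) <= din S A + din S B.
Proof.
rewrite /din -!big_split /=; apply: leq_sum => e _; rewrite !inE.
by case: (tl e \in A); case: (tl e \in B); case: (hd e \in A); case: (hd e \in B).
Qed.

Lemma dinD S T A : T \subset S -> din S A = din T A + din (S :\: T) A.
Proof.
move=> TS; rewrite /din (bigID (mem T)) /=; congr (_ + _); apply: eq_bigl => y.
  by rewrite andbC; case: (boolP (y \in T)) => //= /(subsetP TS) ->.
by rewrite !inE andbC.
Qed.

Lemma din_gt0 S A : 0 < din S A -> exists2 e, e \in S & (tl e \notin A) && (hd e \in A).
Proof.
rewrite lt0n sum_nat_eq0 negb_forall => /existsP [e]; rewrite negb_imply => /andP[eS].
by rewrite eqb0 negbK; exists e.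
Qed.

Lemma din_pos S A e : e \in S -> tl e \notin A -> hd e \in A -> 0 < din S A.
Proof. by move=> eS te he; rewrite /din (bigD1 e) //= te he. Qed.

(** The cut form of having [m] arc-disjoint paths from [r] to every other vertex. *)
Definition rooted r m S := forall A, r \notin A -> A != set0 -> m <= din S A.

(** An arborescence on [U]; reachability from [r] is again stated through cuts, so that no paths
    have to be handled. *)
Definition partial_arb r U T :=
  [/\ forall e, e \in T -> (tl e \in U) && (hd e \in U),
      forall v, #|[set e in T | hd e == v]| = (v \in U) && (v != r) &
      forall A, r \notin A -> A :&: U != set0 -> 0 < din T A].

(** Lovasz's argument. An arc leaving [U] is unusable only if it enters a set of in-degree at most
    [m] in [R]. In a smallest such set [A] not inside [U], the part outside [U] has in-degree above
    [m], since [T] has no arc there; so some arc goes to it from [A :&: U]. A set [B] blocking this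
    arc would make [A :&: B] critical by submodularity, and smaller, as it misses the tail. *)
Lemma grow_arb r m S U T : rooted r m.+1 S -> T \subset S -> r \in U ->
  partial_arb r U T -> rooted r m (S :\: T) -> U != setT ->
  exists e, [/\ e \in S :\: T, tl e \in U, hd e \notin U & rooted r m (S :\: T :\ e)].
Proof.
move=> rS TS rU [TU Tin Treach] rest UnT.
pose R := S :\: T.
pose crit A := [&& r \notin A, din R A <= m & ~~ (A \subset U)].
have noT A : A :&: U = set0 -> din R A = din S A.
  move=> AU; rewrite (dinD A TS) [din T A]big1 // => e /TU /andP[_ hU].
  case: (boolP (hd e \in A)) => hA; last by rewrite andbF.
  by have : hd e \in A :&: U; [rewrite inE hA hU | rewrite AU inE].
suff [e [eR te he ok]] : exists e, [/\ e \in R, tl e \in U, hd e \notin U &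
    forall B, r \notin B -> din R B <= m -> tl e \notin B -> hd e \in B -> False].
  exists e; split=> // A rA A0; have := rest A rA A0.
  rewrite -/R; have sub : [set e] \subset R by rewrite sub1set.
  rewrite (dinD A sub) /din big_set1.
  have [/andP[tA hA]|_] := boolP ((tl e \notin A) && (hd e \in A)); last by [].
  have [le|gt] := leqP (din R A) m; first by case: (ok A).
  move=> _; move: gt; rewrite (dinD A sub) /din big_set1 tA hA /=.
  by rewrite add1n ltnS.
have [/existsP [A0 critA0]|nocrit] := boolP [exists A, crit A]; last first.
  have rU' : r \notin ~: U by rewrite inE rU.
  have U'0 : ~: U != set0.
    by apply: contra UnT => /eqP UE; rewrite -[U]setCK UE setC0.
  have [|e eR /andP[te he]] := @din_gt0 R (~: U).
    rewrite noT; first by apply: leq_trans (rS _ rU' U'0).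
    by rewrite setIC setICr.
  move: te he; rewrite !inE negbK => te he; exists e; split=> // B rB tB teB heB.
  apply: (negP nocrit); apply/existsP; exists B; rewrite /crit rB tB.
  by apply/subsetPn; exists (hd e).
case: (arg_minnP (fun A : {set V} => #|A|) critA0) => A /and3P [rA tA AU] Amin.
have rAU : r \notin A :\: U by rewrite inE rU.
have AU0 : A :\: U != set0 by rewrite setD_eq0.
have := rS _ rAU AU0; rewrite -noT; last by rewrite setDE -setIA [_ :&: U]setIC setICr setI0.
move=> big; have : exists2 e, e \in R & (tl e \in A) && (tl e \in U) && (hd e \in A :\: U).
  have /existsP [e /and3P[eR e1 e2]] : [exists e, [&& e \in R,
      (tl e \notin A :\: U) && (hd e \in A :\: U) & ~~ ((tl e \notin A) && (hd e \in A))]].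
    apply: contraT; rewrite negb_exists => /forallP no.
    suff : din R (A :\: U) <= din R A by move: big tA; clear; lia.
    apply: leq_sum => e eR; have := no e; rewrite eR andTb negb_and negbK.
    by case: ((tl e \notin A :\: U) && _) => //= ->.
  exists e => //; move: e1 e2; rewrite !inE.
  by case: (tl e \in A); case: (tl e \in U); case: (hd e \in A); case: (hd e \in U).
case=> e eR /andP[/andP[teA teU] /setDP[heA heU]]; exists e; split=> // B rB tB teB heB.
have AB0 : A :&: B != set0 by apply/set0Pn; exists (hd e); rewrite inE heA.
have AuB0 : A :|: B != set0 by apply/set0Pn; exists (hd e); rewrite inE heA.
have rAB : r \notin A :&: B by rewrite inE (negbTE rA).
have rAuB : r \notin A :|: B by rewrite inE (negbTE rA).
have /Amin : crit (A :&: B).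
  rewrite /crit rAB /=; apply/andP; split; last by apply/subsetPn; exists (hd e); rewrite ?inE ?heA.
  have := din_submod R A B; have := rest _ rAuB AuB0; rewrite -/R.
  by move: tA tB; clear; lia.
rewrite leqNgt => /negP; apply; apply: proper_card; rewrite properE subsetIl.
by apply/subsetPn; exists (tl e); rewrite ?inE ?(negbTE teB) ?andbF.
Qed.

Lemma arborescence r m S : rooted r m.+1 S -> exists T,
  [/\ T \subset S, rooted r 1 T, (forall v, #|[set e in T | hd e == v]| = (v != r)) &
      rooted r m (S :\: T)].
Proof.
move=> rS.
suff main n U T : #|~: U| <= n -> r \in U -> T \subset S -> partial_arb r U T ->
    rooted r m (S :\: T) -> exists T, [/\ T \subset S, rooted r 1 T,
      (forall v, #|[set e in T | hd e == v]| = (v != r)) & rooted r m (S :\: T)].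
  apply: (main #|~: [set r]| [set r] set0); rewrite ?sub0set ?set11 //.
    split=> [e|v|A rA]; first by rewrite in_set0.
      rewrite (_ : [set e in set0 | _] = set0); last by apply/setP=> e; rewrite !inE.
      by rewrite cards0 inE andbN.
    case/set0Pn=> v; rewrite !inE => /andP[vA /eqP vr]; by rewrite -vr vA in rA.
  by move=> A rA A0; rewrite setD0; apply: leq_trans (rS A rA A0).
elim: n => [|n IHn] in U T *.
  rewrite leqn0 cards_eq0 => /eqP U0 rU TS [TU Tin Tr] rest; exists T; split=> //.
  - move=> A rA A0; apply: Tr => //; rewrite -[U]setCK U0 setC0 setIT //.
  - by move=> v; rewrite Tin -[U]setCK U0 !inE.
move=> leU rU TS arbT rest; have [UT|UnT] := eqVneq U setT.
  by apply: (IHn U T) => //; rewrite UT setCT cards0.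
have [e [eST te he rest']] := grow_arb rS TS rU arbT rest UnT.
have [TU Tin Treach] := arbT; move: eST; rewrite inE => /andP[eT eS].
apply: (IHn (hd e |: U) (e |: T)).
- have := cardsC U; have := cardsC (hd e |: U); rewrite cardsU1 he; move: leU; clear; lia.
- by rewrite !inE rU orbT.
- by rewrite subUset sub1set eS.
- split=> [f|v|A rA AU].
  + rewrite !inE => /orP[/eqP->|/TU /andP[-> ->]]; rewrite ?te ?eqxx ?orbT //.
  + have -> : [set f in e |: T | hd f == v] =
        (if hd e == v then [set e] else set0) :|: [set f in T | hd f == v].
      apply/setP=> f; rewrite !inE; have [->|fe] := eqVneq f e.
        by rewrite (negbTE eT) orbF /=; case: eqP; rewrite ?set11 ?inE.
      by case: (hd e == v); rewrite !inE ?(negbTE fe).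
    have her : hd e != r by apply: contraNneq he => ->.
    have [ev|ev] := eqVneq (hd e) v.
      rewrite cardsU1 inE (negbTE eT) /= Tin -ev (negbTE he) addn0 !inE eqxx her //.
    by rewrite set0U Tin !inE (eq_sym v (hd e)) (negbTE ev).
  + have [AU0|AU0] := boolP (A :&: U == set0).
      have heA : hd e \in A.
        case/set0Pn: AU => v; rewrite !inE => /andP[vA /orP[/eqP <- //|vU]].
        by move/eqP/setP/(_ v): AU0; rewrite !inE vA vU.
      apply: (@din_pos _ _ e); rewrite ?inE ?eqxx //.
      by apply: contraTN AU0 => teA; apply/set0Pn; exists (tl e); rewrite inE teA.
    apply: leq_trans (Treach A rA AU0) _; by rewrite (dinD A (subsetUr [set e] T)) leq_addr.
- by move: rest'; rewrite setDDl setUC.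
Qed.

Lemma arborescences r m S : rooted r m S -> exists T : nat -> {set E},
  [/\ forall i, i < m -> T i \subset S /\ rooted r 1 (T i),
      forall i j, i < m -> j < m -> i != j -> [disjoint T i & T j] &
      forall i v, i < m -> #|[set e in T i | hd e == v]| = (v != r)].
Proof.
elim: m => [|m IHm] in S *; first by exists (fun=> set0).
case/arborescence=> T0 [T0S T0r T0in /IHm [T [T1 T2 T3]]].
exists (fun i => if i is j.+1 then T j else T0); split.
- case=> [|i] im; first by split.
  have [TS Tr] := T1 i im; split=> //; exact: subset_trans TS (subsetDl _ _).
- case=> [|i] [|j] //= im jm ij.
  + rewrite disjoint_sym; have [TS _] := T1 j jm.
    by move/disjointWl: TS; apply; rewrite -setI_eq0 setDE -setIA [_ :&: T0]setIC setICr setI0.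
  + have [TS _] := T1 i im.
    by move/disjointWl: TS; apply; rewrite -setI_eq0 setDE -setIA [_ :&: T0]setIC setICr setI0.
  + exact: T2.
- by case=> [|i] v //=; exact: T3.
Qed.

End Edmonds.

End Orientations.

(** * Alternating choice along closed trails *)

Section Alternation.

Variables (V E : finType) (tl hd : E -> V) (P M : {set E}) (r : V).

Local Notation ins S v := [set e in S | hd e == v].
Local Notation outs S v := [set e in S | tl e == v].

Hypothesis balanced : forall v, #|ins P v| = #|outs P v|.
Hypothesis MP : M \subset P.
Hypothesis M_in : forall v, v != r -> exists2 e, e \in M & hd e = v.
Hypothesis leave_r : exists2 e, e \in P & (tl e == r) && (hd e != r).

(** Such a permutation decomposes [P] into closed trails, namely its cycles. *)
Definition succ (s : {perm E}) :=
  [forall e, (e \in P) ==> ((s e \in P) && (tl (s e) == hd e))].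

Lemma succP s e : succ s -> e \in P -> s e \in P /\ tl (s e) = hd e.
Proof. by move/forallP/(_ e)/implyP=> H /H /andP[sP /eqP]. Qed.

Lemma succ_exists : exists s, succ s.
Proof.
(* The arc entering a vertex at position [i] of the enumeration is followed by the arc leaving it at
   position [i]. *)
pose f e := if e \in P then nth e (enum (outs P (hd e))) (index e (enum (ins P (hd e)))) else e.
have idx e : e \in P -> index e (enum (ins P (hd e))) < size (enum (outs P (hd e))).
  move=> eP; rewrite -cardE -balanced cardE index_mem mem_enum inE eP //=.
have fP e : e \in P -> f e \in outs P (hd e).
  by move=> eP; rewrite /f eP -mem_enum mem_nth // idx.
have f_inj : injective f.
  move=> e e'; have [eP|eP] := boolP (e \in P); have [e'P|e'P] := boolP (e' \in P).
  - move=> ff; have := fP e eP; rewrite ff; have := fP e' e'P; rewrite !inE.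
    move=> /andP[_ /eqP h1] /andP[_ /eqP h2]; have hh : hd e = hd e' by rewrite -h2 -h1.
    move: ff; rewrite /f eP e'P hh (set_nth_default e'); last by rewrite -hh idx.
    move/eqP; rewrite nth_uniq ?enum_uniq ?idx // -?hh ?idx //.
    move/eqP/(congr1 (nth e (enum (ins P (hd e))))).
    by rewrite !nth_index // mem_enum inE ?eP ?e'P ?hh /=.
  - move=> ff; have := fP e eP; rewrite ff /f (negbTE e'P) inE => /andP[].
    by rewrite (negbTE e'P).
  - move=> ff; have := fP e' e'P; rewrite -ff /f (negbTE eP) inE => /andP[].
    by rewrite (negbTE eP).
  - by rewrite /f (negbTE eP) (negbTE e'P).
exists (perm f_inj); apply/forallP=> e; apply/implyP=> eP; rewrite permE.
by have := fP e eP; rewrite inE.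
Qed.

(* A successor permutation with the fewest cycles traces each connected piece of
   the balanced digraph in a single closed trail. *)
Lemma closed_trail : exists2 s, succ s &
  forall e e', e \in P -> e' \in P -> hd e = hd e' -> e' \in porbit s e.
Proof.
have [s0 s0P] := succ_exists.
case: (arg_minnP (fun s : {perm E} => #|porbits s|) s0P) => s sP smin.
exists s => // e e' eP e'P hh; apply: contraT => notin.
have ee' : e' != e by apply: contraNneq notin => ->; exact: porbit_id.
(* Exchanging the successors of two arcs with the same head merges their cycles into one. *)
have := porbits_mul_tperm s e' e; rewrite /= notin ee' => cnt.
have /smin : succ (tperm e' e * s)%g.
  apply/forallP=> x; apply/implyP=> xP; rewrite permM.
  case: tpermP => [xe|xe|_ _].
  - by have [-> ->] := succP sP eP; rewrite xe hh eqxx.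
  - by have [-> ->] := succP sP e'P; rewrite xe hh eqxx.
  - by have [-> ->] := succP sP xP; rewrite eqxx.
rewrite -[true.*2]/2 -[nat_of_bool true]/1 in cnt.
by rewrite leqNgt -ltnS -(addn1 #|porbits s|) -cnt addn2 ltnSn.
Qed.

(** [Q] is defined by the parity of the distance [d e] to the next arc of [M] on the trail. Pairing
    each arc entering [v] with its successor, every pass through [v] contributes one or two to the
    degree, and two only if the entering arc is in [M]. *)
Lemma balanced_superset : exists Q : {set E}, [/\ M \subset Q, Q \subset P &
  forall v, #|ins P v| <= #|ins Q v| + #|outs Q v| <= #|ins P v| + #|ins M v|].
Proof.
have [s sP sorb] := closed_trail.
have img v : s @: ins P v = outs P v.
  apply/eqP; rewrite eqEcard card_imset; last exact: perm_inj.
  rewrite balanced leqnn andbT; apply/subsetP=> x /imsetP[e]; rewrite inE => /andP[eP /eqP he] ->.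
  by have [seP tse] := succP sP eP; rewrite inE seP tse he eqxx.
(* Every trail meets [M]: a head other than [r] is also the head of an arc of [M], on the same
   trail; and a trail through [r] contains the arc of [leave_r], whose head is not [r]. *)
have hit e : e \in P -> exists i, iter i s e \in M.
  move=> eP; suff [e' e'M] : exists2 e', e' \in M & e' \in porbit s e.
    by case/porbitP=> i; rewrite permX => ei; exists i; rewrite -ei.
  have far x : x \in P -> x \in porbit s e -> hd x != r ->
      exists2 e', e' \in M & e' \in porbit s e.
    move=> xP xe hx; have [e' e'M hh] := M_in hx; exists e' => //.
    have := sorb x e' xP (subsetP MP _ e'M); rewrite hh => /(_ erefl).
    by move: xe; rewrite -eq_porbit_mem => /eqP ->.
  have [her|her] := eqVneq (hd e) r; last by apply: (far e) => //; exact: porbit_id.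
  have [f fP /andP[tf hf]] := leave_r.
  have : f \in s @: ins P r by rewrite img inE fP.
  case/imsetP=> g; rewrite inE => /andP[gP /eqP hg] fg.
  apply: (far f) => //; rewrite fg.
  have /porbitP[i ->] : g \in porbit s e by apply: sorb => //; rewrite her hg.
  by rewrite -permM -expgSr mem_porbit.
have : forall e, exists d, e \in P -> iter d s e \in M /\ forall i, iter i s e \in M -> d <= i.
  move=> e; have [eP|eP] := boolP (e \in P); last by exists 0.
  by case: (ex_minnP (hit e eP)) => d dM dmin; exists d => _; split.
case/fin_all_exists=> d dP.
have dM e : e \in M -> d e = 0.
  move=> eM; have [_ dmin] := dP e (subsetP MP _ eM); apply/eqP.
  by rewrite -leqn0; apply: dmin.
have dN e : e \in P -> e \notin M -> d e = (d (s e)).+1.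
  move=> eP eM; have [seP _] := succP sP eP.
  have [d1 m1] := dP e eP; have [d2 m2] := dP (s e) seP.
  have d0 : 0 < d e by rewrite lt0n; apply: contraNneq eM => de; move: d1; rewrite de.
  apply/eqP; rewrite eqn_leq m1 ?iterSr // -(prednK d0) ltnS m2 //.
  by rewrite -iterSr prednK.
pose Q := [set e in P | ~~ odd (d e)].
have MQ : M \subset Q.
  by apply/subsetP=> e eM; rewrite inE (subsetP MP) // dM.
exists Q; split=> // [|v]; first by apply/subsetP=> e; rewrite inE => /andP[].
have -> : #|ins Q v| + #|outs Q v| = \sum_(e in ins P v) ((e \in Q) + (s e \in Q)).
  rewrite big_split /=; congr (_ + _).
    rewrite -big_mkcondr sum1dep_card; apply: eq_card => e; rewrite !inE.
    by case: (e \in P); rewrite ?andbF //= andbC.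
  rewrite -(big_imset (fun e => (e \in Q) : nat)) /=; last by move=> ? ? _ _; exact: perm_inj.
  rewrite img -big_mkcondr sum1dep_card; apply: eq_card => e; rewrite !inE.
  by case: (e \in P); rewrite ?andbF //= andbC.
have pt e : e \in ins P v -> 1 <= (e \in Q) + (s e \in Q) <= 1 + (e \in M).
  rewrite inE => /andP[eP _]; have [seP _] := succP sP eP.
  have [eM|eM] := boolP (e \in M); first by rewrite (subsetP MQ) //; case: (s e \in Q).
  by rewrite !inE eP seP (dN e) //=; case: (odd _).
apply/andP; split.
  by rewrite -sum1_card; apply: leq_sum => e /pt /andP[].
have -> : #|ins M v| = \sum_(e in ins P v) (e \in M).
  rewrite -big_mkcondr sum1dep_card; apply: eq_card => e; rewrite !inE.
  by have [/(subsetP MP) ->|] := boolP (e \in M); rewrite ?andbF ?andbT.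
rewrite -sum1_card -big_split; apply: leq_sum => e /pt /andP[] //.
Qed.

End Alternation.

(** * Tree packing in a maximum cut *)

Section TreePacking.

Variables (V E : finType) (a b : E -> V).
Implicit Types (S T : {set E}) (A B U X : {set V}).

Definition boundary S A := \sum_(e in S) ((a e \in A) (+) (b e \in A)).

Definition econn m S := forall A, A != set0 -> A != setT -> m <= boundary S A.

(** A partition is encoded by a map [g] constant exactly on its classes. The values are sets because
    [g v] will be the class of [v] itself. *)
Definition crosses (g : V -> {set V}) S := \sum_(e in S) (g (a e) != g (b e)).

Local Notation inside := (internal a b).
Local Notation hd := (hd_of a b).
Local Notation tl := (tl_of a b).

Lemma dl_setC S A : boundary S (~: A) = boundary S A.
Proof.
by apply: eq_bigr => e _; rewrite !inE; case: (a e \in A); case: (b e \in A).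
Qed.

Lemma dl_sub S T A : S \subset T -> boundary S A <= boundary T A.
Proof.
move=> ST; rewrite /boundary [X in _ <= X](bigID (mem S)) /=.
rewrite [X in _ <= X + _](eq_bigl (mem S)) ?leq_addr // => e /=.
by case: (boolP (e \in S)) => [/(subsetP ST) ->|]; rewrite ?andbF.
Qed.

Lemma din_le_dl o S A : din (tl o) (hd o) S A <= boundary S A.
Proof.
apply: leq_sum => e _; rewrite /tl_of /hd_of.
by case: (o e); case: (a e \in A); case: (b e \in A).
Qed.

Lemma rooted_econn o r m S : rooted (tl o) (hd o) r m S -> econn m S.
Proof.
move=> rS A A0 AT; have [rA|rA] := boolP (r \in A); last first.
  exact: leq_trans (rS A rA A0) (din_le_dl _ _ _).
rewrite -dl_setC; apply: leq_trans (rS _ _ _) (din_le_dl _ _ _); first by rewrite inE rA.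
by apply: contra AT => /eqP E0; rewrite -[A]setCK E0 setC0.
Qed.

(** * From the partition condition to a rooted orientation *)

Section Sparse.

Variables (c : nat) (S : {set E}) (r : V).
Hypothesis partS : forall g : V -> {set V}, c * #|g @: setT| <= crosses g S + c.

(** The edge count valid in every union of [c] forests. *)
Definition sparse S0 := [forall U : {set V}, (U != set0) ==> (inside S0 U + c <= c * #|U|)].

(** Take [S0] of maximum size. Tight sets that meet have a tight union, so the maximal ones
    partition the vertices. An edge outside [S0] has both ends in one class, so all crossing edges
    belong to [S0], and [partS] bounds their number from below. *)
Lemma sparse_spanning : exists S0, [/\ S0 \subset S, sparse S0 & c * #|V| <= #|S0| + c].
Proof.
pose ok S0 := (S0 \subset S) && sparse S0.
have ok0 : ok set0.
  rewrite /ok sub0set; apply/forallP=> U; apply/implyP; rewrite -card_gt0 => U0.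
  by rewrite /internal big_set0 add0n leq_pmulr.
case: (arg_maxnP (fun S0 : {set E} => #|S0|) ok0) => S0 /andP[S0S spS0] S0max.
exists S0; split=> //.
have sp U : U != set0 -> inside S0 U + c <= c * #|U|.
  by move=> U0; have := forallP spS0 U; rewrite U0.
pose tight U := (U != set0) && (c * #|U| <= inside S0 U + c).
have tightU A B : tight A -> tight B -> A :&: B != set0 -> tight (A :|: B).
  move=> /andP[A0 tA] /andP[B0 tB] AB0; apply/andP; split.
    by case/set0Pn: A0 => x xA; apply/set0Pn; exists x; rewrite inE xA.
  have := inside_supermod a b S0 A B; have := sp _ AB0; have := cardsUI A B.
  by move: tA tB; clear; nia.
pose g v := \bigcup_(U | tight U && (v \in U)) U.
have tight1 v : tight [set v].
  apply/andP; split; first by apply/set0Pn; exists v; rewrite set11.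
  by rewrite cards1 muln1 leq_addl.
have vg v : v \in g v by apply/bigcupP; exists [set v]; rewrite ?set11 ?tight1.
have tg v : tight (g v).
  suff [g0|/andP[//]] : g v = set0 \/ tight (g v) && (v \in g v).
    by have := vg v; rewrite g0 inE.
  apply: (big_ind (fun X => X = set0 \/ tight X && (v \in X))) => [|A B HA HB|U tU].
  - by left.
  case: HA => [->|/andP[tA vA]]; first by rewrite set0U.
  case: HB => [->|/andP[tB vB]]; first by rewrite setU0; right; rewrite tA.
  right; rewrite inE vA andbT; apply: tightU => //.
  by apply/set0Pn; exists v; rewrite inE vA.
  by right.
have gmax v U : tight U -> v \in U -> U \subset g v.
  by move=> tU vU; apply: (bigcup_max U); rewrite ?tU.
have geq u v : u \in g v -> g u = g v.
  move=> uv; have s1 := gmax _ _ (tg v) uv.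
  by apply/eqP; rewrite eqEsubset s1 andbT gmax // (subsetP s1).
have gim v X : X \in g @: setT -> (v \in X) = (X == g v).
  case/imsetP=> u _ ->; apply/idP/eqP => [/geq -> //|->]; exact: vg.
have inner e : e \in S -> e \notin S0 -> g (a e) = g (b e).
  move=> eS eS0; have nsp : ~~ sparse (e |: S0).
    apply/negP=> sp'; have /S0max : ok (e |: S0).
      by rewrite /ok sp' subUset sub1set eS S0S.
    by rewrite /= cardsU1 eS0 add1n ltnn.
  have [U] := forallPn nsp; rewrite negb_imply -ltnNge => /andP[U0].
  rewrite (@insideD1 _ _ a b _ e) ?setU11 // setU1K //.
  have := sp U U0; case: (boolP (_ && _)) => [/andP[aU bU] le1 le2|_]; last by clear; lia.
  have tU : tight U by rewrite /tight U0; move: le2; clear; lia.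
  by apply: geq; apply: (subsetP (gmax _ _ tU bU)).
have cross0 : crosses g S = crosses g S0.
  rewrite /crosses (bigID (mem S0)) /= [X in _ + X]big1 ?addn0; last first.
    by move=> e /andP[eS eS0]; rewrite inner // eqxx.
  apply: eq_bigl => e; rewrite andbC.
  by case: (boolP (e \in S0)) => //= /(subsetP S0S) ->.
have cardS0 : #|S0| = crosses g S0 + \sum_(X in g @: setT) inside S0 X.
  rewrite /crosses /internal exchange_big /= -big_split /= -sum1_card; apply: eq_bigr => e _.
  have -> : \sum_(X in g @: setT) ((a e \in X) && (b e \in X)) = (g (a e) == g (b e)).
    rewrite (bigD1 (g (a e))) ?imset_f ?inE //= vg /= gim ?imset_f ?inE // big1 ?addn0 //.
    by move=> X /andP[Xim Xne]; rewrite (gim _ _ Xim) (negbTE Xne).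
  by case: eqP.
have cardV : \sum_(X in g @: setT) #|X| = #|V|.
  rewrite -[RHS]sum1_card.
  under eq_bigr do rewrite -sum1_card big_mkcond /=.
  rewrite exchange_big /=; apply: eq_bigr => v _.
  rewrite (bigD1 (g v)) ?imset_f ?inE //= vg big1 // => X /andP[Xim Xne].
  by rewrite (gim _ _ Xim) (negbTE Xne).
have : \sum_(X in g @: setT) c * #|X| <= \sum_(X in g @: setT) (inside S0 X + c).
  by apply: leq_sum => X /imsetP[v _ ->]; have /andP[] := tg v.
rewrite big_split /= sum_nat_const -big_distrr /= cardV.
have := partS g; rewrite cross0 cardS0 => le1 le2; apply: leq_trans le2 _.
by rewrite [crosses _ _ + _]addnC -addnA leq_add2l mulnC.
Qed.

(** In-degrees are capped by [c], and by 0 at [r]; the number of edges forces equality. A set [A]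
    without [r] thus receives [c * #|A|] heads, and sparsity leaves at least [c] of them to arcs
    from outside. *)
Lemma orient_rooted : exists S0 o, S0 \subset S /\ rooted (tl o) (hd o) r c S0.
Proof.
have [S0 [S0S /forallP spS0 cardS0]] := sparse_spanning.
have sp U : U != set0 -> inside S0 U + c <= c * #|U|.
  by move=> U0; have := spS0 U; rewrite U0.
pose cap v := if v == r then 0 else c.
have sumcap U : \sum_(v in U) cap v + c * (r \in U) = c * #|U|.
  have -> : c * #|U| = \sum_(v in U) c by rewrite sum_nat_const mulnC.
  have [rU|rU] := boolP (r \in U); last first.
    rewrite muln0 addn0; apply: eq_bigr => v vU; rewrite /cap; case: eqP => // vr.
    by move: rU; rewrite -vr vU.
  rewrite (bigD1 r) //= [RHS](bigD1 r) //= {1}/cap eqxx muln1 addnC add0n; congr (_ + _).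
  by apply: eq_bigr => v /andP[_ /negbTE vr]; rewrite /cap vr.
have [|o oP] := @orientation_exists _ _ a b S0 cap.
  move=> U; have [->|U0] := eqVneq U set0.
    by rewrite /internal big1 // => e _; rewrite inE.
  by have := sp U U0; have := sumcap U; case: (r \in U); clear; nia.
have sumin A : \sum_(e in S0) (hd o e \in A) = \sum_(v in A) #|[set e in S0 | hd o e == v]|.
  under [RHS]eq_bigr do rewrite -sum1dep_card big_mkcondr /=.
  rewrite exchange_big /=; apply: eq_bigr => e _.
  have [hA|hA] := boolP (hd o e \in A).
    rewrite (bigD1 (hd o e)) //= eqxx big1 // => v /andP[_ vn].
    by rewrite eq_sym (negbTE vn).
  rewrite big1 // => v vA; case: eqP => // hv; by move: hA; rewrite hv vA.
have sumT (h : V -> nat) : \sum_(v in [set: V]) h v = \sum_v h v.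
  by apply: eq_bigl => v; rewrite inE.
have tot : \sum_v cap v <= \sum_v #|[set e in S0 | hd o e == v]|.
  rewrite -sumT -[X in _ <= X]sumT -sumin.
  have -> : \sum_(e in S0) (hd o e \in setT) = #|S0|.
    by rewrite -sum1_card; apply: eq_bigr => e _; rewrite inE.
  have := sumcap setT; rewrite inE cardsT.
  by move: cardS0; clear; lia.
have oE v : #|[set e in S0 | hd o e == v]| = cap v.
  apply/eqP; rewrite eqn_leq oP leqNgt; apply/negP=> lt.
  suff : \sum_v #|[set e in S0 | hd o e == v]| < \sum_v cap v by rewrite ltnNge tot.
  rewrite (bigD1 v) // [X in _ < X](bigD1 v) //= -addSn leq_add //.
  exact: leq_sum.
exists S0, o; split=> // A rA A0.
have : \sum_(e in S0) (hd o e \in A) = din (tl o) (hd o) S0 A + inside S0 A.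
  rewrite /din /internal -big_split; apply: eq_bigr => e _ /=; rewrite /hd_of /tl_of.
  by case: (o e); case: (a e \in A); case: (b e \in A).
rewrite sumin (eq_bigr cap) => [|v _]; last exact: oE.
have := sumcap A; rewrite (negbTE rA) muln0 addn0 => ->.
by have := sp A A0; clear; lia.
Qed.

End Sparse.

(** Classes are collected one at a time: while one is missing, an edge leaves the union of those
    collected and leads to a new class. *)
Lemma crosses_tree g T : econn 1 T -> #|g @: setT| <= crosses g T + 1.
Proof.
move=> cT; suff grow n : n <= #|g @: setT| -> exists2 Q : {set {set V}},
    Q \subset g @: setT /\ #|Q| = n &
    n <= \sum_(e in T) [&& g (a e) != g (b e), g (a e) \in Q & g (b e) \in Q] + 1.
  have [Q _ leQ] := grow _ (leqnn _); apply: leq_trans leQ _; rewrite leq_add2r.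
  by apply: leq_sum => e _; case: (g (a e) != g (b e)) => //=; case: (_ && _).
elim: n => [_|n IHn ltn]; first by exists set0; rewrite ?sub0set ?cards0.
have [Q [Qim cQ] leQ] := IHn (ltnW ltn).
have [n0|n_gt0] := posnP n.
  have /card_gt0P[X Xim] : 0 < #|g @: setT| by apply: leq_ltn_trans ltn.
  by exists [set X]; [rewrite sub1set cards1 n0 | rewrite n0 addn1].
pose A := [set v | g v \in Q].
have [] : A != set0 /\ A != setT.
  split.
    have /card_gt0P[X XQ] : 0 < #|Q| by rewrite cQ.
    have /imsetP[v _ Xv] := subsetP Qim _ XQ.
    by apply/set0Pn; exists v; rewrite inE -Xv.
  apply/negP=> /eqP AT; move: ltn; rewrite ltnNge -cQ => /negP; apply.
  apply: subset_leq_card; apply/subsetP=> X /imsetP[v _ ->].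
  by have := in_setT v; rewrite -AT inE.
move=> A0 AT; have := cT A A0 AT; rewrite lt0n sum_nat_eq0 negb_forall => /existsP [e].
rewrite negb_imply eqb0 negbK !inE => /andP[eT ab].
pose X := if g (a e) \in Q then g (b e) else g (a e).
have XQ : X \notin Q by rewrite /X; move: ab; case: (boolP (g (a e) \in Q)).
exists (X |: Q); first split.
- by rewrite subUset Qim sub1set /X; case: ifP => _; rewrite imset_f ?inE.
- by rewrite cardsU1 XQ cQ.
pose w (Q' : {set {set V}}) f : nat := [&& g (a f) != g (b f), g (a f) \in Q' & g (b f) \in Q'].
suff : \sum_(f in T) w Q f < \sum_(f in T) w (X |: Q) f.
  by move: leQ; rewrite -/(w Q _) !addn1 => le1 lt; apply: leq_trans lt.
rewrite (bigD1 e) // [X in _ < X](bigD1 e) //= -addSn leq_add //.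
  have -> : w Q e = 0.
    by rewrite /w; move: ab; case: (g (a e) \in Q); case: (g (b e) \in Q); rewrite ?andbF.
  rewrite lt0b !inE /X; move: ab; case: (boolP (g (a e) \in Q)) => aQ /= => bQ.
    by rewrite eqxx orbT andbT; apply: contraNneq bQ => <-.
  by rewrite eqxx bQ !orbT /= andbT; apply: contraNneq aQ => ->.
apply: leq_sum => f _; rewrite /w !inE.
by case: (g (a f) \in Q); case: (g (b f) \in Q); rewrite ?andbF ?orbT.
Qed.

Lemma disj_sum (n : nat) (T : 'I_n -> {set E}) (J : {set 'I_n}) (S : {set E}) (w : E -> nat) :
  (forall i j, i != j -> [disjoint T i & T j]) -> (forall i, i \in J -> T i \subset S) ->
  \sum_(i in J) \sum_(e in T i) w e <= \sum_(e in S) w e.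
Proof.
move=> dT sT; rewrite (exchange_big_dep (mem S)) /=; last by move=> i e /sT /subsetP H /H.
apply: leq_sum => e _; have [i iJ|no] := pickP (fun i => (i \in J) && (e \in T i)).
  rewrite (bigD1 i) //= big1 ?addn0 // => j /andP[/andP[_ ej] ji].
  by case/andP: iJ => _ ei; rewrite (disjointFr (dT _ _ ji) ej) in ei.
by rewrite big_pred0.
Qed.

Lemma econn_union n (T : 'I_n -> {set E}) (J : {set 'I_n}) (S : {set E}) :
  (forall i j, i != j -> [disjoint T i & T j]) -> (forall i, i \in J -> T i \subset S) ->
  (forall i, econn 1 (T i)) -> econn #|J| S.
Proof.
move=> dT sT cT A A0 AT; apply: leq_trans (disj_sum (fun e => (a e \in A) (+) (b e \in A)) dT sT).
by rewrite -sum1_card; apply: leq_sum => i _; apply: cT.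
Qed.

Definition cross_edges X : {set E} := [set e | (a e \in X) (+) (b e \in X)].

(** Moving the vertices of [A] to the other side exchanges the boundary edges of [A] inside the cut
    with those outside it; maximality means that at least half are inside. *)
Lemma max_cut S : exists X, forall A, boundary S A <= 2 * boundary (S :&: cross_edges X) A.
Proof.
pose val X := \sum_(e in S) ((a e \in X) (+) (b e \in X)).
case: (@arg_maxnP _ (set0 : {set V}) xpredT val isT) => X _ Xmax.
exists X => A.
pose X' := [set v | (v \in X) (+) (v \in A)].
have : val X' + 2 * boundary (S :&: cross_edges X) A = val X + boundary S A.
  rewrite /boundary /val big_distrr /= [X in _ + X = _](_ : _ =
    \sum_(e in S) 2 * (((a e \in X) (+) (b e \in X)) && ((a e \in A) (+) (b e \in A)))).
    rewrite -!big_split; apply: eq_bigr => e _; rewrite /= !inE.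
    by case: (a e \in X); case: (b e \in X); case: (a e \in A); case: (b e \in A).
  rewrite [RHS](bigID (mem (cross_edges X))) /= [X in _ = _ + X]big1 ?addn0.
    by apply: eq_big => [e|e]; rewrite !inE // => /andP[_ ->].
  by move=> e /andP[_]; rewrite inE => /negbTE ->.
by have := Xmax X' isT; rewrite /val; clear; lia.
Qed.

Lemma sum_parts g S : \sum_(X in g @: setT) boundary S [set v | g v == X] = 2 * crosses g S.
Proof.
rewrite /boundary /crosses exchange_big /= big_distrr; apply: eq_bigr => e _ /=.
have [gab|gab] := eqVneq (g (a e)) (g (b e)).
  by rewrite muln0 big1 // => X _; rewrite !inE gab addbb.
rewrite (bigD1 (g (a e))) ?imset_f ?inE //= (bigD1 (g (b e))) /=; last first.
  by rewrite imset_f ?inE //= eq_sym.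
rewrite !inE !eqxx [g (b e) == _]eq_sym (negbTE gab) big1 // => X /andP[/andP[_ Xa] Xb].
by rewrite !inE ![_ == X]eq_sym (negbTE Xa) (negbTE Xb).
Qed.

(** Halving applies to every class of a partition, so the cut satisfies the partition condition for
    [c.+1], half the number of trees. Splitting off one arborescence leaves in-degree [c] for every
    set without [r]. *)
Lemma bip_trees n (T : 'I_n -> {set E}) (J : {set 'I_n}) (c : nat) (r : V) (S : {set E}) :
  (forall i j, i != j -> [disjoint T i & T j]) -> (forall i, i \in J -> T i \subset S) ->
  (forall i, econn 1 (T i)) -> #|J| = 2 * c.+1 ->
  exists (X : {set V}) (T0 F0 : {set E}), [/\ T0 \subset S :&: cross_edges X, F0 \subset S :&: cross_edges X,
    [disjoint T0 & F0], econn 1 T0 & econn c F0].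
Proof.
move=> dT sT cT cJ; have [X Xmax] := max_cut S.
have [|S0 [o [S0S rS0]]] := @orient_rooted c.+1 (S :&: cross_edges X) r.
  move=> g; have : \sum_(Y in g @: setT) boundary S [set v | g v == Y] <=
      \sum_(Y in g @: setT) 2 * boundary (S :&: cross_edges X) [set v | g v == Y].
    by apply: leq_sum => Y _; exact: Xmax.
  rewrite -big_distrr /= !sum_parts.
  have := disj_sum (fun e => g (a e) != g (b e)) dT sT.
  have : \sum_(i in J) #|g @: setT| <= \sum_(i in J) (crosses g (T i) + 1).
    by apply: leq_sum => i _; apply: crosses_tree.
  rewrite big_split /= !sum_nat_const cJ -/(crosses g S); clear; rewrite /crosses; nia.
have [T0 [T0S rT0 _ rF0]] := arborescence rS0.
exists X, T0, (S0 :\: T0); split.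
- exact: subset_trans T0S S0S.
- exact: subset_trans (subsetDl _ _) S0S.
- by rewrite -setI_eq0 setIC setDE -setIA [_ :&: T0]setIC setICr setI0.
- exact: rooted_econn rT0.
- exact: rooted_econn rF0.
Qed.

End TreePacking.

(** * Factors of the graph *)

Section Graphs.

Variable G : multigraph.
Local Notation V := (vertex G).
Local Notation E := (edge G).
Implicit Types (F S T K : {set E}) (A : {set V}) (u v w : V) (e : E).

Definition end1 e := (ends e).1.
Definition end2 e := (ends e).2.

Local Notation dl := (boundary end1 end2).
Local Notation econn := (econn end1 end2).

Definition incid e v : nat := (end1 e == v) + (end2 e == v).

Lemma degreeE F v : degree F v = \sum_(e in F) incid e v. Proof. by []. Qed.

Lemma degreeU S T v : [disjoint S & T] -> degree (S :|: T) v = degree S v + degree T v.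
Proof.
move=> dST; rewrite !degreeE (eq_bigl [predU S & T]); last by move=> e; rewrite !inE.
exact: bigU.
Qed.

Lemma sum_incid e A : \sum_(v in A) incid e v = (end1 e \in A) + (end2 e \in A).
Proof.
have one x : \sum_(v in A) (x == v : nat) = (x \in A).
  have [xA|xA] := boolP (x \in A).
    rewrite (bigD1 x) //= eqxx big1 // => v /andP[_ vx].
    by rewrite eq_sym (negbTE vx).
  by rewrite big1 // => v vA; case: eqP => // xv; move: xA; rewrite xv vA.
by rewrite big_split /= !one.
Qed.

Lemma sum_degree F A : \sum_(v in A) degree F v = dl F A + 2 * internal end1 end2 F A.
Proof.
rewrite /degree exchange_big /= big_distrr /= -big_split; apply: eq_bigr => e _ /=.
by rewrite (sum_incid e); case: (_ \in A); case: (_ \in A).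
Qed.

Lemma sum_degreeT F : \sum_v degree F v = 2 * #|F|.
Proof.
rewrite /degree exchange_big /= -sum1_card big_distrr; apply: eq_bigr => e _ /=.
transitivity (\sum_(v in [set: V]) incid e v); last by rewrite sum_incid !inE.
by apply: eq_bigl => v; rewrite inE.
Qed.

Lemma connected_econn T : connected T -> econn 1 T.
Proof.
move=> cT A A0 AT; rewrite lt0n; apply/negP=> /eqP d0.
have clA : closed (adjacent T) A.
  move=> u v /existsP [e /andP[eT uv]].
  have : (end1 e \in A) (+) (end2 e \in A) = 0 :> nat.
    by move: d0 => /eqP; rewrite sum_nat_eq0 => /forallP /(_ e); rewrite eT => /eqP.
  rewrite /end1 /end2; case/orP: uv => /eqP -> /=; by case: (u \in A); case: (v \in A).
have [u uA] := set0Pn _ A0.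
have /subsetPn [v _ vA] : ~~ (setT \subset A) by rewrite subTset.
by have := closed_connect clA (cT u v); rewrite uA (negbTE vA).
Qed.

Lemma adjacentC T u v : adjacent T u v = adjacent T v u.
Proof. by apply: eq_existsb => e; rewrite orbC. Qed.

Lemma adjacent_end T e : e \in T -> adjacent T (end1 e) (end2 e).
Proof.
move=> eT; apply/existsP; exists e; rewrite eT /end1 /end2.
by case: (ends e) => x y /=; rewrite eqxx.
Qed.

Lemma econn_connected T : econn 1 T -> connected T.
Proof.
move=> cT u v; pose A := [set w | connect (adjacent T) u w].
suff /eqP AT : A == setT by have := in_setT v; rewrite -AT inE.
apply/negPn/negP=> AT; have A0 : A != set0.
  by apply/set0Pn; exists u; rewrite inE connect0.
have := cT A A0 AT; rewrite lt0n sum_nat_eq0 negb_forall => /existsP [e].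
rewrite negb_imply eqb0 negbK !inE => /andP[eT].
have a1 := connect1 (adjacent_end eT).
have a2 : connect (adjacent T) (end2 e) (end1 e).
  by apply: connect1; rewrite adjacentC adjacent_end.
have [c1|c1] := boolP (connect (adjacent T) u (end1 e)).
  by rewrite (connect_trans c1 a1).
by rewrite addFb => c2; rewrite (connect_trans c2 a2) in c1.
Qed.

Lemma path_noncrossing (A : {set V}) (d0 : dart G) (c : seq (dart G)) (d : dart G) :
  path (fun d d' => dart_head d == dart_tail d') d (rcons c d0) ->
  all (fun d => (dart_head d \in A) == (dart_tail d \in A)) c ->
  (dart_head d \in A) = (dart_tail d0 \in A).
Proof.
elim: c d => [|x c IH] d /=; first by rewrite andbT => /eqP ->.
by case/andP=> /eqP -> /IH {}IH /andP[/eqP <- /IH].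
Qed.

(** Take a connected subset of minimum size. If an edge lies on a cycle and no other edge crosses a
    given cut, walking around the cycle puts the ends of that edge on the same side, so it does not
    cross either and could be deleted. *)
Lemma spanning_subtree F : connected F -> exists2 T : {set E}, T \subset F & spanning_tree T.
Proof.
move=> cF.
pose good (S : {set E}) := (S \subset F) && [forall u, forall v, connect (adjacent S) u v].
have F0 : good F by rewrite /good subxx; apply/forallP=> u; apply/forallP=> v.
case: (arg_minnP (fun S : {set E} => #|S|) F0) => T /andP[TF cT] Tmin.
have {}cT : connected T by move=> u v; exact: (forallP (forallP cT u) v).
exists T => //; split=> // c [c0 cTs cyc _ uc]; case: c => // d c in c0 cTs cyc uc *.
move: cTs uc => /= /andP[dT cTs] /andP[dc _].
suff /Tmin : good (T :\ d.1).
  by rewrite [X in X <= _](cardsD1 d.1) dT add1n ltnn.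
rewrite /good (subset_trans (subD1set _ _) TF) /=.
apply/forallP=> u; apply/forallP=> v; apply: econn_connected => {u v} A A0 AT.
rewrite lt0n; apply/negP=> /eqP d0.
have nc e : e \in T -> e != d.1 -> (end1 e \in A) = (end2 e \in A).
  move=> eT ed; move: d0 => /eqP; rewrite sum_nat_eq0 => /forallP /(_ e).
  by rewrite !inE ed eT /= eqb0; case: (_ \in A); case: (_ \in A).
have hd_tl : (dart_head d \in A) = (dart_tail d \in A).
  apply: (path_noncrossing cyc); apply/allP=> x xc.
  have xT := allP cTs x xc.
  have xd : x.1 != d.1.
    by apply: contraNneq dc => <-; apply: map_f.
  have := nc _ xT xd; rewrite /dart_head /dart_tail /end1 /end2.
  by case: x.2 => ->.
have := connected_econn cT A0 AT; rewrite /boundary (bigD1 d.1) //=.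
have -> : (end1 d.1 \in A) = (end2 d.1 \in A).
  by move: hd_tl; rewrite /dart_head /dart_tail /end1 /end2; case: d.2.
have E1 : \sum_(e in T | e != d.1) ((end1 e \in A) (+) (end2 e \in A)) = dl (T :\ d.1) A.
  by rewrite /boundary; apply: eq_bigl => e; rewrite !inE andbC.
by rewrite addbb add0n E1 d0.
Qed.

Definition symdiff S T := (S :\: T) :|: (T :\: S).

Lemma odd_degree_symdiff S T v :
  odd (degree (symdiff S T) v) = odd (degree S v) (+) odd (degree T v).
Proof.
have : degree (symdiff S T) v + 2 * degree (S :&: T) v = degree S v + degree T v.
  rewrite !degreeE big_distrr /= ![\sum_(e in _) _]big_mkcond /= -!big_split.
  apply: eq_bigr => e _; rewrite /= !inE.
  by case: (e \in S); case: (e \in T); rewrite /= ?addn0 //; lia.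
by move/(congr1 odd); rewrite mul2n oddD odd_double addbF oddD.
Qed.

Lemma path_join T u v : connect (adjacent T) u v ->
  exists2 K : {set E}, K \subset T & forall w, odd (degree K w) = (w == u) (+) (w == v).
Proof.
case/connectP=> p; elim: p u => [|x p IH] u /=.
  by move=> _ ->; exists set0; rewrite ?sub0set // => w; rewrite /degree big_set0 addbb.
case/andP=> /existsP [e /andP[eT ux]] /IH {}IH /IH [K KT Kodd].
exists (symdiff K [set e]).
  apply/subsetP=> f; rewrite !inE => /orP[/andP[_ /(subsetP KT)] //|/andP[_ /eqP -> //]].
move=> w; rewrite odd_degree_symdiff Kodd /degree big_set1 oddD !oddb.
case/orP: ux => /eqP -> /=; rewrite ![_ == w]eq_sym;
  by case: (w == u); case: (w == x); case: (w == v).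
Qed.

(** The vertices of [O] are paired off and joined by paths; symmetric difference makes overlaps
    harmless for parities. *)
Lemma parity_join T (O : {set V}) : connected T -> ~~ odd #|O| ->
  exists2 K : {set E}, K \subset T & forall v, odd (degree K v) = (v \in O).
Proof.
move=> cT; have [n] := ubnP #|O|; elim: n => // n IHn in O *; rewrite ltnS => leO evO.
have [->|[u uO]] := set_0Vmem O.
  by exists set0; rewrite ?sub0set // => w; rewrite /degree big_set0 inE.
have [O1|[v vO]] := set_0Vmem (O :\ u).
  by move: evO; rewrite (cardsD1 u) uO O1 cards0.
have cO : #|O| = (#|O :\ u :\ v|).+2 by rewrite (cardsD1 u) uO (cardsD1 v) vO.
have [||K KT Kodd] := IHn (O :\ u :\ v).
- by move: leO; rewrite cO => /ltnW.
- by move: evO; rewrite cO /= negbK.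
have [L LT Lodd] := path_join (cT u v).
exists (symdiff K L).
  apply/subsetP=> e; rewrite !inE => /orP[] /andP[_]; exact: subsetP.
move=> w; rewrite odd_degree_symdiff Kodd Lodd; move: vO; rewrite !inE => /andP[vu vO].
have [->|wv] := eqVneq w v; first by rewrite vO (negbTE vu).
by have [->|wu] := eqVneq w u; rewrite ?uO //= addbF.
Qed.

Lemma even_split P m (r : V) : 0 < m -> 1 < #|V| ->
  (forall v, ~~ odd (degree P v)) -> econn (2 * m - 1) P ->
  exists (Q : {set E}) (T : nat -> {set E}), [/\ Q \subset P,
    forall i, i < m -> T i \subset Q /\ econn 1 (T i),
    forall i j, i < m -> j < m -> i != j -> [disjoint T i & T j] &
    forall v, degree P v <= 2 * degree Q v <= degree P v + 2 * m].
Proof.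
move=> m_gt0 V2 evP cP.
have half v : 2 * (degree P v)./2 = degree P v by rewrite mul2n even_halfK.
(* Capping in-degrees by half the degrees gives an Eulerian orientation, as both totals equal the
   number of edges. *)
have [|o oP] := @orientation_exists V E end1 end2 P (fun v => (degree P v)./2).
  move=> U; rewrite -(@leq_pmul2l 2) // [X in _ <= X]big_distrr /=.
  under [X in _ <= X]eq_bigr do rewrite half.
  by rewrite sum_degree leq_addl.
set hd := hd_of end1 end2 o in oP; set tl := tl_of end1 end2 o.
have io F v : #|[set e in F | hd e == v]| + #|[set e in F | tl e == v]| = degree F v.
  rewrite -!sum1dep_card !big_mkcondr /= -big_split; apply: eq_bigr => e _.
  by rewrite /hd /tl /hd_of /tl_of /end1 /end2; case: (o e); case: (_ == v); case: (_ == v).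
have sum_in F A : \sum_(v in A) #|[set e in F | hd e == v]| = \sum_(e in F) (hd e \in A).
  under eq_bigr do rewrite -sum1dep_card big_mkcondr /=.
  rewrite exchange_big /=; apply: eq_bigr => e _.
  have [hA|hA] := boolP (hd e \in A).
    rewrite (bigD1 (hd e)) //= eqxx big1 // => v /andP[_ vn].
    by rewrite eq_sym (negbTE vn).
  rewrite big1 // => v vA; case: eqP => // hv; by move: hA; rewrite hv vA.
have oE v : #|[set e in P | hd e == v]| = (degree P v)./2.
  apply/eqP; rewrite eqn_leq oP leqNgt; apply/negP=> lt.
  have tot : \sum_v #|[set e in P | hd e == v]| = #|P|.
    rewrite -sum1_card; have := sum_in P setT.
    rewrite [RHS](eq_bigr (fun=> 1)) => [<-|e _]; last by rewrite inE.
    by apply: eq_bigl => x; rewrite inE.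
  have tot2 : \sum_v (degree P v)./2 = #|P|.
    apply/eqP; rewrite -(@eqn_pmul2l 2) // -sum_degreeT big_distrr /=; apply/eqP.
    by apply: eq_bigr => x _; rewrite half.
  suff : \sum_v #|[set e in P | hd e == v]| < \sum_v (degree P v)./2.
    by rewrite tot tot2 ltnn.
  rewrite (bigD1 v) // [X in _ < X](bigD1 v) //= -addSn leq_add //.
  exact: leq_sum.
(* Exactly half of each boundary enters the set, so boundary [2m - 1] already forces in-degree
   [m]. *)
have rP : rooted tl hd r m P.
  move=> A rA A0; have AT : A != setT by apply: contraNneq rA => ->; rewrite inE.
  have := cP A A0 AT.
  have E1 : \sum_(e in P) (hd e \in A) = din tl hd P A + internal end1 end2 P A.
    rewrite /din /internal -big_split; apply: eq_bigr => e _ /=; rewrite /hd /tl /hd_of /tl_of.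
    by case: (o e); case: (end1 e \in A); case: (end2 e \in A).
  have : 2 * (\sum_(v in A) (degree P v)./2) = dl P A + 2 * internal end1 end2 P A.
    by rewrite -sum_degree big_distrr; apply: eq_bigr => v _ /=; rewrite half.
  under eq_bigr do rewrite -oE.
  by rewrite sum_in E1; clear; lia.
have [T [T1 T2 T3]] := arborescences rP.
pose M := \bigcup_(i < m) T i.
have MP : M \subset P by apply/bigcupsP=> i _; have [] := T1 i (ltn_ord i).
have TM i : i < m -> T i \subset M by move=> im; apply: (bigcup_sup (Ordinal im)).
have insM v : #|[set e in M | hd e == v]| <= m.
  apply: (@leq_trans (\sum_(i < m) #|[set e in T i | hd e == v]|)).
    apply: (@leq_trans #|\bigcup_(i < m) [set e in T i | hd e == v]|).
      apply: subset_leq_card; apply/subsetP=> e; rewrite inE => /andP[/bigcupP[i _ ei] he].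
      by apply/bigcupP; exists i; rewrite // inE ei.
    elim/big_rec2: _ => [|i n B _ le]; first by rewrite cards0.
    by apply: leq_trans (leq_card_setU _ _) _; rewrite leq_add2l.
  rewrite -[X in _ <= X]card_ord -sum1_card; apply: leq_sum => i _.
  by rewrite T3 //; case: (v != r).
have balP v : #|[set e in P | hd e == v]| = #|[set e in P | tl e == v]|.
  by have := io P v; have := half v; rewrite oE; clear; lia.
have [||Q [MQ QP degQ]] := @balanced_superset V E tl hd P M r balP MP.
- move=> v vr; have := T3 0 v m_gt0; rewrite vr => c1.
  have /card_gt0P[e] : 0 < #|[set e in T 0 | hd e == v]| by rewrite c1.
  by rewrite inE => /andP[eT /eqP he]; exists e => //; apply: (subsetP (TM 0 m_gt0)).
- have r1 : r \notin ~: [set r] by rewrite !inE eqxx.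
  have r2 : ~: [set r] != set0.
    by rewrite -card_gt0; have := cardsC [set r]; rewrite cards1; move: V2; clear; lia.
  have /din_gt0 [e eP /andP[te he]] : 0 < din tl hd P (~: [set r]).
    by apply: leq_trans m_gt0 (rP _ r1 r2).
  by exists e => //; move: te he; rewrite !inE negbK => -> ->.
exists Q, T; split=> //.
- by move=> i im; have [_ rT] := T1 i im; split;
    [exact: subset_trans (TM i im) MQ | exact: rooted_econn rT].
- move=> v; have := degQ v; rewrite io oE; have := half v; have := insM v.
  by clear; lia.
Qed.

End Graphs.

Lemma subset_of_card (T : finType) (A : {set T}) n : n <= #|A| ->
  exists2 B : {set T}, B \subset A & #|B| = n.
Proof.
case/card_geqP=> s [us sn sA]; exists [set x in s].
  by apply/subsetP=> x; rewrite inE; exact: sA.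
by rewrite cardsE -sn; apply/card_uniqP.
Qed.

(** * Distributing the given trees *)

Section Parts.

Variables (G : multigraph) (k m : nat).
Hypotheses (k_gt0 : 0 < k) (m_gt0 : 0 < m).
Local Notation V := (vertex G).
Local Notation E := (edge G).
Local Notation econn := (econn (@end1 G) (@end2 G)).
Local Notation cross := (cross_edges (@end1 G) (@end2 G)).

Variable T : 'I_(2 * m + 6 * k - 5) -> {set E}.
Hypothesis dT : forall i j, i != j -> [disjoint T i & T j].
Hypothesis cT : forall i, econn 1 (T i).

Lemma hit_count (J : {set 'I_(2 * m + 6 * k - 5)}) (D : {set E}) :
  (forall i, i \in J -> ~~ [disjoint T i & D]) -> #|J| <= #|D|.
Proof.
move=> hit; have := @disj_sum _ _ T J setT (fun e => e \in D) dT (fun i _ => subsetT _).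
have -> : \sum_(e in [set: E]) (e \in D) = #|D|.
  by rewrite -sum1_card [RHS]big_mkcond /=; apply: eq_big => e; rewrite ?inE //; case: (e \in D).
apply: leq_trans; rewrite -sum1_card; apply: leq_sum => i /hit /pred0Pn [e /andP[/= eT eD]].
by rewrite (bigD1 e) //= eD.
Qed.

(** [R] should avoid the [2m - 1] trees that keep the remainder connected. If fewer than [k - 1]
    non-crossing edges lie outside these trees, all but at most [k - 2] of the other trees lie
    wholly in the cut. Such trees can then serve directly as [T0] and [F0], and enough of the given
    trees are left over to survive any choice of [R]. *)
Lemma choose_parts (r : V) : exists (X : {set V}) (R T0 F0 : {set E}),
  [/\ R \subset ~: cross X /\ (#|R| <= k - 1 /\ (#|R| = k - 1 \/ R = ~: cross X)),
      T0 \subset cross X /\ F0 \subset cross X,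
      [disjoint T0 & F0], econn 1 T0 /\ econn (3 * k - 3) F0 &
      econn (2 * m - 1) (~: (T0 :|: F0 :|: R))].
Proof.
pose J2 := [set i : 'I_(2 * m + 6 * k - 5) | 2 * m - 1 <= i].
have cJ2' : #|~: J2| = 2 * m - 1.
  have le : 2 * m - 1 <= 2 * m + 6 * k - 5 by move: k_gt0 m_gt0; clear; lia.
  have winj : injective (widen_ord le) by move=> i j /(congr1 val) /= /val_inj.
  rewrite -[RHS]card_ord -(card_imset _ winj); apply: eq_card => i.
  rewrite !inE -ltnNge; apply/idP/imsetP => [lt|[j _ ->]]; last by rewrite /= ltn_ord.
  by exists (Ordinal lt) => //; apply: val_inj.
have cJ2 : #|J2| = 2 * (3 * k - 3).+1.
  have := cardsC J2; rewrite cJ2' card_ord; move: k_gt0 m_gt0; clear; lia.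
pose S := \bigcup_(i in J2) T i.
have TS i : i \in J2 -> T i \subset S by move=> iJ; apply: (bigcup_sup i).
have [X [T0 [F0 [T0S F0S dTF c0 cF]]]] := bip_trees r dT TS cT cJ2.
pose In1 := ~: cross X :\: \bigcup_(i in ~: J2) T i.
have [le|lt] := leqP (k - 1) #|In1|.
  have [R RIn cR] := subset_of_card le.
  have RX : R \subset ~: cross X by apply: subset_trans RIn (subsetDl _ _).
  exists X, R, T0, F0; split=> //.
  - by rewrite RX cR leqnn; split=> //; split=> //; left.
  - by split; [apply: subset_trans T0S _ | apply: subset_trans F0S _]; rewrite subsetIr.
  rewrite -cJ2'; apply: (econn_union dT) => // i iJ; apply/subsetP=> e eT.
  have eS : e \notin S.
    apply/bigcupP=> -[j jJ ej]; have ij : i != j.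
      by apply: contraTneq iJ => ->; rewrite inE negbK.
    by rewrite (disjointFr (dT ij) eT) in ej.
  rewrite !inE !negb_or; apply/andP; split; first (apply/andP; split).
  - by apply: contra eS => /(subsetP T0S); rewrite inE => /andP[].
  - by apply: contra eS => /(subsetP F0S); rewrite inE => /andP[].
  - apply/negP=> /(subsetP RIn); rewrite inE => /andP[/negP + _]; apply.
    by apply/bigcupP; exists i.
pose Pu := [set i | T i \subset cross X].
have impure : #|J2 :\: Pu| <= #|In1|.
  apply: hit_count => i; rewrite !inE => /andP[/subsetPn[e eT eX] iJ].
  apply/pred0Pn; exists e; rewrite /= eT /= 2!inE eX andbT.
  apply/bigcupP=> -[j]; rewrite !inE => jJ ej.
  have ij : i != j by apply: contraNneq jJ => <-.
  by rewrite (disjointFr (dT ij) eT) in ej.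
have [C CPu cC] : exists2 C : {set 'I_(2 * m + 6 * k - 5)}, C \subset Pu & #|C| = (3 * k - 3).+1.
  apply: subset_of_card; apply: (@leq_trans #|J2 :&: Pu|); last first.
    by apply: subset_leq_card; rewrite subsetIr.
  by have := cardsID Pu J2; rewrite cJ2; move: impure lt k_gt0; clear; lia.
have [i0 i0C] : exists i, i \in C by apply/card_gt0P; rewrite cC.
have [R RX cR] := @subset_of_card _ (~: cross X) (minn (k - 1) #|~: cross X|) (geq_minr _ _).
pose F1 := \bigcup_(i in C :\ i0) T i.
have puX i : i \in C -> T i \subset cross X by move/(subsetP CPu); rewrite inE.
exists X, R, (T i0), F1; split=> //.
- split=> //; split; first by rewrite cR geq_minl.
  have [le|gt] := leqP (k - 1) #|~: cross X|.
    by left; rewrite cR; apply/minn_idPl.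
  right; apply/eqP; rewrite eqEcard RX cR leq_min leqnn andbT; exact: ltnW.
- by split; [exact: puX | apply/bigcupsP=> i /setD1P[_]; exact: puX].
- by apply/bigcup_disjointP=> i /setD1P[ii0 _]; apply: dT; rewrite eq_sym.
- split=> //; have -> : 3 * k - 3 = #|C :\ i0|.
    by move: cC; rewrite (cardsD1 i0) i0C add1n => -[->].
  by apply: (econn_union dT) => // i iC; apply: (bigcup_sup i).
pose Hit := [set i | ~~ [disjoint T i & R]].
have cHit : #|Hit| <= #|R| by apply: hit_count => i; rewrite inE.
pose J := ~: (C :|: Hit).
(* [3k - 2] trees are used up and at most [k - 1] are hit by [R], which leaves [2m + 2k - 2]. *)
have cJ : 2 * m - 1 <= #|J|.
  have h2 : #|C :|: Hit| + #|J| = 2 * m + 6 * k - 5 by rewrite cardsC card_ord.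
  have h1 : #|C :|: Hit| <= (3 * k - 3).+1 + (k - 1).
    apply: leq_trans (leq_card_setU _ _) _; rewrite cC leq_add2l.
    by apply: leq_trans cHit _; rewrite cR geq_minl.
  move: h1 h2 k_gt0 m_gt0; move: #|C :|: Hit| #|J| => c1 j1; clear; lia.
move=> A A0 AT; apply: leq_trans cJ _; move: A A0 AT.
apply: (econn_union dT) => // i; rewrite !inE negb_or negbK => /andP[iC iR].
apply/subsetP=> e eT; rewrite !inE !negb_or; apply/andP; split; first (apply/andP; split).
- have ii0 : i != i0 by apply: contraNneq iC => ->.
  by rewrite (disjointFr (dT ii0) eT).
- apply/bigcupP=> -[j /setD1P[_ jC] ej]; have ij : i != j by apply: contraNneq iC => ->.
  by rewrite (disjointFr (dT ij) eT) in ej.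
- by rewrite (disjointFr iR eT).
Qed.

End Parts.

Lemma odd_card_odd (T : finType) (h : T -> nat) :
  odd #|[set v | odd (h v)]| = odd (\sum_v h v).
Proof.
rewrite -sum1dep_card big_mkcond /=.
apply: (big_ind2 (fun a b => odd a = odd b)) => // [a b c d|v _].
  by rewrite !oddD => -> ->.
by case: (odd (h v)).
Qed.

Lemma acyclic0 (G : multigraph) : acyclic (set0 : {set edge G}).
Proof. by move=> [|d c] [] //= _; rewrite inE. Qed.

(** With one vertex the empty set is a spanning tree and all edges are loops, so only the number of
    chosen edges matters. *)
Lemma few_vertices (G : multigraph) (k m : nat) (f : vertex G -> 'I_k) :
  0 < k -> 0 < m -> compatible f [set: edge G] -> #|vertex G| <= 1 ->
  exists H : {set edge G},
    [/\ tree_connected m H,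
        forall v : vertex G, degree H v = f v %[mod k] &
        forall v : vertex G,
          (degree [set: edge G] v)./2 - (k - 1) <= degree H v
            <= uphalf (degree [set: edge G] v) + (k - 1) + m].
Proof.
move=> k_gt0 m_gt0 hf V1.
have eqV (u v : vertex G) : u = v by apply: (card_le1_eqP V1).
have tree0 (H : {set edge G}) : tree_connected m H.
  exists (fun=> set0); split=> [i|i j _]; last by rewrite -setI_eq0 set0I.
  split; first exact: sub0set; split; last exact: acyclic0.
  by move=> u v; rewrite (eqV u v) connect0.
have deg (F : {set edge G}) v : degree F v = 2 * #|F|.
  rewrite degreeE -sum1_card big_distrr; apply: eq_bigr => e _ /=.
  by rewrite /incid (eqV (end1 e) v) (eqV (end2 e) v) eqxx.
have [V0|/card_gt0P[v _]] := posnP #|vertex G|.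
  exists set0; split=> // v; exfalso.
    by have := card0_eq V0 v; rewrite inE.
  by have := card0_eq V0 v; rewrite inE.
have [x xE fx] : exists2 x, x <= #|edge G| & exists j : int, (Posz (f v) - 2 * Posz x = j * Posz k)%R.
  have vT : (\sum_(w in [set: vertex G]) Posz (f w))%R = Posz (f v).
    by rewrite (big_pred1 v) // => w; rewrite inE (eqV w v) /= eqxx.
  have T0 : [set: vertex G] :|: set0 = [set: vertex G] by rewrite setU0.
  have d0 : [disjoint [set: vertex G] & (set0 : {set vertex G})] by rewrite -setI_eq0 setI0.
  have [[x xle]|[y yle]] := hf _ _ T0 d0.
    rewrite vT big_set0 => /eqP; rewrite eqz_mod_dvd subr0 => /dvdzP [j Ej].
    exists x; last by exists j; rewrite Ej.
    by apply: leq_trans xle _; rewrite -cardsT subset_leq_card // subsetT.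
  rewrite vT big_set0 => /eqP; rewrite eqz_mod_dvd => /dvdzP [j Ej].
  have y0 : y = 0.
    apply/eqP; rewrite -leqn0; apply: leq_trans yle _; rewrite leqn0 cards_eq0.
    by apply/eqP/setP=> e; rewrite !inE.
  by exists 0 => //; exists j; rewrite -Ej y0; clear; lia.
have [h [hE [l hx] lo hi]] : exists h, [/\ h <= #|edge G|,
    exists l : int, (Posz h = Posz x + l * Posz k)%R,
    #|edge G| <= 2 * h + (k - 1) & 2 * h <= #|edge G| + (k - 1) + m].
  have [lt|ge] := ltnP #|edge G| k.
    exists x; split=> //; first by exists 0%R; clear; lia.
      by move: lt; clear; lia.
    by move: xE lt; clear; lia.
  (* The [k] consecutive numbers from [low] on meet every residue. The double of the last may exceed
     [#|edge G| + (k - 1)] by one, which [m] absorbs. *)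
  pose low := uphalf (#|edge G| - k + 1).
  pose s := ((Posz x - Posz low) %% Posz k)%Z.
  have s0 : (0 <= s)%R by apply: modz_ge0; move: k_gt0; clear; lia.
  have sk : (s < Posz k)%R by apply: ltz_pmod; move: k_gt0; clear; lia.
  have sE : (Posz x - Posz low = ((Posz x - Posz low) %/ Posz k)%Z * Posz k + s)%R.
    exact: divz_eq.
  have lowE : #|edge G| - k + 1 <= 2 * low <= #|edge G| - k + 2.
    by rewrite /low; clear; lia.
  exists (low + absz s); split.
  - by move: s0 sk lowE ge; clear; lia.
  - exists (- ((Posz x - Posz low) %/ Posz k)%Z)%R.
    by move: sE s0; set d := (_ %/ _)%Z; clear; lia.
  - by move: s0 lowE ge; clear; lia.
  - by move: s0 sk lowE ge m_gt0; clear; lia.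
have [|H _ cH] := @subset_of_card _ [set: edge G] h; first by rewrite cardsT.
exists H; split=> // w; rewrite !deg cH ?cardsT.
  have -> : w = v by exact: eqV.
  have : (Posz (2 * h) == Posz (f v) %[mod Posz k])%Z.
    rewrite eqz_mod_dvd; apply/dvdzP; case: fx => j Ej; exists (2 * l - j)%R.
    by move: hx Ej; clear; lia.
  by rewrite !modz_nat => /eqP [].
by rewrite mul2n uphalf_double doubleK; move: lo hi; clear; lia.
Qed.

(** * Orientations as factors, and signed degree sums *)

Section Assembly.

Variables (G : multigraph) (X : {set vertex G}).
Local Notation V := (vertex G).
Local Notation E := (edge G).
Local Notation cross := (cross_edges (@end1 G) (@end2 G)).
Local Notation dl := (boundary (@end1 G) (@end2 G)).
Implicit Types (S F : {set E}) (v x y : V) (e : E).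

Definition mult F x y := \sum_(e in F) edge1 (end1 e) (end2 e) x y.

Lemma cut_mult F A : cut (mult F) setT A = dl F A.
Proof.
rewrite /cut /mult /boundary.
under eq_bigr do rewrite exchange_big /=.
rewrite exchange_big /=; apply: eq_bigr => e _.
by rewrite -(cut_edge1 A (in_setT (end1 e)) (in_setT (end2 e))).
Qed.

Lemma bip_factor F (f : V -> V -> nat) : F \subset cross X ->
  (forall x y, f x y + f y x = mult F x y) ->
  exists2 H : {set E}, H \subset F &
    forall v, degree H v = if v \in X then \sum_y f v y else \sum_y f y v.
Proof.
move=> FX fE.
pose xe e := if end1 e \in X then end1 e else end2 e.
pose ye e := if end1 e \in X then end2 e else end1 e.
have side e : e \in F -> (xe e \in X) && (ye e \notin X).
  move/(subsetP FX); rewrite inE /xe /ye; case: (boolP (end1 e \in X)) => aX /=.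
    by rewrite aX.
  by move=> ->; rewrite aX.
have edgeE e x y : e \in F -> x \in X -> y \notin X ->
    edge1 (end1 e) (end2 e) x y = (xe e == x) && (ye e == y).
  move/side; rewrite /edge1 /xe /ye => + xX yX; case: (boolP (end1 e \in X)) => aX.
    case/andP=> _ bX; rewrite [x == end2 e](negbTE _) ?addn0.
      by rewrite eq_sym [y == _]eq_sym.
    by apply: contraNneq bX => <-.
  case/andP=> bX _; rewrite [x == end1 e](negbTE _) ?add0n.
    by rewrite eq_sym [y == _]eq_sym.
  by apply: contraNneq aX => <-.
have same x y : (x \in X) = (y \in X) -> f x y = 0.
  move=> xy; have : f x y + f y x = 0.
    rewrite fE /mult big1 // => e /(subsetP FX); rewrite inE /edge1 => cr.
    have -> : (x == end1 e) && (y == end2 e) = false.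
      by apply/negP=> /andP[/eqP x1 /eqP y2]; move: cr; rewrite -x1 -y2 xy addbb.
    have -> // : (x == end2 e) && (y == end1 e) = false.
    by apply/negP=> /andP[/eqP x1 /eqP y2]; move: cr; rewrite -x1 -y2 xy addbb.
  by clear; lia.
have multE x y : x \in X -> y \notin X -> mult F x y = #|[set e in F | (xe e == x) && (ye e == y)]|.
  move=> xX yX; rewrite -sum1dep_card big_mkcondr; apply: eq_bigr => e eF.
  by rewrite edgeE //; case: (_ && _).
(* An orientation only counts how many parallel edges go each way; which of them are chosen is
   arbitrary. *)
have : forall z : V * V, exists S : {set E},
    S \subset [set e in F | (xe e == z.1) && (ye e == z.2)] /\
    (z.1 \in X -> z.2 \notin X -> #|S| = f z.1 z.2).
  move=> [x y] /=; have [/andP[xX yX]|no] := boolP ((x \in X) && (y \notin X)).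
    have [|S S1 S2] := @subset_of_card _ [set e in F | (xe e == x) && (ye e == y)] (f x y).
      by rewrite -multE // -fE leq_addr.
    by exists S.
  by exists set0; rewrite sub0set; split=> // xX yX; rewrite xX yX in no.
case/fin_all_exists=> S SP.
pose H := [set e in F | e \in S (xe e, ye e)].
have cnt x y : x \in X -> y \notin X ->
    \sum_(e in H) ((xe e == x) && (ye e == y)) = f x y.
  move=> xX yX; have [SF <- //] := SP (x, y).
  rewrite -big_mkcondr sum1dep_card; apply: eq_card => e; rewrite !inE.
  apply/idP/idP => [/andP[/andP[_ eS] /andP[/eqP <- /eqP <-]] //|eS].
  have := subsetP SF _ eS; rewrite inE => /andP[-> /andP[/eqP -> /eqP ->]].
  by rewrite eS !eqxx.
have HF : H \subset F by apply/subsetP=> e; rewrite inE => /andP[].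
exists H => // v; rewrite degreeE.
have -> : \sum_(e in H) incid e v = \sum_(e in H) ((xe e == v) + (ye e == v)).
  by apply: eq_bigr => e _; rewrite /incid /xe /ye; case: ifP => // _; rewrite addnC.
have split1 (P : pred V) (z : E -> V) (b : E -> bool) : (forall e, e \in H -> P (z e)) ->
    \sum_(e in H) b e = \sum_(y | P y) \sum_(e in H) (b e && (z e == y)).
  move=> zP; rewrite exchange_big /=; apply: eq_bigr => e eH.
  rewrite (bigD1 (z e)) ?zP //= eqxx andbT big1 ?addn0 // => y /andP[_ yz].
  by rewrite eq_sym (negbTE yz) andbF.
case: ifP => vX.
  rewrite (eq_bigr (fun e => (xe e == v) : nat)) => [|e /(subsetP HF)/side /andP[_ yX]]; last first.
    rewrite [ye e == v](negbTE _) ?addn0 //.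
    by apply: contraNneq yX => ->.
  rewrite (split1 (fun y => y \notin X) ye) => [|e /(subsetP HF)/side /andP[] //].
  rewrite [RHS](bigID (fun y => y \in X)) /= [X in _ = X + _]big1 ?add0n => [|y yX]; last first.
    by apply: same; rewrite vX yX.
  by apply: eq_bigr => y yX; exact: cnt.
rewrite (eq_bigr (fun e => (ye e == v) : nat)) => [|e /(subsetP HF)/side /andP[xX _]]; last first.
  rewrite [xe e == v](negbTE _) ?add0n //.
  by apply: contraFneq vX => <-.
rewrite (split1 (fun y => y \in X) xe) => [|e /(subsetP HF)/side /andP[] //].
rewrite [RHS](bigID (fun y => y \in X)) /= [X in _ = _ + X]big1 ?addn0 => [|y yX]; last first.
  by apply: same; rewrite vX (negbTE yX).
apply: eq_bigr => y yX; rewrite -cnt ?vX //; apply: eq_bigr => e _; by rewrite andbC.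
Qed.

Lemma hsum S (c : E -> V -> int) :
  (\sum_v \sum_(e in S) Posz (incid e v) * c e v =
   \sum_(e in S) (c e (end1 e) + c e (end2 e)))%R.
Proof.
rewrite exchange_big /=; apply: eq_bigr => e _.
have one x : (\sum_v Posz (x == v) * c e v = c e x)%R.
  rewrite (bigD1 x) //= eqxx mul1r big1 ?addr0 // => v vx.
  by rewrite eq_sym (negbTE vx) mul0r.
under eq_bigr do rewrite /incid PoszD mulrDl.
by rewrite big_split /= !one.
Qed.

Lemma Posz_sum (I : finType) (P : pred I) (h : I -> nat) :
  Posz (\sum_(i | P i) h i) = (\sum_(i | P i) Posz (h i))%R.
Proof. by apply: (big_morph Posz). Qed.

Definition sgn v (z : int) : int := if v \in X then z else (- z)%R.

Definition inX : {set E} := [set e | (end1 e \in X) && (end2 e \in X)].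
Definition inY : {set E} := [set e | (end1 e \notin X) && (end2 e \notin X)].

(** Half of the signed degree sum of [S]: an edge across the bipartition cancels, any other edge
    counts twice with the sign of its side. *)
Definition xq S : int := (Posz #|S :&: inX| - Posz #|S :&: inY|)%R.

Lemma xqE S : xq S = (\sum_(e in S) (Posz (e \in inX) - Posz (e \in inY)))%R.
Proof.
have card (D : {set E}) : Posz #|S :&: D| = (\sum_(e in S) Posz (e \in D))%R.
  rewrite -Posz_sum; congr Posz; rewrite -sum1_card.
  rewrite (eq_bigl (fun e => (e \in S) && (e \in D))) => [|e]; last by rewrite inE.
  by rewrite big_mkcondr; apply: eq_bigr => e _; case: (e \in D).
by rewrite /xq !card -sumrB.
Qed.

Lemma sum_sgn_degree S : (\sum_v sgn v (Posz (degree S v)) = 2 * xq S)%R.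
Proof.
transitivity (\sum_v \sum_(e in S) Posz (incid e v) * sgn v 1)%R.
  apply: eq_bigr => v _; rewrite degreeE Posz_sum /sgn.
  by case: ifP => _; rewrite -?sumrN; apply: eq_bigr => e _; rewrite ?mulr1 ?mulrN1.
rewrite hsum xqE mulr_sumr; apply: eq_bigr => e _; rewrite /sgn !inE.
by case: (end1 e \in X); case: (end2 e \in X).
Qed.

(** Start from [R :&: inY]. Adding an edge inside [X] and removing one outside it both raise [xq] by
    one, and this is done for [s] edges. *)
Lemma sub_xq (R : {set E}) s : R \subset ~: cross X -> s <= #|R| ->
  exists2 I : {set E}, I \subset R & xq I = (Posz s - Posz #|R :&: inY|)%R.
Proof.
move=> RX sR; have [B BR cB] := subset_of_card sR.
exists ((B :&: inX) :|: ((R :&: inY) :\: B)).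
  apply/subsetP=> e; rewrite !inE => /orP[/andP[/(subsetP BR) //]|/andP[_ /andP[//]]].
rewrite /xq.
have -> : ((B :&: inX) :|: ((R :&: inY) :\: B)) :&: inX = B :&: inX.
  apply/setP=> e; rewrite !inE.
  by case: (e \in B); case: (end1 e \in X); case: (end2 e \in X); rewrite /= ?andbF ?andbT.
have -> : ((B :&: inX) :|: ((R :&: inY) :\: B)) :&: inY = (R :&: inY) :\: B.
  apply/setP=> e; rewrite !inE.
  by case: (e \in B); case: (end1 e \in X); case: (end2 e \in X); rewrite /= ?andbF ?andbT.
have c1 : #|B :&: inX| + #|B :&: inY| = s.
  rewrite -cB -(cardsID inX B); congr (_ + _); apply: eq_card => e; rewrite !inE.
  have [eB|] := boolP (e \in B); last by rewrite !andbF.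
  have := subsetP RX _ (subsetP BR _ eB); rewrite !inE andbT /=.
  by case: (end1 e \in X); case: (end2 e \in X).
have c2 : #|B :&: inY| + #|(R :&: inY) :\: B| = #|R :&: inY|.
  rewrite -(cardsID B (R :&: inY)); congr (_ + _); apply: eq_card => e; rewrite !inE.
  by have [/(subsetP BR) ->|] := boolP (e \in B); rewrite ?andbF ?andbT.
by move: c1 c2; clear; lia.
Qed.

End Assembly.

(** * Completing the factor on the bipartite part *)

Section Completion.

Variables (G : multigraph) (k : nat) (X : {set vertex G}) (F R I : {set edge G}).
Variable g : vertex G -> int.
Hypothesis k_gt0 : 0 < k.
Hypotheses (FX : F \subset cross_edges (@end1 G) (@end2 G) X).
Hypotheses (RX : R \subset ~: cross_edges (@end1 G) (@end2 G) X) (IR : I \subset R).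
Hypothesis cR : #|R| <= k - 1.
Hypothesis cF : econn (@end1 G) (@end2 G) (3 * k - 3) F.
Hypothesis balance : exists l : int, (\sum_v sgn X v (g v) = 2 * xq X I + l * Posz k)%R.

Local Notation dl := (boundary (@end1 G) (@end2 G)).

(* An edge of [R] has both ends on the same side, so its two halves are recorded as
   two arcs to the outside vertex; they leave [X] and enter the other side if the
   edge is chosen, and the other way round if it is not. *)
Let q v := \sum_(e in R) incid e v * ((e \in I) == (v \in X)).
Let p v := \sum_(e in R) incid e v * ((e \in I) != (v \in X)).
(** Chosen edges leave [X], so the net out-degree of a vertex in [X] is twice its chosen degree
    minus its whole degree; on the other side the sign is opposite. *)
Let t v : int := sgn X v (2 * g v - Posz (degree F v + degree R v))%R.
Let J := Inst setT (mult F) p q t set0.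

Lemma pq v : p v + q v = degree R v.
Proof.
rewrite -big_split degreeE; apply: eq_bigr => e _ /=.
by case: (_ == _); rewrite /= ?muln0 ?muln1 ?addn0.
Qed.

Lemma ar_J A : ar J A = \sum_(v in A) degree R v.
Proof. by apply: eq_bigr => v _; exact: pq. Qed.

Lemma dg_J A : dg J A = dl F A + \sum_(v in A) degree R v.
Proof. by rewrite /dg ar_J /= cut_mult. Qed.

Lemma odd_ts A : odd (absz (ts J A)) = odd (dg J A).
Proof.
transitivity (odd (\sum_(v in A) (degree F v + degree R v))).
  apply: (big_ind2 (fun (a : int) b => odd (absz a) = odd b)) => //.
    by clear; move=> a b a' b'; lia.
  by move=> v _; rewrite /= /t /sgn; case: ifP => _; clear; lia.
rewrite big_split /= dg_J sum_degree; clear; lia.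
Qed.

Lemma qp_sum : (\sum_v (Posz (q v) - Posz (p v)) = 4 * xq X I - 2 * xq X R)%R.
Proof.
transitivity (\sum_v \sum_(e in R) Posz (incid e v) *
    (if (e \in I) == (v \in X) then 1 else -1))%R.
  apply: eq_bigr => v _; rewrite /q /p !Posz_sum -sumrB; apply: eq_bigr => e _.
  by case: (_ == _) => /=; clear; lia.
rewrite hsum !xqE.
have -> : (\sum_(e in I) (Posz (e \in inX X) - Posz (e \in inY X)) =
    \sum_(e in R) (if e \in I then Posz (e \in inX X) - Posz (e \in inY X) else 0))%R.
  rewrite -big_mkcondr; apply: eq_bigl => e.
  by have [/(subsetP IR) ->|] := boolP (e \in I); rewrite ?andbF.
rewrite !mulr_sumr -sumrB; apply: eq_bigr => e eR.
have := subsetP RX _ eR; rewrite !inE.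
by case: (end1 e \in X); case: (end2 e \in X); case: (e \in I).
Qed.

Lemma valid_J : valid k J.
Proof.
split=> /=.
- by move=> x y; apply: eq_bigr => e _; rewrite edge1C.
- move=> x; rewrite /mult big1 // => e /(subsetP FX); rewrite inE => cr.
  by apply: edge1_irr; apply: contraTneq cr => ->; rewrite addbb.
- by left.
- by move=> v _; have := odd_ts [set v]; rewrite ts1.
- have [l bal] := balance.
  have tsE : ts J setT = (2 * (2 * xq X I + l * Posz k) - 2 * xq X F - 2 * xq X R)%R.
    rewrite -bal -!(sum_sgn_degree X) mulr_sumr -!sumrB /ts.
    rewrite (eq_bigl xpredT) => [|v]; last by rewrite inE.
    apply: eq_bigr => v _; rewrite /= /t /sgn PoszD; case: ifP => _; clear; lia.
  have xF : xq X F = 0%R.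
    rewrite xqE big1 // => e /(subsetP FX); rewrite !inE.
    by case: (end1 e \in X); case: (end2 e \in X).
  have sT (h : vertex G -> nat) : \sum_(v in [set: vertex G]) h v = \sum_v h v.
    by apply: eq_bigl => v; rewrite inE.
  have := qp_sum; rewrite sumrB -!Posz_sum !sT tsE xF => qpE; exists l.
  by move: qpE; clear; lia.
- rewrite ar_J (eq_bigl xpredT) => [|v]; last by rewrite inE.
  by rewrite sum_degreeT; move: cR k_gt0; clear; lia.
(* The connectivity [3k - 3] could fail only for norm [k], and then by one; norm and degree have the
   same parity, which excludes it. *)
move=> A _ A0 AT _; rewrite /bal; have := cF A0 AT; have := odd_ts A.
have := nrm_le k_gt0 (ts J A); have := odd_nrm k_gt0 (ts J A); rewrite dg_J.
by move: k_gt0; clear; lia.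
Qed.

Lemma completion : exists2 H : {set edge G}, H \subset F & forall v,
  (exists l : int, (Posz (degree H v + degree I v) = g v + l * Posz k)%R) /\
  degree F v + degree R v <= 2 * (degree H v + degree I v) + (2 * k - 1) /\
  2 * (degree H v + degree I v) <= degree F v + degree R v + (2 * k - 1).
Proof.
have [f fE fN] := mod_orient k_gt0 valid_J.
have fE' x y : f x y + f y x = mult F x y by apply: fE; rewrite inE.
have [H HF Hdeg] := bip_factor FX fE'.
exists H => // v; have [[l El]] := fN v (in_setT v).
have sT (h : vertex G -> nat) : \sum_(v in [set: vertex G]) h v = \sum_v h v.
  by apply: eq_bigl => w; rewrite inE.
have IE : degree I v = if v \in X then q v else p v.
  have -> : degree I v = \sum_(e in R) incid e v * (e \in I).
    rewrite degreeE [RHS](bigID (mem I)) /= [X in _ = _ + X]big1 ?addn0; last first.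
      by move=> e /andP[_ /negbTE ->]; rewrite muln0.
    apply: eq_big => [e|e eI]; last by rewrite eI muln1.
    by have [/(subsetP IR) ->|] := boolP (e \in I); rewrite ?andbF.
  rewrite /q /p; case: (v \in X); apply: eq_bigr => e _; congr (_ * _).
    by rewrite eqb_id.
  by rewrite eqbF_neg negbK.
have total : \sum_y f v y + \sum_y f y v = degree F v.
  have := dg1 valid_J (in_setT v); rewrite dg_J /= !big_set1 sT.
  rewrite -addnA pq => /addIn dE.
  have : dl F [set v] = degree F v.
    rewrite degreeE; apply: eq_bigr => e /(subsetP FX); rewrite !inE /incid => cr.
    case: (end1 e =P v) => [e1|]; case: (end2 e =P v) => [e2|] //=.
    by rewrite e1 e2 addbb in cr.
  rewrite dE => <-; rewrite -big_split; apply: eq_bigr => y _ /=; exact: fE'.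
move: El; rewrite /net /= !sT Hdeg IE -total -(pq v) /t /sgn.
case: ifP => _ El lt; split.
- by exists l; move: El; rewrite -total -(pq v); clear; lia.
- by move: lt; clear; lia.
- by exists (- l)%R; move: El; rewrite -total -(pq v); clear; lia.
- by move: lt; clear; lia.
Qed.

End Completion.

(** The two alternatives of compatibility merge into one signed number [x0], ranging over the values
    that [xq] takes on sets of edges. *)
Lemma compatible_sum (G : multigraph) (k : nat) (f : vertex G -> 'I_k) (X : {set vertex G}) :
  compatible f [set: edge G] -> exists x0 l : int,
    [/\ (\sum_v sgn X v (Posz (f v)) = 2 * x0 + l * Posz k)%R,
        (- Posz #|inY X| <= x0)%R & (x0 <= Posz #|inX X|)%R].
Proof.
move=> hf.
have sumE : (\sum_v sgn X v (Posz (f v)) =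
    \sum_(v in X) Posz (f v) - \sum_(v in ~: X) Posz (f v))%R.
  rewrite (bigID (mem X)) /= -sumrN; congr (_ + _)%R.
    by apply: eq_bigr => v vX; rewrite /sgn vX.
  by apply: eq_big => v; rewrite ?inE // /sgn => /negbTE ->.
have iX : edges_inside [set: edge G] X = #|inX X|.
  by apply: eq_card => e; rewrite !inE.
have iY : edges_inside [set: edge G] (~: X) = #|inY X|.
  by apply: eq_card => e; rewrite !inE.
have dX : [disjoint X & ~: X] by rewrite -setI_eq0 setICr.
have [[x xle]|[y yle]] := hf X (~: X) (setUCr X) dX.
  move/eqP; rewrite eqz_mod_dvd => /dvdzP [j Ej].
  exists (Posz x), j; rewrite sumE; rewrite iX in xle; split.
  - by move: Ej; clear; lia.
  - by clear; lia.
  - by move: xle; clear; lia.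
move/eqP; rewrite eqz_mod_dvd => /dvdzP [j Ej].
exists (- Posz y)%R, j; rewrite sumE; rewrite iY in yle; split.
- by move: Ej; clear; lia.
- by move: yle; clear; lia.
- by clear; lia.
Qed.

Theorem theorem1p4 (G : multigraph) (k m : nat) (hk : 0 < k) (hm : 0 < m)
    (f : vertex G -> 'I_k)
    (hf : compatible f [set: edge G])
    (hG : tree_connected (2 * m + 6 * k - 5) [set: edge G]) :
  exists H : {set edge G},
    [/\ tree_connected m H,
        forall v : vertex G, degree H v = f v %[mod k] &
        forall v : vertex G,
          (degree [set: edge G] v)./2 - (k - 1) <= degree H v
            <= uphalf (degree [set: edge G] v) + (k - 1) + m].
Proof.
have [V1|V2] := leqP #|vertex G| 1; first exact: few_vertices.
have [T [T1 dT]] := hG.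
have cT i : econn (@end1 G) (@end2 G) 1 (T i).
  by have [_ [cTi _]] := T1 i; exact: connected_econn.
have [r _] : exists r, r \in vertex G by apply/card_gt0P; exact: ltnW.
have [X [R [T0 [F0 [[RX [cR Rfull]] [T0X F0X] dTF [cT0 cF0] cP0]]]]] :=
  choose_parts hk hm dT cT r.
pose P0 := ~: (T0 :|: F0 :|: R).
have [|K KT0 Kodd] := @parity_join G T0 [set v | odd (degree P0 v)] (econn_connected cT0).
  by rewrite odd_card_odd sum_degreeT mul2n odd_double.
(* The tree edges that the join does not use lie in the cut, so they can go to the bipartite
   part. *)
pose P := P0 :|: K; pose F := F0 :|: (T0 :\: K).
have mem4 e : [/\ (e \in K) ==> (e \in T0), ~~ ((e \in T0) && (e \in F0)),
    ~~ ((e \in R) && (e \in T0)) & ~~ ((e \in R) && (e \in F0))].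
  split; first by apply/implyP; exact: (subsetP KT0).
  - by apply/negP=> /andP[eT eF]; rewrite (disjointFr dTF eT) in eF.
  - by apply/negP=> /andP[/(subsetP RX) + /(subsetP T0X)]; rewrite inE => /negbTE ->.
  - by apply/negP=> /andP[/(subsetP RX) + /(subsetP F0X)]; rewrite inE => /negbTE ->.
have dP0K : [disjoint P0 & K].
  rewrite -setI_eq0; apply/eqP/setP=> e; rewrite !inE; have [] := mem4 e.
  by case: (e \in K); case: (e \in T0); rewrite ?andbF.
have dPF : [disjoint P & F].
  rewrite -setI_eq0; apply/eqP/setP=> e; rewrite !inE; have [] := mem4 e.
  by case: (e \in K); case: (e \in T0); case: (e \in F0); case: (e \in R).
have dPFR : [disjoint P :|: F & R].
  rewrite -setI_eq0; apply/eqP/setP=> e; rewrite !inE; have [] := mem4 e.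
  by case: (e \in K); case: (e \in T0); case: (e \in F0); case: (e \in R).
have allE : [set: edge G] = (P :|: F) :|: R.
  apply/setP=> e; rewrite !inE; have [] := mem4 e.
  by case: (e \in K); case: (e \in T0); case: (e \in F0); case: (e \in R).
have evP v : ~~ odd (degree P v).
  by rewrite degreeU // oddD Kodd inE addbb.
have cP : econn (@end1 G) (@end2 G) (2 * m - 1) P.
  by move=> A A0 AT; apply: leq_trans (cP0 A A0 AT) (dl_sub _ _ _ (subsetUl _ _)).
have cF : econn (@end1 G) (@end2 G) (3 * k - 3) F.
  by move=> A A0 AT; apply: leq_trans (cF0 A A0 AT) (dl_sub _ _ _ (subsetUl _ _)).
have FX : F \subset cross_edges (@end1 G) (@end2 G) X.
  by rewrite subUset F0X (subset_trans (subsetDl _ _) T0X).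
have [Q [Ts [QP Ts1 Ts2 degQ]]] := even_split r hm V2 evP cP.
have [x0 [l0 [sumf x0Y x0X]]] := compatible_sum X hf.
(* With [k - 1] edges in [R], every residue is attained by some [s]. Otherwise [R] holds all
   non-crossing edges, so [xq X Q] is 0 and the range of [x0] given by compatibility is exactly what
   [R] can realise. *)
have [s sR [l sE]] : exists2 s, s <= #|R| & exists l : int,
    (Posz s - Posz #|R :&: inY X| = x0 - xq X Q + l * Posz k)%R.
  case: Rfull => [cRk|Rall].
    pose z := (x0 - xq X Q + Posz #|R :&: inY X|)%R.
    have z0 : (0 <= z %% Posz k)%Z%R by apply: modz_ge0; move: hk; clear; lia.
    have zk : ((z %% Posz k)%Z < Posz k)%R by apply: ltz_pmod; move: hk; clear; lia.
    have zE := divz_eq z (Posz k); rewrite {1}/z in zE.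
    exists (absz (z %% Posz k)%Z); first by rewrite cRk; move: z0 zk; clear; lia.
    exists (- (z %/ Posz k)%Z)%R; move: zE z0.
    by set d := (_ %/ _)%Z; set w := (_ %% _)%Z; clear; lia.
  have Q0 (D : {set edge G}) : D \subset ~: cross_edges (@end1 G) (@end2 G) X -> Q :&: D = set0.
    move=> DX; apply/setP=> e; rewrite !inE; apply/negP=> /andP[eQ /(subsetP DX)].
    rewrite -Rall => eR; have : e \in P :|: F by rewrite inE (subsetP QP).
    by move=> ePF; rewrite (disjointFr dPFR ePF) in eR.
  have inXs : inX X \subset ~: cross_edges (@end1 G) (@end2 G) X.
    by apply/subsetP=> e; rewrite !inE; case: (end1 e \in X); case: (end2 e \in X).
  have inYs : inY X \subset ~: cross_edges (@end1 G) (@end2 G) X.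
    by apply/subsetP=> e; rewrite !inE; case: (end1 e \in X); case: (end2 e \in X).
  have RY : R :&: inY X = inY X by rewrite Rall; apply/setIidPr.
  have cRXY : #|R| = #|inX X| + #|inY X|.
    rewrite -(cardsID (inX X) R); congr (_ + _).
      by congr #|pred_of_set _|; rewrite Rall; apply/setIidPr.
    apply: eq_card => e; rewrite Rall !inE.
    by case: (end1 e \in X); case: (end2 e \in X).
  exists (absz (x0 + Posz #|inY X|)%R); first by rewrite cRXY; move: x0Y x0X; clear; lia.
  exists 0%R; rewrite /xq !Q0 // cards0 RY; move: x0Y; clear; lia.
have [I IR xI] := sub_xq RX sR.
have [|H HF Hdeg] := @completion G k X F R I
    (fun v => Posz (f v) - Posz (degree Q v))%R hk FX RX IR cR cF.
  exists (l0 - 2 * l)%R; rewrite xI sE.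
  have -> : (\sum_v sgn X v (Posz (f v) - Posz (degree Q v)) =
      \sum_v sgn X v (Posz (f v)) - \sum_v sgn X v (Posz (degree Q v)))%R.
    by rewrite -sumrB; apply: eq_bigr => v _; rewrite /sgn; case: ifP => _; clear; lia.
  by rewrite sum_sgn_degree sumf; clear; lia.
have dQH : [disjoint Q & H].
  by apply: disjointWl QP _; apply: disjointWr HF _.
have dQHI : [disjoint Q :|: H & I].
  apply: disjointWr IR _; apply: disjointWl dPFR.
  by apply: setUSS.
have degH v : degree ((Q :|: H) :|: I) v = degree Q v + (degree H v + degree I v).
  by rewrite !degreeU // addnA.
exists ((Q :|: H) :|: I); split.
- have : forall i : 'I_m, exists2 S : {set edge G}, S \subset Ts i & spanning_tree S.
    move=> i; have [_ cTs] := Ts1 i (ltn_ord i).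
    by apply: spanning_subtree; exact: econn_connected.
  case/fin_all_exists2=> S S1 S2; exists S; split=> [i|i j ij].
    split=> //; apply: subset_trans (S1 i) _; have [TQ _] := Ts1 i (ltn_ord i).
    by apply: subset_trans TQ _; rewrite -setUA subsetUl.
  by apply: disjointWl (S1 i) _; apply: disjointWr (S1 j) _; apply: Ts2.
- move=> v; rewrite degH; have [[j Ej] _] := Hdeg v.
  have : (Posz (degree Q v + (degree H v + degree I v)) == Posz (f v) %[mod Posz k])%Z.
    rewrite eqz_mod_dvd; apply/dvdzP; exists j; move: Ej; clear; lia.
  by rewrite !modz_nat => /eqP [].
- have degE v : degree [set: edge G] v = degree P v + degree F v + degree R v.
    by rewrite allE (degreeU v dPFR) (degreeU v dPF).
  (* The doubled deviation [2k - 1] is odd, so rounding turns it into [k - 1] below the floor and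
     above the ceiling. *)
  move=> v; rewrite degH degE; have [_ [lo hi]] := Hdeg v; have := degQ v.
  move: lo hi hk; move: (degree P v) (degree F v) (degree R v) (degree Q v) => a1 a2 a3 a4.
  by move: (degree H v + degree I v) => a5; clear; lia.
Qed.
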